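(* Let $k\geq 5$ be an integer, and let $\mathcal{S}_{k}$ be the class of matroids isomorphic to minors of spikes $L(\Delta_{r},\mathcal{B})$ (for any $r\geq 3$) where $\mathcal{B}$ contains at most $k$ Hamiltonian cycles. Then $\mathcal{S}_{k}$ is weakly fractal, but is not strongly fractal.
   Context: Graphs may have loops and parallel edges. A theta-subgraph of a graph $G$ consists of two distinct vertices $u,v$ and three $u$–$v$ paths that are internally vertex-disjoint. A linear class is a collection $\mathcal{B}$ of cycles of $G$ such that no theta-subgraph of $G$ contains exactly two cycles of $\mathcal{B}$; cycles in $\mathcal{B}$ are balanced, others unbalanced. The lift matroid $L(G,\mathcal{B})$ has ground set $E(G)$, and $X\subseteq E(G)$ is a circuit iff $G[X]$ is a balanced cycle, an unbalanced theta-subgraph (one containing an unbalanced cycle), or the union of two unbalanced cycles sharing at most one vertex. For $r\geq 3$, $\Delta_{r}$ is the graph obtained from a cycle with $r$ edges by replacing each edge by a parallel pair; a (tipless) spike is a matroid $L(\Delta_{r},\mathcal{B})$ with $\mathcal{B}$ a linear class of Hamiltonian cycles of $\Delta_{r}$. For a minor-closed class $\mathcal{M}$ containing infinitely many matroids, let $m_{n}$ be the number of isomorphism classes of $n$-element matroids in $\mathcal{M}$ and $x_{n}$ the number of isomorphism classes of $n$-element excluded minors for $\mathcal{M}$; set $\Gamma_{\mathcal{M}}(n)=x_{n}/(m_{n}+x_{n})$. $\mathcal{M}$ is strongly fractal if $\lim_{n\to\infty}\Gamma_{\mathcal{M}}(n)=1$, and weakly fractal if the sequence $\Gamma_{\mathcal{M}}(1),\Gamma_{\mathcal{M}}(2),\ldots$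 has an infinite subsequence converging to $1$.
   Formalization: The theta-subgraphs that are circuits of L(G,B) are taken to be those all of whose cycles are unbalanced; with ''containing an unbalanced cycle'' a theta could properly contain a balanced cycle, so the listed sets would not be the circuits of a matroid. *)

(* Defs.v *)
From HB Require Import structures.
(* [finset] comes after [classical_sets], so that [set0], [setU11], etc. refer
   to finite sets. *)
From mathcomp Require Import boolp classical_sets reals topology sequences.
From mathcomp Require Import normedtype.
From mathcomp Require Import all_boot all_order all_algebra.

Set Implicit Arguments.
Unset Strict Implicit.
Unset Printing Implicit Defensive.

Import Order.TTheory GRing.Theory Num.Theory.
Import numFieldNormedType.Exports.

Local Open Scope set_scope.

(** * Matroids *)

Definition matroid_axiom (E : finType) (I : {set {set E}}) : bool :=
  [&& set0 \in I,
      [forall A in I, forall B : {set E}, (B \subset A) ==> (B \in I)] &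
      [forall A in I, forall B in I,
        (#|A| < #|B|) ==> [exists x in B :\: A, x |: A \in I]]].

(* The ground set of a [matroid E] is the whole finite type [E]. *)
Record matroid (E : finType) := Matroid {
  indep : {set {set E}};
  _ : matroid_axiom indep }.

HB.instance Definition _ (E : finType) := [isSub for @indep E].
HB.instance Definition _ (E : finType) := [Finite of matroid E by <:].

Lemma indepP (E : finType) (M : matroid E) :
  [/\ set0 \in indep M,
      forall A B : {set E}, A \in indep M -> B \subset A -> B \in indep M &
      forall A B : {set E}, A \in indep M -> B \in indep M -> #|A| < #|B| ->
        exists2 x, x \in B :\: A & x |: A \in indep M].
Proof.
case: M => I /= /and3P[I0 /forall_inP I1 /forall_inP I2]; split=> //.
  by move=> A B AI BA; exact: (implyP (forallP (I1 A AI) B)).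
by move=> A B AI BI AB; apply/exists_inP/(implyP (forall_inP (I2 A AI) B BI)).
Qed.

Definition circuit (E : finType) (M : matroid E) (X : {set E}) : bool :=
  minset (fun Y : {set E} => Y \notin indep M) X.

Definition basis_in (E : finType) (M : matroid E) (X B : {set E}) : bool :=
  maxset (fun A : {set E} => (A \in indep M) && (A \subset X)) B.

Definition matroid_iso (E F : finType) (M : matroid E) (N : matroid F) : Prop :=
  exists2 f : E -> F, bijective f &
    forall A : {set E}, (f @: A \in indep N) = (A \in indep M).

Definition minor_ground (E : finType) (C D : {set E}) : finType :=
  {x : E | x \in ~: (C :|: D)}.

(* The independent sets of M / C \ D: those sets whose union with some (or
   equivalently every) basis of M | C is independent in M. *)
Definition minor_indep (E : finType) (M : matroid E) (C D : {set E}) :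
    {set {set minor_ground C D}} :=
  [set A : {set minor_ground C D} |
    [exists B : {set E}, basis_in M C B && (val @: A :|: B \in indep M)]].

Lemma minor_indep_axiom (E : finType) (M : matroid E) (C D : {set E}) :
  matroid_axiom (minor_indep M C D).
Proof.
have [I0 Isub Iaug] := indepP M.
have cardB B1 B2 : basis_in M C B1 -> basis_in M C B2 -> #|B1| <= #|B2|.
  move=> b1 b2; rewrite leqNgt; apply/negP => lt21.
  have /andP[B1I B1C] := maxsetp b1; have /andP[B2I B2C] := maxsetp b2.
  have [x /setDP[xB1 xB2] xI] := Iaug _ _ B2I B1I lt21.
  have xC : x |: B2 \subset C by rewrite subUset sub1set B2C (subsetP B1C).
  have /(maxsetsup b2) : (x |: B2 \in indep M) && (x |: B2 \subset C).
    by rewrite xI xC.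
  by move=> /(_ (subsetUr _ _)) eB; rewrite -eB setU11 in xB2.
have dis (A : {set minor_ground C D}) B :
    basis_in M C B -> #|val @: A :|: B| = #|A| + #|B|.
  move=> b; have /andP[_ BC] := maxsetp b.
  rewrite cardsU card_imset; last exact: val_inj.
  suff -> : (val @: A) :&: B = set0 by rewrite cards0 subn0.
  apply/setP=> x; rewrite !inE; apply/negP => /andP[/imsetP[y _ ->]].
  move=> /(subsetP BC) yC; have := valP y; rewrite !inE negb_or.
  by move=> /andP[]; rewrite yC.
apply/and3P; split.
- have [B b _] : {B | basis_in M C B & set0 \subset B}.
    by apply: maxset_exists; rewrite I0 sub0set.
  rewrite inE; apply/existsP; exists B; rewrite b imset0 set0U.
  by case/andP: (maxsetp b).
- apply/forall_inP => A; rewrite inE => /existsP[B /andP[b AI]].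
  apply/forallP => A'; apply/implyP => sA; rewrite inE; apply/existsP; exists B.
  by rewrite b; apply: Isub AI _; rewrite setSU// imsetS.
- apply/forall_inP => A1; rewrite inE => /existsP[B1 /andP[b1 I1]].
  apply/forall_inP => A2; rewrite inE => /existsP[B2 /andP[b2 I2]].
  apply/implyP => lt12.
  have [|x /setDP[]] := Iaug _ _ I1 I2.
    by rewrite !dis// -addSn leq_add// cardB.
  rewrite !inE negb_or => /orP[/imsetP[y yA2 ->]|xB2] /andP[xA1 xB1] xI.
    apply/exists_inP; exists y.
      by rewrite !inE yA2 andbT; apply: contra xA1; exact: imset_f.
    rewrite inE; apply/existsP; exists B1; rewrite b1.
    by rewrite imsetU1 -setUA.
  have /andP[_ B1C] := maxsetp b1; have /andP[_ B2C] := maxsetp b2.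
  have /(maxsetsup b1) : (x |: B1 \in indep M) && (x |: B1 \subset C).
    rewrite subUset sub1set B1C (subsetP B2C)//= andbT.
    by apply: Isub xI _; rewrite setUS// subsetUr.
  by move=> /(_ (subsetUr _ _)) eB; rewrite -eB setU11 in xB1.
Qed.

Definition minor (E : finType) (M : matroid E) (C D : {set E}) :
    matroid (minor_ground C D) :=
  Matroid (minor_indep_axiom M C D).

(** * Classes of matroids and fractality *)

Definition matroid_class := forall E : finType, matroid E -> Prop.

Definition excluded_minor (P : matroid_class) : matroid_class :=
  fun E M => ~ P E M /\
    forall C D : {set E}, [disjoint C & D] -> C :|: D != set0 ->
      P _ (minor M C D).

(* Every n-element matroid is isomorphic to one on ['I_n]. *)
Definition num_iso_classes (P : matroid_class) (n : nat) : nat :=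
  #|equivalence_partition (fun M N : matroid 'I_n => `[< matroid_iso M N >])
      [set M : matroid 'I_n | `[< P _ M >]]|.

Definition Gamma (R : realType) (P : matroid_class) (n : nat) : R :=
  let m := num_iso_classes P n in
  let x := num_iso_classes (excluded_minor P) n in
  (x%:R / (m + x)%:R)%R.

Definition strongly_fractal (R : realType) (P : matroid_class) : Prop :=
  (Gamma R P n @[n --> \oo] --> (1%R : R))%classic.

Definition weakly_fractal (R : realType) (P : matroid_class) : Prop :=
  exists s : nat -> nat,
    [/\ increasing_seq s, 0 < s 0 &
        (Gamma R P (s i) @[i --> \oo] --> (1%R : R))%classic].

(** * Graphs, possibly with loops and parallel edges *)

(* A loop is an edge whose set of ends is a singleton. *)
Record mgraph (V E : finType) := MGraph {
  ends : E -> {set V};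
  _ : forall e, 0 < #|ends e| <= 2 }.

Section Graphs.
Variables (V E : finType) (G : mgraph V E).

Definition vertices (X : {set E}) : {set V} := \bigcup_(e in X) ends G e.

(* A walk from [u] is the list of its steps, each given by the edge traversed
   and the vertex reached. *)
Fixpoint walk (u : V) (p : seq (E * V)) : bool :=
  if p is (e, w) :: p' then (ends G e == [set u; w]) && walk w p' else true.

Definition walk_edges (p : seq (E * V)) : {set E} := [set e in unzip1 p].

Definition is_path (u v : V) (p : seq (E * V)) : bool :=
  [&& walk u p, last u (unzip2 p) == v & uniq (u :: unzip2 p)].

Definition inner_vertices (u v : V) (p : seq (E * V)) : {set V} :=
  [set x in unzip2 p] :\: [set u; v].

(* Cycles are identified with their edge sets; likewise theta-subgraphs. *)
Definition is_cycle (X : {set E}) : Prop :=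
  exists u p,
    [/\ p != [::], walk u p, last u (unzip2 p) = u,
        uniq (unzip1 p) && uniq (unzip2 p) & X = walk_edges p].

(* Distinctness of the paths matters only for paths with a single edge, which
   have no inner vertices. *)
Definition is_theta (X : {set E}) : Prop :=
  exists u v p1 p2 p3,
    [/\ u != v,
        [&& is_path u v p1, is_path u v p2 & is_path u v p3],
        [&& p1 != p2, p1 != p3 & p2 != p3],
        [&& [disjoint inner_vertices u v p1 & inner_vertices u v p2],
            [disjoint inner_vertices u v p1 & inner_vertices u v p3] &
            [disjoint inner_vertices u v p2 & inner_vertices u v p3]] &
        X = walk_edges p1 :|: walk_edges p2 :|: walk_edges p3].

Definition is_hamiltonian_cycle (X : {set E}) : Prop :=
  is_cycle X /\ vertices X = [set: V].

Definition linear_class (B : {set {set E}}) : Prop :=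
  (forall C, C \in B -> is_cycle C) /\
  (forall X, is_theta X -> #|[set C in B | C \subset X]| <> 2).

Definition balanced_cycle (B : {set {set E}}) (X : {set E}) : Prop :=
  is_cycle X /\ X \in B.

Definition unbalanced_cycle (B : {set {set E}}) (X : {set E}) : Prop :=
  is_cycle X /\ X \notin B.

(* The theta-subgraphs that are circuits are those all of whose cycles are
   unbalanced: a theta-subgraph with both balanced and unbalanced cycles
   properly contains a circuit, namely its balanced cycle. In the last case the
   two cycles are distinct, since a loop meets itself in a single vertex. *)
Definition lift_circuit (B : {set {set E}}) (X : {set E}) : Prop :=
  [\/ balanced_cycle B X,
      is_theta X /\
        (forall C, is_cycle C -> C \subset X -> unbalanced_cycle B C) |
      exists C1 C2,
        [/\ unbalanced_cycle B C1, unbalanced_cycle B C2, C1 != C2,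
            #|vertices C1 :&: vertices C2| <= 1 & X = C1 :|: C2]].

(* [L] is the matroid L(G, B): a matroid is determined by its circuits. *)
Definition is_lift_matroid (B : {set {set E}}) (L : matroid E) : Prop :=
  forall X : {set E}, circuit L X <-> lift_circuit B X.

End Graphs.

(** * Spikes *)

Definition Delta_ends (r : nat) (e : 'I_r * bool) : {set 'I_r} :=
  [set e.1; ordS e.1].

Lemma Delta_ends_card r (e : 'I_r * bool) : 0 < #|Delta_ends e| <= 2.
Proof. by rewrite /Delta_ends cards2; case: eqP. Qed.

(* The cycle on ['I_r] with the edge from i to i + 1 mod r doubled. *)
Definition Delta (r : nat) : mgraph 'I_r ('I_r * bool)%type :=
  MGraph (@Delta_ends_card r).

(* Membership of [M] in S_k. *)
Definition spike_minor_class (k : nat) : matroid_class :=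
  fun E M =>
    exists (r : nat) (B : {set {set 'I_r * bool}})
           (L : matroid ('I_r * bool)%type) (C D : {set 'I_r * bool}),
      [/\ 3 <= r,
          linear_class (Delta r) B /\
            (forall H, H \in B -> is_hamiltonian_cycle (Delta r) H),
          #|B| <= k,
          is_lift_matroid (Delta r) B L &
          [disjoint C & D] /\ matroid_iso (minor L C D) M].

(* Main.v *)
Require Import Defs.
From mathcomp Require Import boolp classical_sets reals topology sequences.
From mathcomp Require Import normedtype.
From mathcomp Require Import all_boot all_order all_algebra.
From mathcomp Require Import perm.
From mathcomp Require Import zify.

(** A minor of a spike is described by a partition of its elements into legs
    (pairs), tips and singles, two flags, and a set of words, i.e. of
    transversals of the legs containing all the singles. The flags tell whether
    the underlying graph is still a cycle and whether no unbalanced loop was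
    contracted. As soon as there are at least ten legs, the independent sets with
    at most four elements determine the partition, so that the number of words
    is an invariant of the matroid.

    Hence a spike with k + 1 words in which no element lies in all of the words
    or in none of them is an excluded minor. Up to isomorphism there are about
    t ^ (2 ^ k - 2) of them with t legs, whereas the class itself contains only
    about t ^ (2 ^ (k - 1) + 1) matroids with as many elements: this is weak
    fractality along the even integers.

    On the other hand, let M be a large excluded minor. If some M \ e has many
    legs, then comparing the descriptions of M \ e, M \ f and M \ g for f and g
    in distinct legs shows that M itself is described in the same way, and that
    it has more than k words; deleting a tip or contracting a single does not
    change the number of words, so there are neither tips nor singles and M has
    an even number of elements. If no M \ e has many legs, then either M \ e has
    many tips, so that M has a large parallel class, or M / e has many singles,
    so that M has a large series class; in both cases one more parallel or series
    element can be added to the description of M \ x or M / x, and M belongs to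
    the class. So there is no large excluded minor of odd size. *)

Set Implicit Arguments.
Unset Strict Implicit.
Unset Printing Implicit Defensive.

Import Order.TTheory GRing.Theory Num.Theory.
Import numFieldNormedType.Exports.

Local Open Scope set_scope.

(** * Spike-like structures *)

(** Minors of spikes are no longer lift matroids of some [Delta r], so graphs are left behind for
    structures closed under minors. Conversely each matroid with such a structure is a minor of a
    spike, so membership in the class is a bound on the number of words. The linear class condition
    survives as: no two words differ in exactly one leg. Uniqueness rests on the fact that four
    elements cannot span when there are ten legs, so that neither words nor the cycle influence
    their independence. The obstacle for an excluded minor is that only its proper minors come with
    structures, each chosen independently; uniqueness makes the choices compatible, and each
    comparison costs at most one leg, whence the thresholds 24, 22 and 20 on the number of leg
    elements. The exponents differ because one more word doubles the number of membership patterns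
    of a leg: relative to a first word, k words leave 2^(k-1) patterns and k + 1 words leave 2^k, of
    which the zero pattern is excluded and the constant one serves to keep the number of legs
    fixed. *)

(* [mate] exchanges the two elements of a leg and fixes tips and singles.
   Contracting an element of a leg turns its mate into a tip, i.e. an unbalanced
   loop; contracting such a loop clears [lifted], and the remaining tips are then
   matroid loops. Deleting a single, i.e. cutting the cycle, clears [cyclical],
   and the remaining singles are then coloops. Words are given as sets of edges. *)
Record spikelike (E : finType) := Spikelike {
  ground : {set E};
  mate : E -> E;
  tips : {set E};
  lifted : bool;
  cyclical : bool;
  words : {set {set E}} }.

Section Spikelike.
Variables (E : finType) (s : spikelike E).
Implicit Types (X Y w : {set E}) (x y : E).

(* The elements of the unbalanced cycles of length at most two contained in X. *)
Definition full X : {set E} :=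
  [set x in X | (mate s x \in X) && ((x \in tips s) || (mate s x != x))].

Definition one_unit X : bool :=
  [forall x in full X, forall y in full X, (y == x) || (y == mate s x)].

Definition spans X : bool :=
  [forall x in ground s :\: tips s, (x \in X) || (mate s x \in X)].

(** In the lifted case one unbalanced cycle is allowed, but no word and no second cycle: a spanning
    set with a full unit contains a theta, or a tip together with a spanning cycle. In the unlifted
    case the matroid is the cycle matroid of the graph, where words no longer matter. *)
Definition sindep X : bool :=
  if lifted s then
    one_unit X &&
      (cyclical s && spans X ==> (full X == set0) && (X \notin words s))
  else (full X == set0) && ~~ (cyclical s && spans X).

Definition transversal_set X : bool :=
  [&& X \subset ground s :\: tips s, spans X & full X == set0].

(** [wf_dist] is the linear class condition: the union of two transversals that differ in one leg is
    a theta, whose third cycle is that leg and is unbalanced. *)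
Record wf : Prop := Wf {
  wf_inv : involutive (mate s);
  wf_out : forall x, x \notin ground s -> mate s x = x;
  wf_tip : tips s \subset ground s;
  wf_tipm : forall x, x \in tips s -> mate s x = x;
  wf_words : forall w, w \in words s -> transversal_set w;
  wf_dist : forall w x, w \in words s -> x \in w -> mate s x != x ->
    mate s x |: (w :\ x) \notin words s }.

Lemma fullP X x :
  reflect [/\ x \in X, mate s x \in X & (x \in tips s) \/ (mate s x <> x)]
          (x \in full X).
Proof.
rewrite inE; apply: (iffP and3P) => -[-> -> h]; split=> //.
  by case/orP: h => [->|/eqP]; [left|right].
by case: h => [->//|/eqP ->]; rewrite orbT.
Qed.

Lemma full_mono X Y : X \subset Y -> full X \subset full Y.
Proof.
move=> sXY; apply/subsetP => x /fullP[a b c]; apply/fullP; split=> //;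
  exact: (subsetP sXY).
Qed.

Lemma one_unitP X :
  reflect (forall x y, x \in full X -> y \in full X -> y = x \/ y = mate s x)
          (one_unit X).
Proof.
apply: (iffP forall_inP) => [H x y xf yf | H x xf].
  by case/orP: (forall_inP (H x xf) y yf) => /eqP; [left|right].
by apply/forall_inP => y yf; case: (H x y xf yf) => ->; rewrite eqxx ?orbT.
Qed.

Lemma one_unit_mono X Y : X \subset Y -> one_unit Y -> one_unit X.
Proof.
move=> sXY /one_unitP H; apply/one_unitP => x y xf yf.
by apply: H; apply: (subsetP (full_mono sXY)).
Qed.

Lemma full0_one X : full X = set0 -> one_unit X.
Proof. by move=> f0; apply/one_unitP => x y; rewrite f0 inE. Qed.

Lemma spansP X :
  reflect (forall x, x \in ground s -> x \notin tips s ->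
             x \in X \/ mate s x \in X) (spans X).
Proof.
apply: (iffP forall_inP) => [H x xg xt|H x].
  by apply/orP/H; rewrite inE xt.
by rewrite inE => /andP[xt xg]; apply/orP/H.
Qed.

Lemma spansPn X : ~~ spans X ->
  exists x, [/\ x \in ground s, x \notin tips s, x \notin X & mate s x \notin X].
Proof.
case/forall_inPn => x; rewrite inE => /andP[xt xg]; rewrite negb_or => /andP[a b].
by exists x.
Qed.

Lemma spansN X x : x \in ground s -> x \notin tips s -> x \notin X ->
  mate s x \notin X -> spans X = false.
Proof.
by move=> xg xt xX mX; apply/negP => /spansP /(_ x xg xt)[]; apply/negP.
Qed.

Lemma mate_ground x : wf -> (mate s x \in ground s) = (x \in ground s).
Proof.
move=> W; have inv := wf_inv W.
case: (boolP (x \in ground s)) => [xg|xg]; last by rewrite (wf_out W xg) (negPf xg).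
apply/negPn/negP => h; have := wf_out W h; rewrite inv => e.
by rewrite -e xg in h.
Qed.

Lemma mate_tips x : wf -> (mate s x \in tips s) = (x \in tips s).
Proof.
move=> W; have inv := wf_inv W; case: (boolP (x \in tips s)) => [xt|xt].
  by rewrite (wf_tipm W xt).
by apply/negP => h; move: (wf_tipm W h); rewrite inv => e; rewrite -e (negPf xt) in h.
Qed.

Lemma mate_full X x : wf -> (mate s x \in full X) = (x \in full X).
Proof.
move=> W; rewrite !inE (wf_inv W) (mate_tips _ W) andbCA.
by rewrite [x == _]eq_sym.
Qed.

End Spikelike.


(** * Morphisms of structures and transport along injections *)

Record smorph (E F : finType) (s : spikelike E) (t : spikelike F)
    (g : E -> F) : Prop := Smorph {
  sm_inj : {in ground s &, injective g};
  sm_surj : forall y, y \in ground t -> exists2 x, x \in ground s & y = g x;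
  sm_in : forall x, x \in ground s -> g x \in ground t;
  sm_mateg : forall x, x \in ground s -> mate s x \in ground s;
  sm_mate : forall x, x \in ground s -> mate t (g x) = g (mate s x);
  sm_tips : forall x, x \in ground s -> (g x \in tips t) = (x \in tips s);
  sm_lifted : lifted t = lifted s;
  sm_cyclical : cyclical t = cyclical s }.

Section Morphisms.
Variables (E F : finType) (s : spikelike E) (t : spikelike F) (g : E -> F).
Hypothesis sm : smorph s t g.
Variable X : {set E}.
Hypothesis sX : X \subset ground s.

Lemma sm_mem x : x \in ground s -> (g x \in g @: X) = (x \in X).
Proof.
move=> xg; apply/imsetP/idP => [[y yX e]|xX]; last by exists x.
by rewrite (sm_inj sm xg (subsetP sX _ yX) e).
Qed.

Lemma sm_paired x : x \in ground s -> (mate t (g x) != g x) = (mate s x != x).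
Proof.
move=> xg; rewrite (sm_mate sm)//; congr (~~ _).
by apply/eqP/eqP => [/(sm_inj sm (sm_mateg sm xg) xg)->|->].
Qed.

Lemma sm_fullE x : x \in ground s -> (g x \in full t (g @: X)) = (x \in full s X).
Proof.
move=> xg; rewrite /full inE [in RHS]inE sm_paired// (sm_tips sm)//.
by rewrite (sm_mate sm)// !sm_mem// (sm_mateg sm).
Qed.

Let fs x : x \in full s X -> x \in ground s.
Proof. by case/fullP => xX _ _; exact: (subsetP sX). Qed.

Let ft y : y \in full t (g @: X) -> exists2 x, x \in full s X & y = g x.
Proof.
move=> yf; have /fullP[/imsetP[x xX e] _ _] := yf.
by exists x => //; rewrite -sm_fullE ?(subsetP sX)// -e.
Qed.

Lemma sm_full0 : (full t (g @: X) == set0) = (full s X == set0).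
Proof.
apply/set0Pn/set0Pn => [[y /ft[x xf _]]|[x xf]]; first by exists x.
by exists (g x); rewrite sm_fullE ?fs.
Qed.

Lemma sm_one : one_unit t (g @: X) = one_unit s X.
Proof.
apply/one_unitP/one_unitP => H x y.
  move=> xf yf; case: (H (g x) (g y)); rewrite ?sm_fullE ?fs//.
    by move/(sm_inj sm) => /(_ (fs yf) (fs xf)); left.
  rewrite (sm_mate sm) ?fs// => /(sm_inj sm) => /(_ (fs yf) (sm_mateg sm (fs xf))).
  by right.
case/ft => x' xf -> /ft[y' yf ->]; case: (H _ _ xf yf) => ->; first by left.
by right; rewrite (sm_mate sm)// fs.
Qed.

Lemma sm_spans : spans t (g @: X) = spans s X.
Proof.
apply/spansP/spansP => H x xg xt.
  case: (H (g x)); rewrite ?(sm_in sm) ?(sm_tips sm)// ?(sm_mate sm)// ?sm_mem//.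
  - by left.
  - by right.
  - exact: (sm_mateg sm).
case: (sm_surj sm xg) => x' xg' e; subst x.
rewrite (sm_mate sm)// !sm_mem// ?(sm_mateg sm)//.
by apply: H => //; rewrite -(sm_tips sm).
Qed.

Lemma sm_trans : transversal_set t (g @: X) = transversal_set s X.
Proof.
rewrite /transversal_set sm_full0 sm_spans; congr (_ && _).
apply/subsetP/subsetP => H x.
  move=> xX; have xg := subsetP sX _ xX.
  have := H (g x); rewrite sm_mem// !inE (sm_tips sm)// xg => /(_ xX) /andP[->].
  by [].
case/imsetP => z zX ->; have := H z zX; rewrite !inE => /andP[zt zg].
by rewrite (sm_tips sm)// zt (sm_in sm).
Qed.

(** Words need only be compared on transversals: a spanning set without full unit contains no tip, a
    tip being full by itself, and so is a transversal. This is why [smorph] is silent about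
    words. *)
Lemma sm_sindep : wf s ->
  (lifted s -> cyclical s -> transversal_set s X ->
    (g @: X \in words t) = (X \in words s)) ->
  sindep t (g @: X) = sindep s X.
Proof.
move=> Ws gw.
rewrite /sindep (sm_lifted sm) (sm_cyclical sm) sm_one sm_spans sm_full0.
case: ifP => // lt; congr (_ && _).
case: (boolP (cyclical s && spans s X)) => //= /andP[cs sp].
case: (boolP (full s X == set0)) => //= f0.
case: (boolP (X \subset ground s :\: tips s)) => [st|].
  by rewrite gw// /transversal_set st sp f0.
case/subsetPn => z zX; rewrite inE (subsetP sX _ zX) andbT negbK => zt.
suff : z \in full s X by rewrite (eqP f0) inE.
apply/fullP; split=> //; first by rewrite (wf_tipm Ws).
by left.
Qed.

End Morphisms.

Section Transport.
Variables (E F : finType) (g : F -> E).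
Hypothesis ginj : injective g.

Let ginv y := [pick x | g x == y].
Let ginvK x : ginv (g x) = Some x.
Proof.
rewrite /ginv; case: pickP => [z /eqP/ginj ->//|/(_ x)]; by rewrite eqxx.
Qed.

(** The default [x] of the mate is never reached when [s] is well formed and its ground set is the
    image of [g], since that image is then closed under mates. *)
Definition pull (s : spikelike E) : spikelike F := Spikelike
  setT (fun x => odflt x (ginv (mate s (g x)))) (g @^-1: tips s)
  (lifted s) (cyclical s) [set X : {set F} | g @: X \in words s].

Section Pull.
Variable s : spikelike E.
Hypotheses (Ws : wf s) (gs : forall y, (y \in ground s) = (y \in codom g)).

Let gin x : g x \in ground s. Proof. by rewrite gs codom_f. Qed.

Lemma pull_mate x : mate s (g x) = g (mate (pull s) x).
Proof.
rewrite /=; have : mate s (g x) \in ground s by rewrite mate_ground.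
by rewrite gs => /codomP[z ->]; rewrite ginvK.
Qed.

Lemma pull_smorph : smorph (pull s) s g.
Proof.
split=> //.
- by move=> x y _ _; exact: ginj.
- by move=> y; rewrite gs => /codomP[x ->]; exists x; rewrite ?inE.
- by move=> x _; exact: pull_mate.
- by move=> x _; rewrite inE.
Qed.

Lemma pull_wf : wf (pull s).
Proof.
split=> //.
- by move=> x; apply: ginj; rewrite -!pull_mate (wf_inv Ws).
- by move=> x; rewrite inE.
- exact: subsetT.
- by move=> x; rewrite inE => xt; apply: ginj; rewrite -pull_mate (wf_tipm Ws).
- move=> w; rewrite inE => /(wf_words Ws).
  by rewrite (sm_trans pull_smorph) ?subsetT.
- move=> w x; rewrite !inE => wW xw xm.
  have : g x \in g @: w by exact: imset_f.
  move/(wf_dist Ws wW); rewrite pull_mate.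
  rewrite (inj_eq ginj) => /(_ xm).
  suff -> : g @: (mate (pull s) x |: w :\ x) =
    g (mate (pull s) x) |: g @: w :\ g x by [].
  rewrite imsetU1; congr (_ |: _); apply/setP => y; rewrite !inE.
  apply/imsetP/andP => [[z]|[yx /imsetP[z zw e]]].
    by rewrite !inE => /andP[zx zw] ->; rewrite (inj_eq ginj) zx imset_f.
  by exists z => //; rewrite !inE zw andbT; apply: contra yx => /eqP <-; rewrite e.
Qed.

Lemma pull_sindep (X : {set F}) : sindep (pull s) X = sindep s (g @: X).
Proof.
rewrite (sm_sindep pull_smorph) ?subsetT//; first exact: pull_wf.
by move=> _ _ _; rewrite inE.
Qed.

Lemma pull_words : #|words (pull s)| <= #|words s|.
Proof.
rewrite -(card_imset _ (imset_inj ginj)); apply: subset_leq_card.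
by apply/subsetP => w /imsetP[X]; rewrite inE => ? ->.
Qed.

End Pull.

Definition push (t : spikelike F) : spikelike E := Spikelike
  (g @: setT) (fun y => if ginv y is Some x then g (mate t x) else y)
  (g @: tips t) (lifted t) (cyclical t) [set g @: w | w : {set F} in words t].

Section Push.
Variable t : spikelike F.
Hypotheses (Wt : wf t) (gt : ground t = setT).

Lemma push_mate x : mate (push t) (g x) = g (mate t x).
Proof. by rewrite /= ginvK. Qed.

Lemma push_smorph : smorph t (push t) g.
Proof.
split=> //.
- by move=> x y _ _; exact: ginj.
- by move=> y /imsetP[x _ ->]; exists x; rewrite ?gt ?inE.
- by move=> x _; apply: imset_f; rewrite inE.
- by move=> x _; rewrite gt inE.
- by move=> x _; exact: push_mate.
- by move=> x _; rewrite /= mem_imset.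
Qed.

Lemma push_wf : wf (push t).
Proof.
have sT (X : {set F}) : X \subset ground t by rewrite gt subsetT.
have om y : y \notin g @: setT -> ginv y = None.
  by rewrite /ginv; case: pickP => // x /eqP <-; rewrite imset_f ?inE.
split=> //.
- move=> y; case: (boolP (y \in g @: setT)) => [/imsetP[x _ ->]|h].
    by rewrite !push_mate (wf_inv Wt).
  by rewrite /= (om _ h) (om _ h).
- by move=> y h; rewrite /= (om _ h).
- by rewrite /= imsetS ?subsetT.
- by move=> y /imsetP[x xt ->]; rewrite push_mate (wf_tipm Wt).
- by move=> w /imsetP[v vW ->]; rewrite (sm_trans push_smorph)//; exact: wf_words.
- move=> w y /imsetP[v vW ->] /imsetP[x xv ->].
  rewrite push_mate (inj_eq ginj) => xm; apply/negP => /imsetP[u uW e].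
  have /negP := wf_dist Wt vW xv xm; apply.
  suff <- : u = mate t x |: v :\ x by [].
  apply/setP => z; have := congr1 (fun A : {set E} => g z \in A) e.
  by rewrite !inE !(mem_imset _ _ ginj) !(inj_eq ginj) => <-.
Qed.

Lemma push_sindep (X : {set F}) : sindep (push t) (g @: X) = sindep t X.
Proof.
rewrite (sm_sindep push_smorph) ?gt ?subsetT//.
by move=> _ _ _; rewrite /= mem_imset//; exact: imset_inj.
Qed.

Lemma push_words : #|words (push t)| <= #|words t|.
Proof. exact: leq_imset_card. Qed.

End Push.
End Transport.

(** * Minors of spike-like structures *)

Section MinorStructure.
Variables (E : finType) (s : spikelike E) (C D : {set E}).

Let lifted' := lifted s && (full s C == set0).
Let cyclical' := cyclical s &&
  [forall x in ground s :\: tips s, ~~ ((x \in D) && (mate s x \in D))].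

Definition mnr : spikelike E := Spikelike
  (ground s :\: (C :|: D))
  (fun x => if (x \in C :|: D) || (mate s x \in C :|: D) then x else mate s x)
  [set x in ground s :\: (C :|: D) | (x \in tips s) || (mate s x \in C)]
  lifted' cyclical'
  (if lifted' && cyclical' then
     [set w :\: C | w in [set w in words s | (C \subset w) && [disjoint w & D]]]
   else set0).

Hypotheses (Ws : wf s) (CD : [disjoint C & D]).

Lemma mnr_mate x : x \in ground mnr ->
  mate mnr x = if mate s x \in C :|: D then x else mate s x.
Proof. by rewrite /= inE => /andP[/negPf ->]. Qed.

Lemma mnr_wf : wf mnr.
Proof.
have inv := wf_inv Ws.
have notCD x : x \in C -> x \in D -> False.
  by move=> xC xD; rewrite (disjointFr CD xC) in xD.
split.
- move=> x /=; case h: ((x \in C :|: D) || (mate s x \in C :|: D)).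
    by rewrite h.
  by rewrite inv orbC h.
- move=> x /=; rewrite inE negb_and negbK; case: (boolP (x \in _)) => //= _ xg.
  by rewrite (wf_out Ws xg) if_same.
- by apply/subsetP => x /=; rewrite inE => /andP[].
- move=> x /=; rewrite inE => /andP[_ /orP[xt|mC]].
    by rewrite (wf_tipm Ws xt) if_same.
  by rewrite [mate s x \in _]inE mC orbT.
- move=> w /=; case: ifP => [_|_]; last by rewrite inE.
  case/imsetP => v; rewrite inE => /and3P[vW Cv vD] ->.
  have /and3P[vt /spansP vs /eqP vf] := wf_words Ws vW.
  have nf x : x \in v -> mate s x != x -> mate s x \notin v.
    move=> xv xm; apply/negP => mv; suff : x \in full s v by rewrite vf inE.
    by apply/fullP; split=> //; right; apply/eqP.
  have vDn x : x \in v -> x \notin D by move=> /(disjointFr vD) ->.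
  apply/and3P; split.
  + apply/subsetP => x; rewrite !inE => /andP[xC xv].
    have := subsetP vt _ xv; rewrite !inE => /andP[xt xg].
    rewrite xg (negPf xC) (negPf xt) (negPf (vDn _ xv)) /= andbT.
    apply/negP => mC; have mv := subsetP Cv _ mC.
    have: mate s x != x by apply/eqP => e; rewrite e in mC; rewrite mC in xC.
    by move/(nf _ xv); rewrite mv.
  + apply/spansP => x /=; rewrite !inE !negb_or => /andP[/andP[xC xD] xg].
    rewrite xC xD xg /= negb_or => /andP[xt mC].
    case: (boolP (mate s x \in D)) => [mD|mD].
      rewrite orbT /=; left; case: (vs x xg xt) => // mv.
      by rewrite (negPf (vDn _ mv)) in mD.
    rewrite (negPf xC) (negPf xD) (negPf mC) /=.
    by case: (vs x xg xt) => ->; rewrite ?andbT; [left|right].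
  + apply/eqP/setP => x; rewrite !inE; apply/negP.
    case/and3P => /andP[xC xv]; have xD := vDn _ xv.
    rewrite (negPf xC) (negPf xD) /=.
    have := subsetP vt _ xv; rewrite !inE => /andP[xt xg].
    rewrite xg (negPf xt) /=; case: ifP => [h _|h].
      rewrite eqxx orbF => mC.
      have mv := subsetP Cv _ mC.
      have: mate s x != x by apply/eqP => e; rewrite e in mC; rewrite mC in xC.
      by move/(nf _ xv); rewrite mv.
    move=> /andP[/negPf -> mv] /=.
    by move/(nf _ xv); rewrite mv.
- move=> w x /=; case: ifP => [_|_]; last by rewrite inE.
  case/imsetP => v; rewrite inE => /and3P[vW Cv vD] ->.
  rewrite !inE => /andP[xC xv].
  case: ifP => // h xm; first by rewrite eqxx in xm.
  apply/negP => /imsetP[u]; rewrite inE => /and3P[uW Cu uD] e.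
  have /negP := wf_dist Ws vW xv xm; apply.
  suff <- : u = mate s x |: (v :\ x) by [].
  have mC : mate s x \notin C.
    by move/negbT: h; rewrite !negb_or => /andP[_ /andP[]].
  apply/setP => y; have := congr1 (fun A : {set E} => y \in A) e.
  rewrite !inE; case: (boolP (y \in C)) => [yC _|yC] /=; last by move=> <-.
  rewrite (subsetP Cu _ yC) (subsetP Cv _ yC) andbT.
  suff /negPf -> : y != x by rewrite orbT.
  by apply: contraNneq xC => <-.
Qed.

Lemma mnr_words_card :
  #|words mnr| <= #|[set w in words s | (C \subset w) && [disjoint w & D]]|.
Proof.
rewrite /=; case: ifP => _; last by rewrite cards0.
exact: leq_imset_card.
Qed.

(** Full units and spanning are translated separately, by [fX], [full0] and [spanE]. A dependent [C]
    is handled later, by contracting a basis of it and deleting the rest. *)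
Lemma mnr_sindep (X : {set E}) : sindep s C -> X \subset ground mnr ->
  sindep mnr X = sindep s (X :|: C).
Proof.
have inv := wf_inv Ws.
move=> iC sX.
have Xg x : x \in X -> [/\ x \in ground s, x \notin C & x \notin D].
  by move/(subsetP sX); rewrite /= !inE negb_or => /andP[/andP[]].
have XCD x : x \in X -> (x \in C :|: D) = false.
  by move=> /Xg[_ /negPf a /negPf b]; rewrite inE a b.
have mX x : x \in X -> mate mnr x = if mate s x \in C :|: D then x else mate s x.
  by move=> /(subsetP sX); exact: mnr_mate.
have CDn x : x \in C -> (x \in D) = false by exact: disjointFr.
have fX x : x \in X -> (x \in full s (X :|: C)) = (x \in full mnr X).
  move=> xX; have [xg xC xD] := Xg _ xX.
  have e1 : (x \in tips mnr) = (x \in tips s) || (mate s x \in C).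
    by rewrite /= !inE xg (negPf xC) (negPf xD).
  rewrite /full inE [in RHS]inE mX// e1 xX inE xX /= [mate s x \in X :|: C]inE.
  case: (boolP (mate s x \in C)) => [mC|mC].
    rewrite [mate s x \in C :|: D]inE mC /= xX !orbT /=.
    by apply/orP; right; apply: contraNneq xC => <-.
  rewrite [mate s x \in C :|: D]inE (negPf mC) !orbF /=.
  case: (boolP (mate s x \in D)) => // mD.
  have -> : (mate s x \in X) = false.
    by apply/negP => /Xg[_ _]; rewrite mD.
  rewrite xX eqxx orbF /=; symmetry; apply/negP => xt.
  by rewrite (wf_tipm Ws xt) (negPf xD) in mD.
have fC x : x \in C -> x \in full s (X :|: C) ->
    x \in full s C \/ (mate s x \in X).
  move=> xC /fullP[_]; rewrite inE => /orP[mX'|mC] h; first by right.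
  by left; apply/fullP.
have sub : full s C \subset full s (X :|: C) by apply: full_mono; exact: subsetUr.
have full0 : (full s (X :|: C) == set0) = (full mnr X == set0) && (full s C == set0).
  apply/eqP/andP => [e|[/eqP e1 /eqP e2]].
    split; last by move: sub; rewrite e subset0.
    apply/eqP/setP => x; rewrite [RHS]inE; apply/negP => xf.
    have /fullP[xX _ _] := xf.
    by have := fX _ xX; rewrite xf e inE.
  apply/setP => x; rewrite [RHS]inE; apply/negP => xf.
  have /fullP[] := xf; rewrite inE => /orP[xX _ _|xC _ _].
    by move: xf; rewrite fX// e1 inE.
  case: (fC _ xC xf) => [|mX']; first by rewrite e2 inE.
  have : mate s x \in full s (X :|: C) by rewrite mate_full.
  by rewrite fX// e1 inE.
have spanE : cyclical s && spans s (X :|: C) = cyclical mnr && spans mnr X.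
  rewrite /= /cyclical'; case: (cyclical s) => //=.
  apply/idP/andP => [/spansP H|[/forall_inP H1 /spansP H2]].
    split.
      apply/forall_inP => x; rewrite inE => /andP[xt xg].
      apply/negP => /andP[xD mD].
      case: (H x xg xt); rewrite inE => /orP[/Xg[_ _]|/CDn]; rewrite ?xD ?mD//.
    apply/spansP => x xg' xt'.
    move: (xg') (xt'); rewrite /= !inE => /andP[h xg].
    have [xC xD] : x \notin C /\ x \notin D by move: h; rewrite negb_or => /andP[].
    rewrite xg h /= negb_or => /andP[xt mC].
    rewrite (negPf xC) (negPf xD) (negPf mC) /=.
    case: (H x xg xt); rewrite inE.
      by rewrite (negPf xC) orbF; left.
    rewrite (negPf mC) orbF => mX'; right; have [_ _ /negPf ->] := Xg _ mX'.
    by [].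
  apply/spansP => x xg xt; rewrite !inE.
  case: (boolP (x \in C)) => [_|xC]; first by left; rewrite orbT.
  case: (boolP (mate s x \in C)) => [_|mC]; first by right; rewrite orbT.
  rewrite !orbF.
  case: (boolP (x \in D)) => xD.
    have mD : mate s x \notin D.
      by have := H1 x; rewrite inE xt xg xD => /(_ isT).
    have mg : mate s x \in ground mnr.
      by rewrite /= !inE (negPf mC) (negPf mD) mate_ground.
    have := H2 _ mg; rewrite mnr_mate// inv.
    rewrite [x \in C :|: D]inE xD orbT => h; right.
    have mt : mate s x \notin tips mnr.
      by rewrite /= !inE mate_tips// (negPf xt) inv (negPf xC) andbF.
    by case: (h mt).
  have xg' : x \in ground mnr by rewrite /= !inE (negPf xC) (negPf xD).
  have xt' : x \notin tips mnr.
    by rewrite /= !inE (negPf xt) (negPf mC) andbF.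
  case: (H2 x xg' xt') => [|]; first by left.
  by rewrite mnr_mate//; case: ifP; [left|right].
rewrite /sindep.
case: (boolP (lifted s)) => ls; last first.
  have f0 : full s C == set0 by move: iC; rewrite /sindep (negPf ls) => /andP[].
  have -> : lifted mnr = false by rewrite /= /lifted' (negPf ls).
  by rewrite full0 f0 andbT spanE.
have /andP[iC1 iC2] : one_unit s C &&
    (cyclical s && spans s C ==> (full s C == set0) && (C \notin words s)).
  by move: iC; rewrite /sindep ls.
(* If [C] has a full unit, it uses up the only one allowed, so [X] may contribute none and may not
   complete a spanning set: this is the rule for unlifted structures. *)
case: (boolP (full s C == set0)) => f0; last first.
  have -> : lifted mnr = false by rewrite /= /lifted' (negPf f0) andbF.
  rewrite full0 (negPf f0) andbF /= implybF spanE; congr (_ && _).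
  apply/eqP/one_unitP => [e x y xf yf|H].
    have inC z : z \in full s (X :|: C) -> z \in full s C.
      move=> zf; have /fullP[] := zf; rewrite inE => /orP[zX _ _|zC _ _].
        by move: zf; rewrite fX// e inE.
      case: (fC _ zC zf) => // mX'.
      have : mate s z \in full s (X :|: C) by rewrite mate_full.
      by rewrite fX// e inE.
    by move/one_unitP: iC1; apply; apply: inC.
  apply/setP => x; rewrite [RHS]inE; apply/negP => xf.
  have /fullP[xX _ _] := xf.
  have [c cf] := set0Pn _ f0.
  have /fullP[cC mC _] := cf.
  have xf' : x \in full s (X :|: C) by rewrite fX.
  have [_ xC _] := Xg _ xX.
  by case: (H c x (subsetP sub _ cf) xf') => e; move: xC; rewrite e ?cC ?mC.
have -> : lifted mnr by rewrite /= /lifted' ls f0.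
rewrite full0 f0 andbT -spanE; congr (_ && _).
  symmetry; apply/one_unitP/one_unitP => H x y xf yf.
    have /fullP[xX _ _] := xf; have /fullP[yX _ _] := yf.
    have := H x y; rewrite !fX// => /(_ xf yf)[->|e]; first by left.
    by right; rewrite mX// -e XCD.
  (* A full element of the union either lies in [X] or is the contracted mate of an element of [X],
     which is a tip of the minor. *)
  have red z : z \in full s (X :|: C) ->
      exists2 z0, z0 \in full mnr X & z = z0 \/ z = mate s z0.
    move=> zf; have /fullP[] := zf; rewrite inE => /orP[zX _ _|zC _ _].
      by exists z; [rewrite -fX|left].
    case: (fC _ zC zf) => [|mX']; first by rewrite (eqP f0) inE.
    exists (mate s z); last by right; rewrite inv.
    by rewrite -fX// mate_full.
  have [x0 xf0 hx] := red _ xf; have [y0 yf0 hy] := red _ yf.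
  have xX : x0 \in X by case/fullP: xf0.
  have h0 : y0 = x0 \/ y0 = mate s x0.
    case: (H _ _ xf0 yf0); first by left.
    by rewrite mX//; case: ifP => _; [left|right].
  by case: hx => ->; case: hy => ->; case: h0 => ->; rewrite ?inv; auto.
case: (boolP (cyclical s && spans s (X :|: C))) => //= h.
case: (full mnr X == set0) => //=.
have c' : cyclical' by move: h; rewrite spanE => /andP[].
have l' : lifted' by rewrite /lifted' ls f0.
rewrite l' c' /=; congr (~~ _).
have dX : (X :|: C) :\: C = X.
  apply/setP => x; rewrite !inE; case: (boolP (x \in C)) => [xC|xC]; rewrite ?orbF//.
  by symmetry; apply/negP => /Xg[_]; rewrite xC.
apply/imsetP/idP => [[w]|W].
  rewrite inE => /and3P[wW Cw _] e.
  suff -> : X :|: C = w by [].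
  apply/setP => y; rewrite e !inE.
  by case: (boolP (y \in C)) => [/(subsetP Cw) ->|_]; rewrite ?orbT ?orbF.
exists (X :|: C) => //; rewrite inE W subsetUr /=.
apply/pred0P => x /=; apply/negP => /andP[]; rewrite inE => /orP[/Xg[_ _ /negPf ->]//|/CDn ->//].
Qed.

End MinorStructure.

(** * Matroid minors *)

Section MatroidBasics.
Variables (E : finType) (M : matroid E).
Implicit Types (A B C D X Y Z : {set E}).

Lemma indep0 : set0 \in indep M.
Proof. by case: (indepP M). Qed.

Lemma indep_sub A B : A \in indep M -> B \subset A -> B \in indep M.
Proof. by case: (indepP M) => _ h _; exact: h. Qed.

Lemma indep_extend A B : A \in indep M -> B \in indep M -> #|A| <= #|B| ->
  exists Z, [/\ A \subset Z, Z \subset A :|: B, Z \in indep M & #|Z| = #|B|].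
Proof.
have [_ _ aug] := indepP M.
move: {2}(#|B| - #|A|) (leqnn (#|B| - #|A|)) => n.
elim: n A => [|n IH] A hn AI BI AB.
  by exists A; split=> //; [exact: subsetUl|lia].
have [eAB|ltAB] := eqVneq #|A| #|B|.
  by exists A; split=> //; exact: subsetUl.
have [x /setDP[xB xA] xI] := aug _ _ AI BI ltac:(lia).
have [||Z [h1 h2 h3 h4]] := IH (x |: A) _ xI BI.
- by rewrite cardsU1 xA; lia.
- by rewrite cardsU1 xA; lia.
exists Z; split=> //; first exact: subset_trans (subsetUr _ _) h1.
by apply: subset_trans h2 _; rewrite -setUA subUset sub1set inE xB orbT subxx.
Qed.

Lemma basis_exists C : exists B, basis_in M C B.
Proof.
have [B b _] : {B | basis_in M C B & set0 \subset B}.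
  by apply: maxset_exists; rewrite indep0 sub0set.
by exists B.
Qed.

Lemma basis_max C B x : basis_in M C B -> x \in C -> x |: B \in indep M -> x \in B.
Proof.
move=> b xC xI; have /andP[BI BC] := maxsetp b.
have /(maxsetsup b) : (x |: B \in indep M) && (x |: B \subset C).
  by rewrite xI subUset sub1set xC BC.
by move=> /(_ (subsetUr _ _)) <-; rewrite setU11.
Qed.

(** Extend [B2] by elements of [X :|: B1] to the size of [X :|: B1]. No element of [C] can be added
    to the basis [B2], so the extension lies in [X :|: B2], and by counting it is all of it. *)
Lemma basis_exchange C B1 B2 X : basis_in M C B1 -> basis_in M C B2 ->
  [disjoint X & C] -> X :|: B1 \in indep M -> X :|: B2 \in indep M.
Proof.
move=> b1 b2 XC I1.
have /andP[B1I B1C] := maxsetp b1; have /andP[B2I B2C] := maxsetp b2.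
have extC B B' : basis_in M C B -> B' \in indep M -> B' \subset C -> #|B'| <= #|B|.
  move=> b B'I B'C; rewrite leqNgt; apply/negP => lt.
  have /andP[BI _] := maxsetp b.
  have [_ _ /(_ _ _ BI B'I lt)] := indepP M; case=> x /setDP[xB' xB].
  by move/(basis_max b (subsetP B'C _ xB')); rewrite (negPf xB).
have eB : #|B1| = #|B2|.
  by apply/eqP; rewrite eqn_leq !extC.
have disj B : B \subset C -> #|X :|: B| = #|X| + #|B|.
  move=> BC; rewrite cardsU; suff -> : X :&: B = set0 by rewrite cards0 subn0.
  by apply/eqP; rewrite setI_eq0; apply: disjointWr BC XC.
have le2 : #|B2| <= #|X :|: B1| by rewrite disj//; lia.
have [Z [h1 h2 h3 h4]] := indep_extend B2I I1 le2.
apply: (indep_sub h3); rewrite subUset h1 andbT.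
have ZC : Z \subset X :|: B2.
  apply/subsetP => z zZ; have := subsetP h2 _ zZ; rewrite !inE.
  case/or3P => [->|->|zB1]; rewrite ?orbT//; apply/orP; right.
  apply: (basis_max b2); first exact: (subsetP B1C).
  by apply: indep_sub h3 _; rewrite subUset sub1set zZ h1.
suff -> : Z = X :|: B2 by exact: subsetUl.
by apply/eqP; rewrite eqEcard ZC h4 !disj// eB leqnn.
Qed.

Lemma minor_indepE C D B (A : {set minor_ground C D}) : basis_in M C B ->
  (A \in indep (minor M C D)) = (val @: A :|: B \in indep M).
Proof.
move=> b; rewrite inE; apply/existsP/idP => [[B' /andP[b' AI]]|AI].
  apply: basis_exchange b' b _ AI.
  apply/pred0P => x /=; apply/negP => /andP[/imsetP[y _ ->]].
  by have := valP y; rewrite !inE negb_or => /andP[/negPf ->].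
by exists B; rewrite b.
Qed.

Lemma basis_in_indep C : C \in indep M -> basis_in M C C.
Proof.
move=> CI; apply/maxsetP; split; first by rewrite CI subxx.
by move=> B /andP[_ BC] CB; apply/eqP; rewrite eqEsubset BC.
Qed.

End MatroidBasics.

Definition represents (E : finType) (s : spikelike E) (M : matroid E) : Prop :=
  [/\ wf s, ground s = setT & forall X, (X \in indep M) = sindep s X].

(** [C'] is a basis of [C]; the loops that remain after contracting it are deleted instead. The
    bound on the words is kept in terms of [C'] and [D'] so that a proper minor can later be shown
    to lose a word. *)
Lemma represents_minor (E F : finType) (s : spikelike E) (M : matroid E)
    (C D : {set E}) (N : matroid F) :
  represents s M -> [disjoint C & D] -> matroid_iso (minor M C D) N ->
  exists C' D', [/\ C' :|: D' = C :|: D, [disjoint C' & D'] &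
    exists t, represents t N /\
      #|words t| <= #|[set w in words s | (C' \subset w) && [disjoint w & D']]|].
Proof.
move=> [Ws gs sM] CD [f [f' fK f'K] fM].
have [B b] := basis_exists M C.
have /andP[BI BC] := maxsetp b.
pose D' := D :|: (C :\: B).
have BD' : [disjoint B & D'].
  apply/pred0P => x /=; apply/negP => /andP[xB]; rewrite !inE xB /= orbF.
  by rewrite (disjointFr CD) ?(subsetP BC).
have U : B :|: D' = C :|: D.
  apply/setP => x; rewrite !inE; case: (boolP (x \in B)) => [/(subsetP BC)->//|_].
  by rewrite /= orbC.
exists B, D'; split=> //.
pose g (y : F) : E := val (f' y).
have ginj : injective g by move=> x y /val_inj /(can_inj f'K).
have Wm := mnr_wf Ws BD'.
have gg y : (y \in ground (mnr s B D')) = (y \in codom g).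
  rewrite /= gs U setTD; apply/idP/codomP => [h|[z ->]]; last exact: valP.
  by exists (f (Sub y h)); rewrite /g fK SubK.
exists (pull g (mnr s B D')); split; last first.
  by apply: leq_trans (pull_words ginj _) _; exact: mnr_words_card.
split=> //; first exact: pull_wf.
move=> X; rewrite pull_sindep// mnr_sindep//; first last.
- by apply/subsetP => y /imsetP[z _ ->]; rewrite gg codom_f.
- by rewrite -sM.
rewrite -sM; have eX : f @: (f' @: X) = X.
  by rewrite -imset_comp (eq_imset _ (f'K : f \o f' =1 id)) imset_id.
by rewrite -{1}eX fM (minor_indepE _ b) -imset_comp.
Qed.

(** * Spikes are matroids *)

(** [al_inhabited] keeps the empty set from spanning, so that it is independent. *)
Record all_legs (E : finType) (s : spikelike E) : Prop := AllLegs {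
  al_wf : wf s;
  al_inhabited : 0 < #|E|;
  al_ground : ground s = setT;
  al_tips : tips s = set0;
  al_mate : forall x, mate s x != x;
  al_lifted : lifted s;
  al_cyclical : cyclical s }.

Section SpikeMatroid.
Variables (E : finType) (s : spikelike E).
Hypothesis L : all_legs s.
Let Ws := al_wf L.
Let inv := wf_inv Ws.
Implicit Types (X Y : {set E}).

Lemma al_full X x : (x \in full s X) = (x \in X) && (mate s x \in X).
Proof. by rewrite inE (al_mate L) orbT andbT. Qed.

Let cl X := X :|: mate s @: X.

Let in_cl X x : (x \in cl X) = (x \in X) || (mate s x \in X).
Proof. by rewrite inE -{2}[x]inv (mem_imset _ _ (inv_inj inv)). Qed.

Let cl_spans X : spans s X = (cl X == setT).
Proof.
apply/spansP/eqP => [H|H x _ _].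
  by apply/setP => x; rewrite in_cl inE; apply/orP/H; rewrite ?(al_ground L) ?(al_tips L) inE.
by apply/orP; rewrite -in_cl H inE.
Qed.

Let card_cl X : #|cl X| + #|full s X| = #|X| + #|X|.
Proof.
have -> : full s X = X :&: mate s @: X.
  apply/setP => x; rewrite al_full inE; congr (_ && _).
  by rewrite -{2}[x]inv (mem_imset _ _ (inv_inj inv)).
by rewrite cardsUI card_imset//; exact: inv_inj.
Qed.

Let card_full X : one_unit s X -> full s X != set0 -> #|full s X| = 2.
Proof.
move=> /one_unitP H /set0Pn[x xf].
have -> : full s X = [set x; mate s x].
  apply/setP => y; rewrite in_set2; apply/idP/orP.
    by move/(H x y xf) => [->|->]; rewrite eqxx; [left|right].
  by case=> /eqP ->; rewrite ?mate_full.
by rewrite cards2 eq_sym (al_mate L).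
Qed.

Lemma al_sindepP X :
  reflect [/\ one_unit s X & spans s X -> full s X = set0 /\ X \notin words s]
          (sindep s X).
Proof.
rewrite /sindep (al_lifted L) (al_cyclical L) /=.
apply: (iffP andP) => -[h1 h2]; split=> //.
  by move=> sp; move: h2; rewrite sp => /andP[/eqP].
by apply/implyP => /h2[-> ->]; rewrite eqxx.
Qed.

Let cl_mono X Y : Y \subset cl X -> cl Y \subset cl X.
Proof.
move=> /subsetP YX; apply/subsetP => y; rewrite in_cl => /orP[/YX//|/YX].
by rewrite !in_cl inv orbC.
Qed.

Let card_sindep X : sindep s X -> #|X| + #|X| <= #|E|.
Proof.
case/al_sindepP => one sp; have := card_cl X.
case: (boolP (spans s X)) => [/sp[-> _]|nsp].
  by rewrite cards0 addn0 => <-; exact: max_card.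
have [z [_ _ zX mX]] := spansPn nsp.
have le2 : #|full s X| <= 2.
  by case: (eqVneq (full s X) set0) => [->|/(card_full one)->//]; rewrite cards0.
have : #|cl X :|: [set z; mate s z]| = #|cl X| + 2.
  rewrite cardsU (_ : _ :&: _ = set0) ?cards0 ?subn0 ?cards2 ?[z == _]eq_sym ?(al_mate L)//.
  apply/setP => y; rewrite !inE; apply/negP => /andP[+ /orP[/eqP e|/eqP e]].
    by move: (in_cl X y); rewrite !inE e => ->; rewrite (negPf zX) (negPf mX).
  move: (in_cl X y); rewrite !inE e => ->; by rewrite inv (negPf zX) (negPf mX).
by have := subset_leq_card (subsetT (cl X :|: [set z; mate s z])); rewrite cardsT; lia.
Qed.

Let cl_add X y : #|cl (y |: X)| <= #|cl X| + 2.
Proof.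
have sub : cl (y |: X) \subset [set y; mate s y] :|: cl X.
  apply/subsetP => z; rewrite in_cl !in_setU1 in_setU in_cl in_set2.
  case/orP => /orP[/eqP h|->]; rewrite ?orbT//.
    by rewrite h eqxx.
  by rewrite -h inv eqxx orbT.
apply: leq_trans (subset_leq_card sub) _; apply: leq_trans (leq_card_setU _ _) _.
by rewrite addnC leq_add2l cards2; case: (_ == _).
Qed.

Let not_spans X : #|cl X| < #|E| -> spans s X = false.
Proof.
by move=> lt; rewrite cl_spans; apply/negP => /eqP e; rewrite e cardsT ltnn in lt.
Qed.

(** Everything is counted through the closure [cl X] under mates, whose size plus the number of full
    elements is twice the size of [X]. Augmentation could only fail if every candidate completed a
    word, and two such words would differ in a single leg. *)
Lemma al_matroid_axiom : matroid_axiom [set X | sindep s X].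
Proof.
apply/and3P; split.
- rewrite inE; apply/al_sindepP.
  have f0 : full s set0 = set0 by apply/setP => x; rewrite al_full !inE.
  split; first exact: full0_one.
  have /card_gt0P[x _] := al_inhabited L.
  rewrite cl_spans => /eqP/setP/(_ x); by rewrite in_cl !inE.
- apply/forall_inP => A; rewrite inE => /al_sindepP[one sp].
  apply/forallP => B; apply/implyP => BA; rewrite inE; apply/al_sindepP.
  split; first exact: one_unit_mono one.
  move=> spB; have spA : spans s A.
    by move: spB; rewrite !cl_spans -!subTset => h; apply: subset_trans h _;
      apply: cl_mono; apply: subset_trans BA (subsetUl _ _).
  have [fA AW] := sp spA.
  have fB : full s B = set0.
    by apply/eqP; rewrite -subset0 -fA; exact: full_mono.
  split=> //; suff -> : B = A by [].
  apply/eqP; rewrite eqEcard BA /=.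
  have := card_cl A; have := card_cl B; rewrite fA fB !cards0.
  move: spA spB; rewrite !cl_spans => /eqP-> /eqP->; lia.
- apply/forall_inP => X; rewrite inE => Xi; apply/forall_inP => Y; rewrite inE => Yi.
  apply/implyP => lt; have /al_sindepP[oneX spX] := Xi.
  have /al_sindepP[oneY spY] := Yi.
  have cY := card_sindep Yi; have cX := card_cl X.
  (* With a full leg in [X], counting yields an element of [Y] outside [cl X]. Adding it creates no
     unit, and the closure grows to at most twice the size of [X], which is less than twice that of
     [Y], so it is not everything. *)
  case: (eqVneq (full s X) set0) => [f0|fn0]; last first.
    have c2 := card_full oneX fn0.
    have [y yY yX] : exists2 y, y \in Y & y \notin cl X.
      apply/subsetPn; apply/negP => sub.
      have := subset_leq_card (cl_mono sub); have := card_cl Y.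
      have : #|full s Y| <= 2.
        by case: (eqVneq (full s Y) set0) => [->|/(card_full oneY)->//]; rewrite cards0.
      by clear -cX c2 lt; lia.
    move: yX; rewrite in_cl negb_or => /andP[yX mX].
    apply/exists_inP; exists y; first by rewrite inE yX.
    rewrite inE; apply/al_sindepP; split; last first.
      by rewrite not_spans//; have := cl_add X y; clear -cX c2 lt cY; lia.
    have fE : full s (y |: X) = full s X.
      apply/setP => z; rewrite !al_full !inE.
      case: (eqVneq z y) => [->|zy] /=.
        by rewrite (negPf yX) (negPf mX) /= orbF (negPf (al_mate L y)).
      case: (eqVneq (mate s z) y) => [e|//] /=.
      by rewrite -[z]inv e (negPf mX).
    by apply/one_unitP => u v; rewrite fE; move/one_unitP: oneX; apply.
  (* Without a full leg in [X], completing one leg is harmless: [cl X] does not grow and is too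
     small to span. *)
  have fin y : y \in Y -> y \notin X -> mate s y \in X -> y |: X \in [set X | sindep s X].
    move=> yY yX mX; rewrite inE; apply/al_sindepP; split; last first.
      rewrite not_spans//.
      have sub : cl (y |: X) \subset cl X.
        apply: cl_mono; apply/subsetP => z; rewrite in_cl in_setU1.
        by case/orP => [/eqP->|->//]; rewrite mX orbT.
      by have := subset_leq_card sub; rewrite f0 cards0 in cX; clear -cX lt cY; lia.
    have ff z : z \in full s (y |: X) -> z = y \/ z = mate s y.
      rewrite al_full !in_setU1 => /andP[/orP[/eqP->|zX] h]; first by left.
      case/orP: h => [/eqP <-|mz]; first by right; rewrite inv.
      have : z \in full s X by rewrite al_full zX.
      by rewrite f0 inE.
    by apply/one_unitP => u v /ff[->|->] /ff[->|->]; rewrite ?inv; auto.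
  have /set0Pn[y0] : Y :\: X != set0.
    by apply/eqP => e; move/eqP: e; rewrite setD_eq0 => /subset_leq_card; lia.
  rewrite inE => /andP[y0X y0Y].
  case: (boolP [exists y in Y :\: X, y |: X \in [set X | sindep s X]]) => // /exists_inPn H.
  have nc y : y \in Y -> y \notin X -> mate s y \notin X.
    move=> yY yX; apply/negP => mX; have := fin _ yY yX mX.
    by apply/negP; apply: H; rewrite inE yX.
  have bad y : y \in Y -> y \notin X -> spans s (y |: X) /\ (y |: X) \in words s.
    move=> yY yX; have mX := nc _ yY yX.
    have := H y; rewrite inE yX yY => /(_ isT); rewrite inE.
    have f0' : full s (y |: X) = set0.
      apply/setP => z; rewrite al_full !inE; apply/negP.
      case: (eqVneq z y) => [->|zy] /=.
        by rewrite (negPf mX) orbF (negPf (al_mate L y)).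
      case: (eqVneq (mate s z) y) => [e|_] /=.
        by rewrite -[z]inv e (negPf mX).
      by rewrite -al_full f0 inE.
    move=> h; case: (boolP (spans s (y |: X))) => sp; last first.
      by case/negP: h; apply/al_sindepP; split; [exact: full0_one|rewrite (negPf sp)].
    split=> //; apply/negPn/negP => W.
    by case/negP: h; apply/al_sindepP; split=> //; exact: full0_one.
  have [sp0 W0] := bad _ y0Y y0X.
  have [eY|/subsetPn[y1 y1Y]] := boolP (Y \subset y0 |: X).
    have e : Y = y0 |: X.
      by apply/eqP; rewrite eqEcard eY cardsU1 y0X.
    by have := H y0; rewrite inE y0X y0Y -e inE Yi => /(_ isT).
  rewrite in_setU1 negb_or => /andP[y10 y1X].
  (* Both [y0 |: X] and [y1 |: X] are words; as the first one spans, [y1] is the mate of [y0],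
     against [wf_dist]. *)
  have [_ W1] := bad _ y1Y y1X.
  have : y1 \in cl (y0 |: X) by move: sp0; rewrite cl_spans => /eqP ->; rewrite inE.
  rewrite in_cl !in_setU1 (negPf y10) (negPf y1X) (negPf (nc _ y1Y y1X)) /= ?orbF.
  move=> /eqP e; have e1 : y1 = mate s y0 by rewrite -e inv.
  have := wf_dist Ws W0 (setU11 _ _) (al_mate L y0).
  by rewrite setU1K// -e1 W1.
Qed.

Definition spike_matroid : matroid E := Matroid al_matroid_axiom.

Lemma spike_matroid_represents : represents s spike_matroid.
Proof. by split; [exact: Ws|exact: al_ground|move=> X; rewrite /= inE]. Qed.

End SpikeMatroid.

(** * Cycles and thetas of the doubled cycle *)

Section Rotation.
Variable r : nat.
Implicit Types i j : 'I_r.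

Lemma iter_ordS n i : val (iter n (@ordS r) i) = (i + n) %% r.
Proof.
elim: n => [|n IH]; first by rewrite addn0 modn_small.
by rewrite iterS /= IH -addn1 modnDml addn1 addnS.
Qed.

Lemma iter_ordS_r i : iter r (@ordS r) i = i.
Proof. by apply: val_inj; rewrite iter_ordS modnDr modn_small. Qed.

Lemma ordS_reach i j : exists2 n, n < r & iter n (@ordS r) i = j.
Proof.
have [ir jr] := (ltn_ord i, ltn_ord j).
exists ((j + (r - i)) %% r); first by rewrite ltn_mod; lia.
apply: val_inj; rewrite iter_ordS modnDmr.
have -> : i + (j + (r - i)) = j + r by lia.
by rewrite modnDr modn_small.
Qed.

Lemma ordS_closed (A : pred 'I_r) i : A i -> (forall j, A j -> A (ordS j)) ->
  forall j, A j.
Proof.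
move=> Ai H j; have [n _ <-] := ordS_reach i j.
by elim: n => //= n IH; exact: H.
Qed.

Lemma uniq_traject_ordS i n : n <= r -> uniq (traject (@ordS r) i n).
Proof.
move=> nr; apply/(uniqP i) => a b; rewrite !inE size_traject => an bn.
rewrite !nth_traject// => /(congr1 val); rewrite !iter_ordS => e.
have : (i + a == i + b %[mod r]) by apply/eqP.
by rewrite eqn_modDl !modn_small; [move/eqP|lia|lia].
Qed.

Lemma mem_traject_ordS i j : j \in traject (@ordS r) i r.
Proof.
have [n nr <-] := ordS_reach i j; apply/trajectP; by exists n.
Qed.

Hypothesis r3 : 3 <= r.

Lemma ordS_neq i : ordS i != i.
Proof.
apply/eqP => /(congr1 val) /= h; have ir := ltn_ord i.
case: (eqVneq (i.+1) r) h => [e|ne]; first by rewrite e modnn; lia.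
by rewrite modn_small; lia.
Qed.

Lemma ordSS_neq i : ordS (ordS i) != i.
Proof.
apply/eqP => /(congr1 val); have := iter_ordS 2 i; rewrite /= => -> h.
have ir := ltn_ord i.
case: (ltnP (i + 2) r) => h2; first by move: h; rewrite modn_small; lia.
have : (i + 2) %% r = i + 2 - r.
  by rewrite -{1}(subnK h2) modnDr modn_small; lia.
lia.
Qed.

End Rotation.

Local Arguments ends : simpl never.

Section DeltaGraph.
Variable r : nat.
Hypothesis r3 : 3 <= r.
Notation V := 'I_r.
Notation T := ('I_r * bool)%type.
Notation G := (Delta r).
Implicit Types (X Y : {set T}) (e f : T) (i j u v x : V).

Definition mt (e : T) : T := (e.1, ~~ e.2).

Lemma mtK : involutive mt. Proof. by case=> i b; rewrite /mt /= negbK. Qed.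

Definition transv X := forall e, (mt e \in X) = (e \notin X).
Definition leg j : {set T} := [set e | e.1 == j].
(** These are exactly the thetas of the doubled cycle, by [thetaset_theta] and [theta_thetaset]. *)
Definition thetaset j X :=
  leg j \subset X /\ forall e, e.1 != j -> (mt e \in X) = (e \notin X).

Let c X i : nat := ((i, false) \in X) + ((i, true) \in X).
Let deg X x : nat := #|[set e in X | x \in ends G e]|.

Lemma in_ends x e : (x \in ends G e) = (x == e.1) || (x == ordS e.1).
Proof. by rewrite !inE. Qed.

Lemma ends_card e u w : ends G e = [set u; w] -> u != w.
Proof.
move=> h; apply/eqP => e'; have : #|ends G e| = 2.
  by rewrite /ends /= /Delta_ends cards2 eq_sym ordS_neq.
by rewrite h e' cards2 eqxx.
Qed.

Lemma same_leg e f : e.1 = f.1 -> f = e \/ f = mt e.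
Proof.
by case: e f => [i b] [j b'] /= ->; rewrite /mt /=; case: b b' => -[]; auto.
Qed.

Let deg_ordS X i : deg X (ordS i) = c X i + c X (ordS i).
Proof.
rewrite /deg cardE -sum1_size big_filter /=.
have -> : \sum_(e | e \in [set e in X | ordS i \in ends G e]) 1 =
  \sum_(j : V) \sum_(b : bool) (((j, b) \in X) && (ordS i \in ends G (j, b)) : nat).
  rewrite pair_big /= big_mkcond; apply: eq_bigr => -[j b] _ /=.
  by rewrite inE; case: (_ && _).
rewrite (bigD1 i) // (bigD1 (ordS i)) ?ordS_neq // [X in _ + (_ + X) = _]big1 ?addn0.
  by rewrite !big_bool !in_ends /= !eqxx ?orbT ?andbT /c; congr (_ + _); rewrite addnC.
move=> j /andP[ji jSi]; rewrite !big_bool !in_ends /=.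
rewrite [ordS i == j]eq_sym (negPf jSi) (inj_eq (@ordS_inj _)) [i == j]eq_sym (negPf ji).
by rewrite !andbF.
Qed.

(** A step counts once at the vertex it leaves and once at the vertex it reaches. These differ
    because there are no loops, and no edge counts twice because the edges are distinct. *)
Lemma walk_degree u p x : walk G u p -> uniq (unzip1 p) ->
  deg (walk_edges p) x =
  count_mem x (belast u (unzip2 p)) + count_mem x (unzip2 p).
Proof.
elim: p u => [|[e w] p IH] u.
  move=> _ _; rewrite /deg /= [RHS]addn0 -(cards0 T).
  by congr #|pred_of_set _|; apply/setP => z; rewrite !inE.
move=> /= /andP[/eqP ee wp] /andP[ep up].
have uw := ends_card ee.
have -> : deg (walk_edges ((e, w) :: p)) x =
    (x \in ends G e) + deg (walk_edges p) x.
  rewrite /deg; case: (boolP (x \in ends G e)) => xe.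
    have <- : e |: [set f in walk_edges p | x \in ends G f] =
        [set f in walk_edges ((e, w) :: p) | x \in ends G f].
      apply/setP => f; rewrite !inE.
      by case: (eqVneq f e) => [->|_] //=; rewrite -in_ends xe.
    by rewrite cardsU1 !inE (negPf ep).
  congr #|pred_of_set _|; apply/setP => f; rewrite !inE.
  by case: (eqVneq f e) => [->|_] //=; rewrite -in_ends (negPf xe) !andbF.
rewrite (IH w)// ee in_set2.
have -> : ((x == u) || (x == w) : nat) = (x == u) + (x == w).
  by case: (eqVneq x u) => [->|//]; rewrite (negPf uw).
by rewrite [u == x]eq_sym [w == x]eq_sym addnACA.
Qed.

Lemma walk_ends u p e : walk G u p -> e \in unzip1 p ->
  forall x, x \in ends G e -> x \in u :: unzip2 p.
Proof.
elim: p u => [|[f w] p IH] u //= /andP[/eqP ef wp].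
rewrite inE => /orP[/eqP -> x|ep x xe].
  by rewrite ef !inE => /orP[]->; rewrite ?orbT.
by rewrite inE (IH w wp ep x xe) orbT.
Qed.

Lemma path_uniq_edges u p : walk G u p -> uniq (u :: unzip2 p) -> uniq (unzip1 p).
Proof.
elim: p u => [|[e w] p IH] u //= /andP[/eqP ee wp] /andP[up wup].
rewrite (IH w)// andbT; apply/negP => /(walk_ends wp) /(_ u).
rewrite ee in_set2 eqxx => /(_ isT).
by rewrite (negPf up).
Qed.

Lemma c_leg X j e : e.1 = j -> c X j = (e \in X) + (mt e \in X).
Proof. by case: e => [i []] /= <-; rewrite /c /mt /=; lia. Qed.

Lemma c1_transv X : (forall i, c X i = 1) -> transv X.
Proof.
move=> H e; have := H e.1; rewrite (@c_leg X _ e)//.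
by case: (e \in X); case: (mt e \in X).
Qed.

Lemma cycle_transv_or_leg X : is_cycle G X -> transv X \/ exists j, X = leg j.
Proof.
case=> u [p [pn wp lp /andP[up1 up2] ->]].
set Y := walk_edges p.
have degE x : deg Y x = (x \in unzip2 p).*2.
  rewrite (walk_degree _ wp)//.
  have : count_mem x (u :: unzip2 p) = count_mem x (rcons (belast u (unzip2 p)) (last u (unzip2 p))).
    by rewrite -lastI.
  rewrite -cats1 count_cat lp /= addn0 addnC => /addIn <-.
  by rewrite count_uniq_mem// -addnn.
have Yp e : (e \in Y) = (e \in unzip1 p) by rewrite inE.
case: (boolP [exists i, c Y i == 1]) => [/existsP[i ci]|/existsPn H].
  left; apply: c1_transv => j; apply/eqP; move: j.
  apply: (ordS_closed (A := fun j => c Y j == 1) ci) => j /eqP cj.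
  have := degE (ordS j); rewrite deg_ordS cj; case: (_ \in _) => /=; last by [].
  by rewrite add1n => -[->].
right; case: p pn wp lp up1 up2 @Y degE Yp H => [//|[e w] p] _ wp lp up1 up2 Y degE Yp H.
have c2 i : c Y i = 0 \/ c Y i = 2.
  by have := H i; rewrite /c; case: (_ \in _); case: (_ \in _); auto.
have le2 i : c Y i + c Y (ordS i) <= 2.
  by rewrite -deg_ordS degE; case: (_ \in _).
have eY : e \in Y by rewrite Yp inE eqxx.
have ceY f : f \in Y -> c Y f.1 = 2.
  by move=> fY; case: (c2 f.1) => //; rewrite (@c_leg Y _ f)// fY.
exists e.1; have ce := ceY e eY.
have inleg f : f \in Y -> (e.1 \in ends G f) \/ (ordS e.1 \in ends G f) -> f.1 = e.1.
  move=> fY; have cf := ceY f fY; rewrite !in_ends.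
  case=> /orP[] /eqP h //.
  - by have := le2 f.1; rewrite -h cf ce.
  - by have := le2 e.1; rewrite h cf ce.
  - by symmetry; exact: ordS_inj h.
have all_in : forall q x, walk G x q -> x = e.1 \/ x = ordS e.1 ->
    {subset unzip1 q <= Y} -> forall f, f \in unzip1 q -> f.1 = e.1.
  elim=> [//|[f z] q IH] x /= /andP[/eqP ef wq] hx sub g.
  have fe : f.1 = e.1.
    apply: inleg; first by apply: sub; rewrite inE eqxx.
    by rewrite ef !in_set2; case: hx => ->; rewrite eqxx; auto.
  rewrite inE => /orP[/eqP->//|]; apply: (IH z) => //.
    have : z \in ends G f by rewrite ef in_set2 eqxx orbT.
    by rewrite in_ends fe => /orP[]/eqP->; auto.
  by move=> g' hg; apply: sub; rewrite inE hg orbT.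
have hu : u = e.1 \/ u = ordS e.1.
  have : u \in ends G e by case/andP: wp => /eqP-> _; rewrite in_set2 eqxx.
  by rewrite in_ends => /orP[]/eqP->; auto.
apply/setP => f; rewrite [in RHS]inE; apply/idP/eqP => [fY|fe].
  by apply: (all_in _ u wp hu) => [g|]; rewrite -?Yp.
have := ce; rewrite (@c_leg Y _ f)//; by case: (f \in Y); case: (mt f \in Y).
Qed.

Lemma leg_cycle j : is_cycle G (leg j).
Proof.
exists j, [:: ((j, false), ordS j); ((j, true), j)]; split=> //=.
- by rewrite /Delta_ends /= eqxx setUC eqxx.
- by rewrite !inE xpair_eqE andbF /= ordS_neq.
- apply/setP => -[i b]; rewrite !inE /= !xpair_eqE.
  by case: b; rewrite ?andbT ?andbF ?orbF.
Qed.

Section Forward.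
Variable b : V -> bool.

Fixpoint fw j n : seq (T * V) :=
  if n is n'.+1 then ((j, b j), ordS j) :: fw (ordS j) n' else [::].

Lemma fw_walk j n : walk G j (fw j n).
Proof. by elim: n j => //= n IH j; rewrite IH andbT. Qed.

Lemma fw_unzip2 j n : unzip2 (fw j n) = traject (@ordS r) (ordS j) n.
Proof. by elim: n j => //= n IH j; rewrite IH. Qed.

Lemma fw_unzip1 j n : unzip1 (fw j n) = [seq (i, b i) | i <- traject (@ordS r) j n].
Proof. by elim: n j => //= n IH j; rewrite IH. Qed.

Lemma fw_last j n : last j (unzip2 (fw j n)) = iter n (@ordS r) j.
Proof. by rewrite fw_unzip2 last_traject. Qed.

Lemma fw_edges j n e :
  (e \in walk_edges (fw j n)) = (e.1 \in traject (@ordS r) j n) && (e.2 == b e.1).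
Proof.
rewrite inE fw_unzip1; apply/mapP/andP => [[i ij ->]|[h /eqP e2]]; first by rewrite eqxx.
by exists e.1 => //; rewrite -e2; case: e {h e2}.
Qed.

End Forward.

Lemma transv_b X e : transv X -> (e \in X) = (e.2 == ((e.1, true) \in X)).
Proof.
case: e => i []/= tX; first by case: (_ \in _).
by have := tX (i, true); rewrite /mt /= => ->; case: (_ \in _).
Qed.

Lemma transv_cycle X : transv X -> is_cycle G X.
Proof.
move=> tX; have r0 : 0 < r by lia.
pose b i := (i, true) \in X.
exists (Ordinal r0), (fw b (Ordinal r0) r); split.
- apply/eqP => /(congr1 size); rewrite -(size_map (@snd _ _)) -/(unzip2 _).
  by rewrite fw_unzip2 size_traject /=; lia.
- exact: fw_walk.
- by rewrite fw_last iter_ordS_r.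
- rewrite fw_unzip2 fw_unzip1 uniq_traject_ordS// andbT map_inj_uniq ?uniq_traject_ordS//.
  by move=> i j [].
- apply/setP => e; rewrite fw_edges mem_traject_ordS /=; exact: transv_b.
Qed.

(** The branch vertices are the ends of leg [j]: two paths are the edges of this leg, and the third
    goes round the other way in [r.-1] steps. *)
Lemma thetaset_theta j X : thetaset j X -> is_theta G X.
Proof.
move=> [jX tX]; pose b i := (i, true) \in X.
have rE : r = r.-1.+1 by lia.
have last_r : iter r.-1 (@ordS r) (ordS j) = j.
  by rewrite -iterSr -rE iter_ordS_r.
have trj : traject (@ordS r) (ordS j) r = rcons (traject (@ordS r) (ordS j) r.-1) j.
  suff h n : n = r.-1.+1 -> traject (@ordS r) (ordS j) n =
    rcons (traject (@ordS r) (ordS j) r.-1) j by exact: h.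
  by move=> ->; rewrite trajectSr last_r.
exists (ordS j), j, [:: ((j, false), j)], [:: ((j, true), j)], (fw b (ordS j) r.-1).
have inner1 b' : inner_vertices (ordS j) j [:: ((j, b'), j)] = set0.
  by apply/setP => x; rewrite !inE; case: (x == j); rewrite ?orbT ?andbF.
have pp b' : is_path G (ordS j) j [:: ((j, b'), j)].
  rewrite /is_path /= /Delta_ends /= setUC eqxx /= !inE eqxx /=.
  by rewrite ordS_neq.
split.
- exact: ordS_neq.
- rewrite !pp /= /is_path fw_walk fw_last last_r eqxx /= fw_unzip2.
  by have := @uniq_traject_ordS r (ordS j) r.-1.+1; apply; rewrite -rE.
- rewrite eqseq_cons xpair_eqE xpair_eqE andbF /=.
  have sz : size (fw b (ordS j) r.-1) = r.-1.
    by rewrite -(size_map (@snd _ _)) -/(unzip2 _) fw_unzip2 size_traject.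
  by apply/andP; split; apply/eqP => /(congr1 size); rewrite sz /=; lia.
- by rewrite !inner1 -!setI_eq0 !set0I eqxx.
- apply/setP => e; rewrite !in_setU fw_edges.
  have -> : (e.1 \in traject (@ordS r) (ordS j) r.-1) = (e.1 != j).
    have := mem_traject_ordS (ordS j) e.1; rewrite trj mem_rcons inE.
    case: (eqVneq e.1 j) => [->|//] _ /=.
    have := uniq_traject_ordS (ordS j) (leqnn r); rewrite trj rcons_uniq.
    by case/andP => /negPf.
  case: e => i b'; rewrite !inE /= !xpair_eqE.
  case: (eqVneq i j) => [->|ij] /=.
    by rewrite orbF (subsetP jX) ?inE//; case: b'.
  have h1 := tX (i, true) ij; rewrite /mt /= in h1; rewrite /b.
  by case: b' => /=; rewrite ?h1; case: (_ \in _).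
Qed.

Lemma path_head u v p : u != v -> is_path G u v p ->
  exists e w q, [/\ p = (e, w) :: q, ends G e = [set u; w],
    w = v -> q = [::] & w != v -> w \in inner_vertices u v p].
Proof.
move=> uv /and3P[]; case: p => [|[e w] q] /=; first by rewrite (negPf uv).
move=> /andP[/eqP ee wq] /eqP lw /andP[uw /andP[wu uq]].
exists e, w, q; split=> //.
- case: q lw wu {wq uw uq} => [//|[f z] q] /= lw wu wv.
  by move: wu; rewrite wv -lw mem_last.
- move=> wv; rewrite !inE eqxx (negPf wv) orbF andbT.
  by move: uw; rewrite inE negb_or eq_sym => /andP[].
Qed.

Lemma ends_fst e f : e.1 = f.1 -> ends G e = ends G f.
Proof. by rewrite /ends /= /Delta_ends => ->. Qed.

Lemma other_end e f u w w' : e.1 = f.1 ->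
  ends G e = [set u; w] -> ends G f = [set u; w'] -> w = w'.
Proof.
move=> ef he hf; have uw := ends_card he.
have : w \in ends G f by rewrite -(ends_fst ef) he in_set2 eqxx orbT.
by rewrite hf in_set2 eq_sym (negPf uw) => /eqP.
Qed.

(** Two paths leaving [u] along the same leg reach the same vertex, which disjointness forces to be
    [v]; so they are the two edges of that leg. The third path avoids this leg and has degree 1 at
    [u] and [v] and 0 or 2 elsewhere; going round from leg to leg, it uses each other leg exactly
    once. *)
Lemma theta_aux u v ea wa qa eb wb qb pc : u != v ->
  is_path G u v ((ea, wa) :: qa) -> is_path G u v ((eb, wb) :: qb) ->
  is_path G u v pc ->
  (ea, wa) :: qa != (eb, wb) :: qb -> (ea, wa) :: qa != pc -> (eb, wb) :: qb != pc ->
  [disjoint inner_vertices u v ((ea, wa) :: qa) & inner_vertices u v ((eb, wb) :: qb)] ->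
  ea.1 = eb.1 ->
  thetaset ea.1 (walk_edges ((ea, wa) :: qa) :|: walk_edges ((eb, wb) :: qb) :|: walk_edges pc).
Proof.
move=> uv Pa Pb Pc ab ac bc dis eab.
have [e [w [q [[<- <- <-] ha ha1 ha2]]]] := path_head uv Pa.
have [e' [w' [q' [[<- <- <-] hb hb1 hb2]]]] := path_head uv Pb.
have ww := other_end eab ha hb; subst wb.
have wv : wa = v.
  apply/eqP/negPn/negP => wv.
  by have := disjointFr dis (ha2 wv); rewrite hb2.
have qan := ha1 wv; have qbn := hb1 wv; subst qa qb wa.
have ne : ea != eb by apply: contra ab => /eqP ->.
have legE f : f.1 = ea.1 -> f = ea \/ f = eb.
  move=> h; case: (same_leg (esym h)) => ->; first by left.
  by case: (same_leg eab) => h'; [rewrite h' eqxx in ne|right].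
set j := ea.1; set Y := walk_edges pc.
have [ec [wc [qc [epc hc hc1 hc2]]]] := path_head uv Pc.
have [wpc /eqP lpc upc] := and3P Pc.
have Ye f : (f \in Y) = (f \in unzip1 pc) by rewrite inE.
have ec1 : ec.1 != j.
  apply/eqP => h; have vc := other_end h hc ha.
  move: (hc1 vc) => qc0; subst qc wc.
  by case: (legE _ h) => h'; move: ac bc; rewrite epc h' eqxx.
have Yj f : f \in Y -> f.1 != j.
  rewrite Ye epc /= inE => /orP[/eqP->//|fq]; apply/eqP => h.
  move: wpc upc; rewrite epc /= => /andP[_ wq] /andP[uq _].
  have := walk_ends wq fq (x := u); rewrite (ends_fst h) ha in_set2 eqxx => /(_ isT).
  by rewrite (negPf uq).
have cj : c Y j = 0.
  rewrite /c; apply/eqP; rewrite addn_eq0 !eqb0.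
  by apply/andP; split; apply/negP => /Yj; rewrite eqxx.
have endsj x : (x \in [set u; v]) = (x == j) || (x == ordS j) by rewrite -ha in_ends.
have degE x : deg Y x + (x == v) = (x \in unzip2 pc).*2 + (x == u).
  rewrite (walk_degree _ wpc) ?(path_uniq_edges wpc)//.
  have : count_mem x (u :: unzip2 pc) = count_mem x (rcons (belast u (unzip2 pc)) (last u (unzip2 pc))).
    by rewrite -lastI.
  rewrite -cats1 count_cat lpc /= addn0 [v == x]eq_sym [u == x]eq_sym.
  have /andP[_ uq] := upc.
  by rewrite (count_uniq_mem _ uq) => h; rewrite addnAC -h -addnA addnn addnC.
have un : u \notin unzip2 pc by case/andP: upc.
have vin : v \in unzip2 pc.
  have : v \in u :: unzip2 pc by rewrite -lpc mem_last.
  by rewrite inE eq_sym (negPf uv).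
have deg1 x : x \in [set u; v] -> deg Y x = 1.
  rewrite in_set2 => /orP[] /eqP ->.
    by have := degE u; rewrite eqxx (negPf uv) (negPf un) addn0.
  by have := degE v; rewrite eqxx vin [v == u]eq_sym (negPf uv) addn0 addn1 => -[].
have deg2 x : x \notin [set u; v] -> deg Y x = (x \in unzip2 pc).*2.
  rewrite in_set2 negb_or => /andP[/negPf xu /negPf xv].
  by have := degE x; rewrite xu xv !addn0.
have cY i : i != j -> c Y i = 1.
  move=> ij; suff : (i == j) || (c Y i == 1) by rewrite (negPf ij) => /eqP.
  apply: (ordS_closed (A := fun i => (i == j) || (c Y i == 1)) (i := j)).
    by rewrite eqxx.
  move=> l; case: (eqVneq l j) => [-> _|lj /= /eqP cl].
    have := deg1 (ordS j); rewrite endsj eqxx orbT => /(_ isT).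
    by rewrite deg_ordS cj add0n => ->; rewrite eqxx orbT.
  case: (eqVneq (ordS l) j) => //= Sl.
  have := deg2 (ordS l); rewrite endsj (negPf Sl) (inj_eq (@ordS_inj _)) (negPf lj).
  move=> /(_ isT); rewrite deg_ordS cl; case: (_ \in _) => //=.
  by rewrite add1n => -[->].
have mem f : (f \in walk_edges [:: (ea, v)] :|: walk_edges [:: (eb, v)] :|: Y) =
    (f.1 == j) || (f \in Y).
  rewrite !inE; congr (_ || _).
  by apply/orP/eqP => [[]/eqP ->|/legE[]->]; rewrite ?eqxx; auto.
split; first by apply/subsetP => f; rewrite inE mem => ->.
move=> f fj; rewrite !mem /= (negPf fj) /=.
by have := cY _ fj; rewrite (@c_leg Y _ f)//; case: (f \in Y); case: (mt f \in Y).
Qed.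

(** Pigeonhole: three paths start at [u], where only two legs meet. *)
Lemma theta_thetaset X : is_theta G X -> exists j, thetaset j X.
Proof.
case=> u [v [p1 [p2 [p3 [uv /and3P[P1 P2 P3] /and3P[n12 n13 n23] /and3P[d12 d13 d23] ->]]]]].
have [e1 [w1 [q1 [E1 h1 _ _]]]] := path_head uv P1.
have [e2 [w2 [q2 [E2 h2 _ _]]]] := path_head uv P2.
have [e3 [w3 [q3 [E3 h3 _ _]]]] := path_head uv P3.
subst p1 p2 p3.
have inc e w : ends G e = [set u; w] -> u = e.1 \/ u = ordS e.1.
  move=> h; have : u \in ends G e by rewrite h in_set2 eqxx.
  by rewrite in_ends => /orP[]/eqP; auto.
have pig : [\/ e1.1 = e2.1, e1.1 = e3.1 | e2.1 = e3.1].
  case: (inc _ _ h1) => a1; case: (inc _ _ h2) => a2; case: (inc _ _ h3) => a3;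
    first [ by (constructor 1; rewrite -a1 -a2) | by (constructor 2; rewrite -a1 -a3)
          | by (constructor 3; rewrite -a2 -a3)
          | by (constructor 1; apply: ordS_inj; rewrite -a1 -a2)
          | by (constructor 2; apply: ordS_inj; rewrite -a1 -a3)
          | by (constructor 3; apply: ordS_inj; rewrite -a2 -a3) ].
case: pig => ee.
- by exists e1.1; apply: (theta_aux uv P1 P2 P3 n12 n13 n23 d12 ee).
- exists e1.1; rewrite -setUA [walk_edges (_ :: q2) :|: _]setUC setUA.
  by apply: (theta_aux uv P1 P3 P2 n13 n12 _ d13 ee); rewrite eq_sym.
- exists e2.1.
  have := theta_aux uv P2 P3 P1 n23 _ _ d23 ee.
  rewrite eq_sym n12 eq_sym n13 => /(_ isT isT).
  by rewrite -[X in _ -> thetaset _ X]setUA [X in _ -> thetaset _ X]setUC.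
Qed.

End DeltaGraph.

Lemma circuits_indep (E : finType) (M N : matroid E) :
  (forall X, circuit M X -> circuit N X) ->
  forall X, X \in indep N -> X \in indep M.
Proof.
move=> H X XN; apply/negPn/negP => XM.
have [Y Yc YX] : {Y | circuit M Y & Y \subset X} by apply: minset_exists.
by have := minsetp (H _ Yc); rewrite (indep_sub XN YX).
Qed.

(** * Linear classes and lift circuits of the doubled cycle *)

Definition spk r (B : {set {set 'I_r * bool}}) : spikelike ('I_r * bool)%type :=
  Spikelike setT (@mt r) set0 true true B.

Section SpikeLift.
Variables (r : nat) (B : {set {set 'I_r * bool}}).
Hypothesis r3 : 3 <= r.
Notation T := ('I_r * bool)%type.
Notation G := (Delta r).
Implicit Types (X Y : {set T}) (e f : T).

Lemma mt_neq e : mt e != e.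
Proof. by case: e => i b; rewrite /mt xpair_eqE /= eqxx; case: b. Qed.

Lemma spk_transv X : transversal_set (spk B) X <-> transv X.
Proof.
split=> [/and3P[_ /spansP sp /eqP f0] e|tX].
  have := sp e; rewrite /= !inE => /(_ isT isT).
  case: (boolP (e \in X)) => eX; last by case.
  move=> _; apply/negP => mX.
  have : e \in full (spk B) X.
    by apply/fullP; split=> //; right; apply/eqP; exact: mt_neq.
  by rewrite f0 inE.
apply/and3P; split.
- by apply/subsetP => e _; rewrite !inE.
- apply/spansP => e _ _; rewrite /= tX; case: (boolP (e \in X)); by [left|right].
- apply/eqP/setP => e; rewrite [RHS]inE; apply/negP => /fullP[eX].
  by rewrite /= tX eX.
Qed.

Lemma transv_ham X : transv X -> is_hamiltonian_cycle G X.
Proof.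
move=> tX; split; first exact: transv_cycle.
apply/setP => i; rewrite [RHS]inE; apply/bigcupP.
case: (boolP ((i, true) \in X)) => h.
  by exists (i, true) => //; rewrite in_ends eqxx.
exists (i, false); last by rewrite in_ends eqxx.
by have := tX (i, true); rewrite h.
Qed.

Lemma vertices_leg j : vertices G (leg j) = [set j; ordS j].
Proof.
apply/setP => i; rewrite in_set2; apply/bigcupP/orP => [[e]|h].
  by rewrite inE => /eqP <-; rewrite in_ends => /orP.
by exists (j, true); [rewrite inE|rewrite in_ends; apply/orP].
Qed.

Lemma card_vertices_leg j : #|vertices G (leg j)| = 2.
Proof. by rewrite vertices_leg cards2 eq_sym ordS_neq. Qed.

Lemma ham_transv X : is_hamiltonian_cycle G X -> transv X.
Proof.
case=> /(cycle_transv_or_leg r3)[//|[j ->]] h.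
by have := card_vertices_leg j; rewrite h cardsT card_ord; lia.
Qed.

Lemma two_cycles_legs C1 C2 : is_cycle G C1 -> is_cycle G C2 -> C1 != C2 ->
  #|vertices G C1 :&: vertices G C2| <= 1 ->
  exists i j, [/\ i != j, C1 = leg i & C2 = leg j].
Proof.
move=> c1 c2 ne vert.
have [t1|[i e1]] := cycle_transv_or_leg r3 c1.
  have [_ v1] := transv_ham t1; move: vert; rewrite v1 setTI.
  have [t2|[j ->]] := cycle_transv_or_leg r3 c2; last by rewrite card_vertices_leg.
  by have [_ ->] := transv_ham t2; rewrite cardsT card_ord; lia.
have [t2|[j e2]] := cycle_transv_or_leg r3 c2.
  have [_ v2] := transv_ham t2; move: vert; rewrite v2 setIT.
  by rewrite e1 card_vertices_leg.
by exists i, j; split=> //; apply: contra ne => /eqP ij; rewrite e1 e2 ij.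
Qed.

Lemma leg_not_transv (j : 'I_r) : ~ transv (leg j).
Proof. by move=> /(_ (j, true)); rewrite !inE eqxx. Qed.

Lemma transv_thetaset X e : transv X -> e \in X -> thetaset e.1 (mt e |: X).
Proof.
move=> tX eX; split.
  apply/subsetP => f; rewrite !inE => /eqP/esym/same_leg[->|->].
    by rewrite eX orbT.
  by rewrite eqxx.
have mn f g : f.1 != g.1 -> (f == mt g) = false.
  by move=> h; apply/negP => /eqP e'; rewrite e' eqxx in h.
by move=> f fe; rewrite !inE !mn//=; exact: tX.
Qed.

Lemma thetaset_transv j (X C : {set T}) : thetaset j X -> C \subset X -> transv C ->
  forall f, f.1 != j -> (f \in C) = (f \in X).
Proof.
move=> [_ tX] CX tC f fj; apply/idP/idP => [|fX]; first exact: (subsetP CX).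
apply/negPn/negP => fC; have := subsetP CX (mt f); rewrite tC fC tX// fX.
by move/(_ isT).
Qed.

Lemma transv_swap (C C' : {set T}) j : transv C -> transv C' -> C != C' ->
  (forall f, f.1 != j -> (f \in C) = (f \in C')) ->
  exists2 e, e \in C /\ e.1 = j & C' = mt e |: (C :\ e).
Proof.
move=> tC tC' ne H.
have [e eC ej] : exists2 e, e \in C & e.1 = j.
  case: (boolP ((j, true) \in C)) => h; first by exists (j, true).
  by exists (j, false) => //; have := tC (j, true); rewrite h.
exists e => //.
have eC' : e \notin C'.
  apply/negP => eC'; case/eqP: ne; apply/setP => f.
  case: (eqVneq f.1 j) => [fj|/H//].
  by have [->|->] := @same_leg _ e f (etrans ej (esym fj)); rewrite ?tC ?tC' ?eC ?eC'.
apply/setP => f; rewrite !inE.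
case: (eqVneq f.1 j) => [fj|fj].
  have [->|->] := @same_leg _ e f (etrans ej (esym fj)).
    by rewrite (negPf eC') eqxx orbF eq_sym (negPf (mt_neq e)).
  by rewrite eqxx tC' eC'.
rewrite -H//; have -> : (f == mt e) = false.
  by apply/negP => /eqP h; rewrite h /= ej eqxx in fj.
by have -> : f != e by apply: contra fj => /eqP ->; rewrite ej.
Qed.

Lemma spk_all_legs : (forall w, w \in B -> transv w) ->
  (forall w e, w \in B -> e \in w -> mt e |: (w :\ e) \notin B) ->
  all_legs (spk B).
Proof.
move=> HB HD; split=> //.
- split=> //=.
  + exact: mtK.
  + by move=> x; rewrite inE.
  + by move=> x; rewrite inE.
  + by move=> w /HB/spk_transv.
  + by move=> w x wB xw _; exact: HD.
- by rewrite card_prod card_ord card_bool; lia.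
- exact: mt_neq.
Qed.

(** If two words differed in one leg only, their union would be a theta. The only transversals
    inside it are those two, so it would contain exactly two members of [B]. *)
Lemma linear_class_all_legs : linear_class G B ->
  (forall H, H \in B -> is_hamiltonian_cycle G H) -> all_legs (spk B).
Proof.
move=> [_ lin] ham.
have tB w : w \in B -> transv w by move/ham/ham_transv.
apply: spk_all_legs => // w e wB ew; apply/negP => wB'.
have tw := tB _ wB; have tw' := tB _ wB'.
set w' := mt e |: (w :\ e) in wB' tw'.
have th := transv_thetaset tw ew.
apply: (lin _ (thetaset_theta r3 th)).
have ww' : w != w'.
  apply/eqP => h; have := tw e; rewrite ew /= => /negP; apply.
  by rewrite h /w' setU11.
suff -> : [set C in B | C \subset mt e |: w] = [set w; w'] by rewrite cards2 ww'.
apply/setP => C; rewrite !inE; apply/andP/orP => [[CB CX]|[]/eqP->].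
- have tC := tB _ CB; case: (eqVneq C w) => [|Cw]; first by left.
  right; have [||f [fw fe] ->] := @transv_swap w C e.1 tw tC _ _.
  + by rewrite eq_sym.
  + move=> f fe; rewrite (thetaset_transv th CX tC fe).
    by rewrite (thetaset_transv th (subsetUr _ _) tw fe).
  have -> // : f = e.
  by case: (same_leg (esym fe)) => // h; move: fw; rewrite h tw ew.
- by rewrite wB subsetUr.
- by rewrite wB'; split=> //; rewrite setUS// subD1set.
Qed.

Section AllLegs.
Hypothesis L : all_legs (spk B).

Let tB w : w \in B -> transv w.
Proof. by move=> wB; apply/spk_transv; apply: (wf_words (al_wf L)). Qed.

Lemma all_legs_ham H : H \in B -> is_hamiltonian_cycle G H.
Proof. by move/tB/transv_ham. Qed.

(** Two transversals inside a theta agree outside its full leg, hence differ exactly there, which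
    [wf_dist] forbids for words. *)
Lemma all_legs_linear_class : linear_class G B.
Proof.
split; first by move=> C /all_legs_ham[].
move=> X /(theta_thetaset r3)[j th] c2.
have [C [C' [CC' e]]] : exists C C', C != C' /\ [set C in B | C \subset X] = [set C; C'].
  by have /cards2P[C [C' [h1 h2]]] := introT eqP c2; exists C, C'.
have : C \in [set C; C'] by rewrite in_set2 eqxx.
have : C' \in [set C; C'] by rewrite in_set2 eqxx orbT.
rewrite -e !inE => /andP[CB' CX'] /andP[CB CX].
have [f [fC fj] E'] := transv_swap (tB CB) (tB CB') CC' (j := j)
  (fun f fj => etrans (thetaset_transv th CX (tB CB) fj)
                (esym (thetaset_transv th CX' (tB CB') fj))).
by have := wf_dist (al_wf L) CB fC (mt_neq f); rewrite /= -E' CB'.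
Qed.

Let leg_full X e : (e \in full (spk B) X) = (leg e.1 \subset X).
Proof.
rewrite al_full//; apply/andP/subsetP => [[eX mX] f|H].
  by rewrite inE => /eqP/esym/same_leg[]->.
by split; apply: H; rewrite inE.
Qed.

Let spans_mem X : spans (spk B) X -> forall e, e \notin X -> mt e \in X.
Proof. by move/spansP => H e /negP eX; case: (H e); rewrite /= ?inE. Qed.

Let not_one X i j : i != j -> leg i \subset X -> leg j \subset X ->
  one_unit (spk B) X = false.
Proof.
move=> ij iX jX; apply/negP => /one_unitP /(_ (i, true) (j, true)).
rewrite !leg_full => /(_ iX jX)[[h]|[h]]; by rewrite h eqxx in ij.
Qed.

Let one_unitPn X : ~~ one_unit (spk B) X ->
  exists i j, [/\ i != j, leg i \subset X & leg j \subset X].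
Proof.
case/forall_inPn => x; rewrite leg_full => xX /forall_inPn[y]; rewrite leg_full => yX.
rewrite negb_or => /andP[yx ym]; exists x.1, y.1; split=> //.
by apply/eqP => /same_leg[] h; [rewrite h eqxx in yx|rewrite h eqxx in ym].
Qed.

Let leg2_not_spans i j : spans (spk B) (leg i :|: leg j) = false.
Proof.
have [l /andP[li lj]] : exists l : 'I_r, (l != i) && (l != j).
  have : 0 < #|~: [set i; j]|.
    by have := cardsC [set i; j]; rewrite cards2 card_ord; lia.
  by case/card_gt0P => l; rewrite !inE negb_or; exists l.
apply: (spansN (x := (l, true))); rewrite ?inE//=.
  by rewrite negb_or li lj.
by rewrite negb_or li lj.
Qed.

(** A minimal dependent set with two full legs is their union; with at most one full leg it must
    span, and is then a word or a theta containing no word. Two cycles with at most one common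
    vertex are always two legs, because a transversal meets every vertex and every cycle has at
    least two. *)
Lemma lift_circuit_spike X : circuit (spike_matroid L) X <-> lift_circuit G B X.
Proof.
have dep Y : (Y \notin indep (spike_matroid L)) = ~~ sindep (spk B) Y.
  by rewrite /= inE.
have sub_eq (i j : 'I_r) Y : i != j -> leg i \subset Y -> leg j \subset Y -> ~~ sindep (spk B) Y.
  by move=> ij iY jY; apply/negP => /al_sindepP -/(_ L)[]; rewrite (not_one ij iY jY).
(* Two distinct legs with the same two ends would give [ordS (ordS i) = i], which [3 <= r]
   excludes. *)
have two_legs (i j : 'I_r) : i != j -> #|vertices G (leg i) :&: vertices G (leg j)| <= 1.
  move=> ij; rewrite leqNgt; apply/negP => lt.
  have ci := card_vertices_leg i; have cj := card_vertices_leg j.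
  have e : vertices G (leg i) = vertices G (leg j).
    have e1 : vertices G (leg i) :&: vertices G (leg j) = vertices G (leg i).
      by apply/eqP; rewrite eqEcard subsetIl ci.
    have e2 : vertices G (leg i) :&: vertices G (leg j) = vertices G (leg j).
      by apply/eqP; rewrite eqEcard subsetIr cj.
    by rewrite -e1 e2.
  have : i \in vertices G (leg j) by rewrite -e vertices_leg in_set2 eqxx.
  have : j \in vertices G (leg i) by rewrite e vertices_leg in_set2 eqxx.
  rewrite !vertices_leg !in_set2 [j == i]eq_sym (negPf ij) /= => /eqP h1 /eqP h2.
  by have := ordSS_neq r3 i; rewrite -h1 -h2 eqxx.
split.
- move=> /minsetP[]; rewrite dep => Xd min.
  have minX Y : Y \subset X -> ~~ sindep (spk B) Y -> Y = X.
    by move=> YX Yd; apply: min => //; rewrite dep.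
  case: (boolP (one_unit (spk B) X)) => [one|/one_unitPn[i [j [ij iX jX]]]]; last first.
    constructor 3; exists (leg i), (leg j); split.
    + by split; [exact: leg_cycle|apply/negP => /tB/leg_not_transv].
    + by split; [exact: leg_cycle|apply/negP => /tB/leg_not_transv].
    + apply: contra ij => /eqP /setP /(_ (i, true)); rewrite !inE eqxx => /esym //.
    + exact: two_legs.
    + symmetry; apply: minX; first by rewrite subUset iX jX.
      by apply: (sub_eq i j) => //; [exact: subsetUl|exact: subsetUr].
  have [sp hX] : spans (spk B) X /\ (full (spk B) X != set0 \/ X \in B).
    have := Xd; rewrite /sindep /= one /= negb_imply => /andP[sp].
    rewrite negb_and negbK => /orP h; split=> //.
  case: (boolP (X \in B)) => XB.
    by constructor 1; split=> //; apply: transv_cycle => //; exact: tB.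
  case: hX => [|hX]; last by rewrite hX in XB.
  case/set0Pn => e; rewrite leg_full => eX.
  have th : thetaset e.1 X.
    split=> // f fe; apply/idP/idP => [mX|]; last exact: spans_mem.
    apply/negP => fX; have fl : leg f.1 \subset X.
      by rewrite -leg_full al_full// fX.
    by move: one; rewrite (not_one fe fl eX).
  constructor 2; split; first exact: thetaset_theta th.
  move=> C Cc CX; split=> //; apply/negP => CB.
  have : C = X.
    apply: minX => //; apply/negP => /al_sindepP -/(_ L)[_].
    have /spk_transv/and3P[_ -> _] := tB CB.
    by case=> //; rewrite CB.
  by move=> h; rewrite -h CB in XB.
- case=> [[_ XB]|[/(theta_thetaset r3)[j th] unb]|[C1 [C2 [[c1 n1] [c2 n2] ne vert ->]]]];
    apply/minsetP; rewrite dep; split.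
  + have /spk_transv/and3P[_ sp _] := tB XB.
    by apply/negP => /al_sindepP -/(_ L)[_ /(_ sp)[_]]; rewrite /= XB.
  + move=> Y; rewrite dep => Yd YX; have tX := tB XB.
    have /spk_transv/and3P[_ _ /eqP f0] := tX.
    have fY : full (spk B) Y = set0.
      by apply/eqP; rewrite -subset0 -f0 full_mono.
    case: (boolP (spans (spk B) Y)) => sp; last first.
      case/negP: Yd; apply/al_sindepP => //; split; first exact: full0_one.
      by rewrite (negPf sp).
    apply/eqP; rewrite eqEsubset YX /=; apply/subsetP => e eX.
    apply/negPn/negP => /(spans_mem sp) /(subsetP YX); by rewrite tX eX.
  + have [jX tX] := th; apply/negP => /al_sindepP -/(_ L)[_].
    have -> : spans (spk B) X.
      apply/spansP => e _ _ /=; case: (eqVneq e.1 j) => [ej|ej].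
        by left; apply: (subsetP jX); rewrite inE ej.
      by rewrite tX//; case: (boolP (e \in X)); auto.
    case=> // f0 _; have : (j, true) \in full (spk B) X by rewrite leg_full.
    by rewrite f0 inE.
  + move=> Y; rewrite dep => Yd YX; have [jX tX] := th.
    have onlyj e : e \in full (spk B) Y -> e.1 = j.
      move=> ef; apply/eqP/negPn/negP => ej.
      have /fullP[eX mX _] := subsetP (full_mono (spk B) YX) _ ef.
      by move: mX; rewrite /= tX// eX.
    have one : one_unit (spk B) Y.
      apply/one_unitP => e f /onlyj ej /onlyj fj.
      by apply: same_leg; rewrite ej fj.
    have := Yd; rewrite /sindep /= one /= negb_imply => /andP[sp].
    rewrite negb_and negbK => /orP[f0|YB]; last first.
      by have [_] := unb Y (transv_cycle r3 (tB YB)) YX; rewrite YB.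
    case/set0Pn: f0 => e ef; have ej := onlyj _ ef.
    apply/eqP; rewrite eqEsubset YX /=; apply/subsetP => f fX.
    case: (eqVneq f.1 j) => [fj|fj].
      by move: ef; rewrite leg_full ej => /subsetP; apply; rewrite inE fj.
    by apply/negPn/negP => /(spans_mem sp) /(subsetP YX); rewrite tX// fX.
  + have [i [j [ij e1 e2]]] := two_cycles_legs c1 c2 ne vert.
    by rewrite e1 e2; apply: (sub_eq i j); [|exact: subsetUl|exact: subsetUr].
  + have [i [j [ij e1 e2]]] := two_cycles_legs c1 c2 ne vert.
    move=> Y; rewrite dep => Yd YX.
    case: (boolP (one_unit (spk B) Y)) => [one|/one_unitPn[k [l [kl kY lY]]]].
      case/negP: Yd; apply/al_sindepP => //; split=> // sp.
      have := leg2_not_spans i j; rewrite -e1 -e2.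
      suff -> : spans (spk B) (C1 :|: C2) by [].
      apply/spansP => e eg et; move/spansP: sp => /(_ e eg et)[] h.
        by left; apply: (subsetP YX).
      by right; apply: (subsetP YX).
    have inij m : leg m \subset Y -> m = i \/ m = j.
      move=> mY; have : (m, true) \in C1 :|: C2.
        by apply: (subsetP YX); apply: (subsetP mY); rewrite inE.
      by rewrite e1 e2 !inE => /orP[]/eqP /= ->; auto.
    apply/eqP; rewrite eqEsubset YX e1 e2 subUset /=.
    case: (inij _ kY) (inij _ lY) => hk [] hl; subst k l; rewrite ?eqxx// in kl *.
      by rewrite kY lY.
    by rewrite kY lY.
Qed.

Lemma is_lift_matroid_represents M : is_lift_matroid G B M -> represents (spk B) M.
Proof.
move=> lM; split=> //; first exact: al_wf.
move=> X; have [_ _ <-] := spike_matroid_represents L.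
apply/idP/idP; apply: circuits_indep => Y; rewrite lift_circuit_spike; first by move/lM.
by move=> h; apply/lM.
Qed.

End AllLegs.
End SpikeLift.

(** * Spike minors and spike-like structures *)

Lemma spike_minor_class_represents k (E : finType) (M : matroid E) :
  spike_minor_class k M -> exists2 s, represents s M & #|words s| <= k.
Proof.
case=> r [B [L [C [D [r3 [lin ham] Bk lL [CD iso]]]]]].
have LB := linear_class_all_legs r3 lin ham.
have rep := is_lift_matroid_represents r3 LB lL.
have [C' [D' [_ _ [t [rt ct]]]]] := represents_minor rep CD iso.
exists t => //; apply: leq_trans ct _; apply: leq_trans Bk.
by apply: subset_leq_card; apply/subsetP => w; rewrite inE => /andP[].
Qed.

(** * Every structure on a whole type comes from a minor of a spike *)

Section Realize.
Variables (F : finType) (s : spikelike F) (M : matroid F).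
Hypothesis rep : represents s M.

Let Ws : wf s. Proof. by case: rep. Qed.
Let inv := wf_inv Ws.
Let gs : ground s = setT. Proof. by case: rep. Qed.
Let sM X : (X \in indep M) = sindep s X. Proof. by case: rep. Qed.

(** Each element gets a position of its own, and a leg uses just one of the two that its elements
    provide. The three further positions give [3 <= r] even for empty [F]. At [a0] both edges are
    deleted if the cycle has to be cut; at [a1] both are contracted if [lifted] has to be
    cleared. *)
Let r := #|F| + 3.
Notation T := ('I_r * bool)%type.

Let idx (x : F) : 'I_r := lshift 3 (enum_rank x).
Let a0 : 'I_r := rshift #|F| ord0.
Let a1 : 'I_r := rshift #|F| (inord 1).
Let isrep x := enum_rank x <= enum_rank (mate s x).
Let phi x : T := if isrep x then (idx x, false) else (idx (mate s x), true).

Let idx_inj : injective idx.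
Proof. by move=> x y /lshift_inj /enum_rank_inj. Qed.

Let idx_a0 x : (idx x == a0) = false.
Proof. by rewrite /idx /a0 eq_lrshift. Qed.
Let idx_a1 x : (idx x == a1) = false.
Proof. by rewrite /idx /a1 eq_lrshift. Qed.
Let a01 : (a1 == a0) = false.
Proof.
by apply/negP => /eqP /(congr1 val) /=; rewrite inordK//; lia.
Qed.

Let isrep_mate x : mate s x != x -> isrep (mate s x) = ~~ isrep x.
Proof.
move=> xm; rewrite /isrep inv -ltnNge ltn_neqAle.
suff -> : (enum_rank (mate s x) != enum_rank x :> nat) by [].
apply: contra xm => /eqP h.
by apply/eqP; apply: enum_rank_inj; apply: val_inj.
Qed.

Let isrep_fix x : mate s x = x -> isrep x.
Proof. by move=> h; rewrite /isrep h. Qed.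

Let phi_inj : injective phi.
Proof.
move=> x y; rewrite /phi; case: ifP => hx; case: ifP => hy //.
  by move/(congr1 fst)/idx_inj.
by move/(congr1 fst)/idx_inj/(inv_inj inv).
Qed.

Let phi_mate x : mate s x != x -> mt (phi x) = phi (mate s x).
Proof. by move=> xm; rewrite /phi isrep_mate// inv; case: (isrep x). Qed.

Let phi_fix x : mate s x = x -> phi x = (idx x, false).
Proof. by move=> h; rewrite /phi isrep_fix. Qed.

Let Phi := phi @: setT.

Let inPhi x : phi x \in Phi. Proof. by rewrite imset_f ?inE. Qed.

Let Phi_a x : ((phi x).1 == a0) = false /\ ((phi x).1 == a1) = false.
Proof. by rewrite /phi; case: ifP => _ /=; rewrite idx_a0 idx_a1. Qed.

Let mt_fix x : mate s x = x -> mt (phi x) \notin Phi.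
Proof.
move=> h; apply/negP => /imsetP[y _]; rewrite phi_fix// /mt /=.
rewrite /phi; case: ifP => // hy /(congr1 fst)/idx_inj e.
have ey : y = x by rewrite -h e inv.
by rewrite ey isrep_fix in hy.
Qed.

Let cC (e : T) := if e.1 == a0 then cyclical s && e.2
  else if e.1 == a1 then lifted s ==> e.2
  else e.2 && ~~ [exists x, (phi x == mt e) && (x \notin tips s)].
Let C : {set T} := [set e | (e \notin Phi) && cC e].
Let D : {set T} := ~: (C :|: Phi).
Let B : {set {set T}} :=
  if lifted s && cyclical s then [set phi @: w :|: C | w : {set F} in words s] else set0.

Let C_Phi e : e \in C -> e \notin Phi. Proof. by rewrite inE => /andP[]. Qed.
Let phiC x : phi x \notin C. Proof. by rewrite inE inPhi. Qed.

Let CD : [disjoint C & D].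
Proof.
apply/pred0P => e /=; apply/negP => /andP[eC]; by rewrite /D in_setC in_setU eC.
Qed.

Let mtC_fix x : mate s x = x -> (mt (phi x) \in C) = (x \in tips s).
Proof.
move=> h; rewrite inE mt_fix//= /cC /= !(Phi_a x).1 !(Phi_a x).2.
rewrite mtK phi_fix//=; apply/negP/idP => [H|xt /existsP[y /andP[/eqP e yt]]].
  apply/negPn/negP => xt; apply: H; apply/existsP; exists x.
  by rewrite phi_fix// eqxx.
by move: e; rewrite -phi_fix// => /phi_inj e; rewrite e xt in yt.
Qed.

Let mtC x : (mt (phi x) \in C) = (x \in tips s).
Proof.
have [h|h] := eqVneq (mate s x) x; first exact: mtC_fix.
rewrite phi_mate// (negPf (phiC _)); symmetry; apply/negP => xt.
by rewrite (wf_tipm Ws xt) eqxx in h.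
Qed.

Let outC e : lifted s -> cyclical s -> e \notin Phi -> mt e \notin Phi ->
  (e \in C) = e.2.
Proof.
move=> ls cs eP mP; rewrite inE eP /= /cC ls cs /=.
case: ifP => // _; case: ifP => // _.
suff -> : ~~ [exists x, (phi x == mt e) && (x \notin tips s)] by rewrite andbT.
by apply/existsPn => x; apply/negP => /andP[/eqP h]; rewrite -h inPhi in mP.
Qed.

Let memW (w : {set F}) x : (phi x \in phi @: w :|: C) = (x \in w).
Proof. by rewrite inE (negPf (phiC x)) orbF (mem_imset _ _ phi_inj). Qed.

Let outW (w : {set F}) e : e \notin Phi -> (e \in phi @: w :|: C) = (e \in C).
Proof.
move=> eP; rewrite inE; case: imsetP => // -[x _ h].
by rewrite h inPhi in eP.
Qed.

Let wtr w x : w \in words s -> mate s x != x -> (mate s x \in w) = (x \notin w).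
Proof.
move=> /(wf_words Ws)/and3P[wt /spansP sp /eqP f0] xm.
have xt : x \notin tips s by apply: contra xm => /(wf_tipm Ws) ->.
have := sp x; rewrite gs inE => /(_ isT xt).
case: (boolP (x \in w)) => xw; last by case.
move=> _; apply/negP => mw; have : x \in full s w.
  by apply/fullP; split=> //; right; apply/eqP.
by rewrite f0 inE.
Qed.

Let wfix w x : w \in words s -> mate s x = x -> (x \in w) = (x \notin tips s).
Proof.
move=> /(wf_words Ws)/and3P[wt /spansP sp /eqP f0] xm; apply/idP/idP.
  by move/(subsetP wt); rewrite inE => /andP[].
by move/(sp x); rewrite gs inE xm => /(_ isT)[].
Qed.

Let B_transv W : W \in B -> transv W.
Proof.
rewrite /B; case: ifP => [/andP[ls cs]|_]; last by rewrite inE.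
case/imsetP => w wW -> {W} .
have onPhi x : (mt (phi x) \in phi @: w :|: C) = (phi x \notin phi @: w :|: C).
  have [h|h] := eqVneq (mate s x) x.
    by rewrite outW ?mt_fix// mtC memW (wfix wW h) negbK.
  by rewrite phi_mate// !memW wtr.
move=> e; case: (boolP (e \in Phi)) => [/imsetP[x _ ->]//|eP].
case: (boolP (mt e \in Phi)) => [/imsetP[x _ h]|mP].
  have := onPhi x; rewrite -h mtK => ->; by rewrite negbK.
by rewrite !outW// !outC// ?mtK.
Qed.

Let B_dist W e : W \in B -> e \in W -> mt e |: (W :\ e) \notin B.
Proof.
rewrite /B; case: ifP => [/andP[ls cs]|_]; last by rewrite inE.
case/imsetP => w wW -> {W} eW; apply/negP => /imsetP[v vW h].
have eV : e \notin phi @: v :|: C.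
  by rewrite -h !inE eqxx /= orbF eq_sym mt_neq.
have /imsetP[x xw ex] : e \in phi @: w.
  by move: eW eV; rewrite !in_setU; case: (e \in C); rewrite ?orbT ?orbF.
have xm : mate s x != x.
  apply/eqP => xm; move: eV; rewrite ex memW.
  by rewrite (wfix vW xm) -(wfix wW xm) xw.
have /negP := wf_dist Ws wW xw xm; apply.
suff <- : v = mate s x |: (w :\ x) by [].
apply/setP => y; rewrite -(memW v) -h ex phi_mate// !in_setU1 !in_setD1 memW.
by rewrite !(inj_eq phi_inj).
Qed.

Let r3 : 3 <= r. Proof. by rewrite /r; lia. Qed.

Let L : all_legs (spk B). Proof. exact: spk_all_legs. Qed.

Let fullC : (full (spk B) C == set0) = lifted s.
Proof.
case: (boolP (lifted s)) => ls.
  apply/eqP/setP => e; rewrite al_full// [RHS]inE; apply/negP => /andP[].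
  rewrite !inE /cC ls /= => /andP[eP h1] /andP[mP h2]; move: h1 h2.
  case: ifP => _; first by case: (cyclical s) => //=; case: e.2.
  case: ifP => _; first by case: e.2.
  by case: e.2 => //=; rewrite andbF.
apply/set0Pn; exists (a1, true); rewrite al_full//.
have nP b : (a1, b) \notin Phi.
  apply/negP => /imsetP[x _ h]; have := (Phi_a x).2; by rewrite -h eqxx.
by rewrite !inE !nP /cC /= a01 eqxx (negPf ls).
Qed.

Let a0D : cyclical s = false -> ((a0, true) \in D) && ((a0, false) \in D).
Proof.
move=> cs; have nP b : (a0, b) \notin Phi.
  apply/negP => /imsetP[x _ h]; have := (Phi_a x).1; by rewrite -h eqxx.
by rewrite !inE !(negPf (nP _)) /cC /= eqxx cs.
Qed.

Let cycD : [forall e in ground (spk B) :\: tips (spk B),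
  ~~ ((e \in D) && (mate (spk B) e \in D))] = cyclical s.
Proof.
apply/forall_inP/idP => [H|cs e _].
  apply/negPn/negP => /negPf/a0D/andP[h1 h2].
  have h0 : (a0, true) \in ground (spk B) :\: tips (spk B) by rewrite /= !inE.
  by have := H _ h0; rewrite -[mate _ _]/(a0, false) h1 h2.
apply/negP => /andP[]; rewrite /= !in_setC !in_setU !negb_or.
move=> /andP[eC eP] /andP[mC mP].
have key (f : T) : f.2 -> f \notin Phi -> mt f \notin Phi -> f \in C.
  move=> f2 fP mfP; rewrite inE fP /= /cC f2 cs implybT /=; case: ifP => // _.
  case: ifP => // _; apply/existsPn => x; apply/negP => /andP[/eqP h].
  by rewrite -h inPhi in mfP.
case: (boolP e.2) => e2; first by rewrite key in eC.
by rewrite key ?mtK//= in mC.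
Qed.

Let C_indep : sindep (spk B) C.
Proof.
apply/al_sindepP => //; split.
  case: (boolP (lifted s)) => ls; first by apply: full0_one; apply/eqP; rewrite fullC.
  have ff e : e \in full (spk B) C -> e.1 = a1.
    rewrite al_full// !inE /cC /= => /andP[/andP[_ h1] /andP[_ h2]].
    apply/eqP; move: h1 h2; case: ifP => _.
      by case: (cyclical s) => //=; case: e.2.
    by case: (_ == _) => //; case: e.2.
  by apply/one_unitP => e f /ff he /ff hf; apply: same_leg; rewrite he hf.
move=> /spansP sp.
have cs : cyclical s.
  apply/negPn/negP => /negPf/a0D/andP[]; rewrite !in_setC !in_setU !negb_or.
  move=> /andP[h1 _] /andP[h2 _].
  have := sp (a0, true); rewrite !in_setT in_set0 => /(_ isT isT)[]; exact/negP.
(* If [C] spans, so does the empty set in [s]. As the empty set is independent in [M], the structure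
   is lifted and the empty set is no word of [s], hence [C] is not in [B]. *)
have s0 : spans s set0.
  apply/spansP => x _ xt; exfalso.
  have := sp (phi x); rewrite in_setT in_set0 => /(_ isT isT)[].
    by apply/negP.
  by rewrite /= mtC (negPf xt).
have := indep0 M; rewrite sM /sindep s0 cs; case: (boolP (lifted s)) => ls /=; last first.
  by rewrite andbF.
move=> /and3P[_ _ nw]; split; first by apply/eqP; rewrite fullC.
rewrite /= /B ls cs /=; apply/negP => /imsetP[w wW h].
suff w0 : w = set0 by rewrite w0 (negPf nw) in wW.
apply/setP => x; rewrite -(memW w) -h in_set0; exact: negbTE (phiC x).
Qed.

Let Mn := mnr (spk B) C D.

Let groundE e : (e \in ground Mn) = (e \in Phi).
Proof.
rewrite /= in_setD in_setT andbT in_setU /D in_setC in_setU negb_or negbK.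
by case: (boolP (e \in C)) => [/C_Phi/negbTE ->|_].
Qed.

Let Mn_smorph : smorph s Mn phi.
Proof.
split.
- by move=> x y _ _; exact: phi_inj.
- move=> e; rewrite groundE => /imsetP[x _ ->]; exists x => //.
  by rewrite gs inE.
- by move=> x _; rewrite groundE.
- by move=> x; rewrite mate_ground.
- move=> x _; rewrite mnr_mate ?groundE//=.
  have [h|h] := eqVneq (mate s x) x.
    rewrite ifT ?h//; have := mt_fix h.
    by rewrite in_setU /D in_setC in_setU => /negPf ->; rewrite orbF orbN.
  rewrite phi_mate// ifF// in_setU /D in_setC in_setU inPhi.
  by rewrite (negPf (phiC _)).
- move=> x _; have gx : phi x \in ground Mn by rewrite groundE.
  transitivity ((phi x \in ground Mn) && ((phi x \in set0) || (mt (phi x) \in C))).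
    by rewrite [LHS]in_set.
  by rewrite gx in_set0 /= mtC.
- by rewrite /= fullC.
- by rewrite -cycD.
Qed.

Let key (X : {set F}) : (phi @: X :|: C \in indep (spike_matroid L)) = (X \in indep M).
Proof.
have [_ _ ->] := spike_matroid_represents L; rewrite sM.
rewrite -(@mnr_sindep _ (spk B) C D (al_wf L) CD)//; last first.
  by apply/subsetP => e /imsetP[x _ ->]; rewrite groundE.
apply: (sm_sindep Mn_smorph) => //; first by rewrite gs subsetT.
move=> ls cs tX /=; rewrite fullC ls.
have := cycD => /= ->; rewrite cs /=.
have WD (w : {set F}) : (phi @: w :|: C) :\: C = phi @: w.
  apply/setP => e; rewrite in_setD in_setU.
  case: (boolP (e \in C)) => eC /=; last by rewrite orbF.
  by symmetry; apply/negP => /imsetP[x _ h]; rewrite h (negPf (phiC x)) in eC.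
apply/imsetP/idP => [[W]|XW].
  rewrite inE /B ls cs /= => /andP[/imsetP[w wW ->] _]; rewrite WD.
  by move/(imset_inj phi_inj) ->.
have XB : phi @: X :|: C \in B by rewrite /B ls cs; apply/imsetP; exists X.
exists (phi @: X :|: C) => //; rewrite inE XB subsetUr /=.
apply/pred0P => e /=; apply/negP => /andP[h]; rewrite /D in_setC in_setU.
by move: h; rewrite in_setU => /orP[/imsetP[x _ ->]|->]; rewrite ?inPhi ?orbT.
Qed.

Lemma represents_spike_minor_class k : #|words s| <= k -> spike_minor_class k M.
Proof.
move=> wk; exists r, B, (spike_matroid L), C, D; split=> //.
- by split; [exact: all_legs_linear_class|exact: all_legs_ham].
- apply: leq_trans wk; rewrite /B; case: ifP => _; last by rewrite cards0.
  exact: leq_imset_card.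
- by move=> X; exact: lift_circuit_spike.
split; first exact: CD.
have CI : C \in indep (spike_matroid L) by have := key set0; rewrite imset0 set0U indep0.
have gP x : phi x \in ~: (C :|: D).
  by rewrite in_setC in_setU /D in_setC in_setU inPhi orbT orbF.
pose g x : minor_ground C D := Sub (phi x) (gP x).
have gI : injective g by move=> x y /(congr1 val)/= /phi_inj.
have [f gK fK] : bijective g.
  apply: inj_card_bij => //; rewrite card_sig -(card_imset _ phi_inj).
  apply: subset_leq_card; apply/subsetP => e h.
  have eCD : e \notin C :|: D by rewrite -in_setC; exact: h.
  suff : e \in Phi by case/imsetP => x _ ->; rewrite imset_f.
  by rewrite -groundE /= in_setD eCD in_setT.
exists f; first by exists g.
move=> A; rewrite (minor_indepE _ (basis_in_indep CI)) -key.
suff -> : phi @: (f @: A) = val @: A by [].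
rewrite -imset_comp; apply: eq_imset => z /=.
by rewrite -[in RHS](fK z).
Qed.

End Realize.

(** * Uniqueness of the structure *)

Definition legs (E : finType) (s : spikelike E) : {set E} := [set x | mate s x != x].

Definition same_skeleton (E : finType) (s1 s2 : spikelike E) : Prop :=
  [/\ mate s1 =1 mate s2, tips s1 = tips s2, lifted s1 = lifted s2 &
      cyclical s1 = cyclical s2].

(** Independence with spanning cycles ignored; on sets that do not span it is independence itself,
    by [small_sindep]. *)
Definition few_units (E : finType) (s : spikelike E) (X : {set E}) : bool :=
  if lifted s then one_unit s X else full s X == set0.

Section Basic.
Variables (E : finType) (s : spikelike E).
Hypothesis W : wf s.
Let inv := wf_inv W.
Implicit Types (x y u v : E) (X Z : {set E}).

Lemma leg_ground x : mate s x != x -> x \in ground s.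
Proof. by apply: contraR => /(wf_out W) ->. Qed.

Lemma leg_tips x : mate s x != x -> x \notin tips s.
Proof. by apply: contra => /(wf_tipm W) ->. Qed.

Lemma mate_leg x : (mate s (mate s x) != mate s x) = (mate s x != x).
Proof. by rewrite inv eq_sym. Qed.

Lemma pick_leg Z : #|Z|.*2 < #|legs s| ->
  exists x, [/\ mate s x != x, x \notin Z & mate s x \notin Z].
Proof.
move=> lt; have [x xl xZ] : exists2 x, x \in legs s & x \notin Z :|: mate s @: Z.
  apply/subsetPn; apply/negP => /subset_leq_card; rewrite leqNgt => /negP; apply.
  apply: leq_ltn_trans (leq_card_setU _ _) _.
  by apply: leq_ltn_trans lt; rewrite -addnn leq_add2l leq_imset_card.
rewrite inE in xl; move: xZ; rewrite inE negb_or => /andP[xZ mZ].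
exists x; split=> //; apply: contra mZ => mZ.
by rewrite -[x]inv imset_f.
Qed.

Lemma two_units X x y : x \in full s X -> y \in full s X -> y != x ->
  y != mate s x -> few_units s X = false.
Proof.
move=> xf yf yx ym; rewrite /few_units; case: ifP => _.
  by apply/negP => /one_unitP /(_ x y xf yf)[] /eqP; exact/negP.
by apply/negP => /eqP f0; rewrite f0 inE in xf.
Qed.

(** A leg is one unit and needs both elements, so two units among two elements can only be tips. *)
Lemma one_unit2_tips u v : one_unit s [set u; v] = false ->
  u \in tips s /\ v \in tips s.
Proof.
move/negbT/forall_inPn => [x xf /forall_inPn[y yf]]; rewrite negb_or => /andP[yx ym].
have tipx z z' : z \in full s [set u; v] -> z' \in [set u; v] -> z' != z ->
    z' != mate s z -> z \in tips s.
  move=> /fullP[zX mX h] z'X ne nm; case: h => // /eqP zm.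
  move: zX mX z'X ne nm zm; rewrite !in_set2.
  by move=> /orP[]/eqP-> /orP[]/eqP-> /orP[]/eqP->; rewrite ?eqxx.
have xX : x \in [set u; v] by case/fullP: xf.
have yX : y \in [set u; v] by case/fullP: yf.
have xt := tipx x y xf yX yx ym.
have xm : x != mate s y.
  by apply/eqP => h; move: ym; rewrite h inv eqxx.
have yt := tipx y x yf xX ltac:(by rewrite eq_sym) xm.
move: xX yX yx xt yt; rewrite !in_set2.
by move=> /orP[]/eqP-> /orP[]/eqP->; rewrite ?eqxx.
Qed.

Lemma few_units_legs u v : lifted s -> mate s u != u -> few_units s [set u; v].
Proof.
move=> ls um; rewrite /few_units ls; apply/negPn/negP => /negbTE /one_unit2_tips[ut _].
by rewrite (wf_tipm W ut) eqxx in um.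
Qed.

Lemma few_units_cross u v : mate s u != u -> mate s v != v -> v != mate s u ->
  few_units s [set u; v].
Proof.
move=> um vm uv; case: (boolP (lifted s)) => ls; first exact: few_units_legs.
rewrite /few_units (negPf ls); apply/eqP/setP => x; rewrite [RHS]inE; apply/negP.
case/fullP; rewrite !in_set2 => /orP[]/eqP-> /orP[]/eqP h _.
- by rewrite h eqxx in um.
- by rewrite h eqxx in uv.
- by rewrite -h inv eqxx in uv.
- by rewrite h eqxx in vm.
Qed.

Lemma small_sindep X : spans s X = false -> sindep s X = few_units s X.
Proof. by move=> sp; rewrite /sindep /few_units sp andbF /= !andbT. Qed.

Lemma tips_full X x : x \in X -> x \in tips s -> x \in full s X.
Proof. by move=> xX xt; apply/fullP; split=> //; [rewrite (wf_tipm W)|left]. Qed.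

Lemma leg_full X x : x \in X -> mate s x \in X -> mate s x != x -> x \in full s X.
Proof. by move=> xX mX /eqP xm; apply/fullP; split=> //; right. Qed.

Lemma transversal_exists : exists T, transversal_set s T.
Proof.
exists [set x in ground s :\: tips s | enum_rank x <= enum_rank (mate s x)].
apply/and3P; split.
- by apply/subsetP => x; rewrite inE => /andP[].
- apply/spansP => x xg xt; rewrite !inE mate_ground// mate_tips// xg xt inv /=.
  by apply/orP; exact: leq_total.
- apply/eqP/setP => x; rewrite [RHS]inE; apply/negP => /fullP[].
  rewrite !inE inv => /andP[/andP[xt _] h1] /andP[_ h2] [h|]; first by rewrite h in xt.
  apply; apply: enum_rank_inj; apply: val_inj; apply/eqP.
  by rewrite eqn_leq; apply/andP.
Qed.

End Basic.

(** The test set is a transversal. In the lifted case a transversal may be independent although the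
    cycle is intact, so a whole leg is added to it, which makes a theta. *)
Lemma cyclical_transfer (E : finType) (s t : spikelike E) : wf s -> wf t ->
  ground s = ground t -> mate s =1 mate t -> tips s = tips t ->
  lifted s = lifted t -> 0 < #|legs s| ->
  (forall X : {set E}, X \subset ground s -> sindep s X = sindep t X) ->
  cyclical s -> cyclical t.
Proof.
move=> Ws Wt gg mm tt ll /card_gt0P[z]; rewrite inE => zm SS cs.
have fullE X : full t X = full s X by apply/setP => x; rewrite !inE mm tt.
have oneE X : one_unit t X = one_unit s X.
  by apply/one_unitP/one_unitP => H x y; rewrite ?fullE => xf yf;
    have := H x y; rewrite ?fullE ?mm; auto.
have [T /and3P[Tg Ts /eqP Tf]] := transversal_exists Ws.
have Tg' : T \subset ground s by apply: subset_trans Tg (subsetDl _ _).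
apply/negPn/negP => /negPf ct; case: (boolP (lifted s)) => ls; last first.
  by have := SS T Tg'; rewrite /sindep -ll (negPf ls) cs ct Ts fullE Tf eqxx.
pose X := T :|: [set z; mate s z].
have Xg : X \subset ground s.
  rewrite subUset Tg'; apply/subsetP => x; rewrite in_set2.
  by case/orP => /eqP->; rewrite ?mate_ground// leg_ground.
have := SS X Xg; rewrite /sindep -ll ls cs ct /= andbT.
have -> : spans s X.
  apply/spansP => x xg xt; move/spansP: Ts => /(_ x xg xt)[] h; [left|right];
    by rewrite inE h.
have zf : z \in full s X by apply: leg_full; rewrite // !inE eqxx ?orbT.
have -> : (full s X == set0) = false by apply/negP => /eqP f0; rewrite f0 inE in zf.
rewrite andbF => /esym/negP; apply; rewrite oneE.
have inv := wf_inv Ws.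
have ff x : x \in full s X -> x = z \/ x = mate s z.
  move=> /fullP[]; rewrite !inE => xX mX h.
  case: (eqVneq x z) => [->|xz]; first by left.
  case: (eqVneq x (mate s z)) => [->|xmz]; first by right.
  have {}xX : x \in T by move: xX; rewrite (negPf xz) (negPf xmz) /= orbF.
  have {}mX : mate s x \in T.
    move: mX; rewrite [mate s x == mate s z](inj_eq (inv_inj inv)) (negPf xz) orbF.
    by case/orP => // /eqP e; rewrite -e inv eqxx in xmz.
  suff : x \in full s T by rewrite Tf inE.
  by apply/fullP.
by apply/one_unitP => a b /ff[->|->] /ff[->|->]; rewrite ?inv; auto.
Qed.

Section Unique.
Variables (E : finType) (s1 s2 : spikelike E).
Hypotheses (W1 : wf s1) (W2 : wf s2) (gg : ground s1 = ground s2).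
Hypothesis SS : forall X : {set E}, X \subset ground s1 -> sindep s1 X = sindep s2 X.
Hypothesis many : 20 <= #|legs s1|.
Implicit Types (x y u v : E) (X Z : {set E}).
Local Notation m1 := (mate s1).
Local Notation m2 := (mate s2).
Let inv1 := wf_inv W1.
Let inv2 := wf_inv W2.

Let gl x : m1 x != x -> x \in ground s1. Proof. exact: leg_ground. Qed.
Let glm x : m1 x != x -> m1 x \in ground s1.
Proof. by move=> h; rewrite mate_ground// gl. Qed.

Let small1 X : #|X| <= 4 -> spans s1 X = false.
Proof.
move=> cX; have [|x [xm xX mX]] := pick_leg W1 (Z := X); first by lia.
by apply: spansN (gl xm) (leg_tips W1 xm) xX mX.
Qed.

Let pair1 x y : m1 x != x -> m1 y != y -> y != m1 x -> few_units s1 [set x; y].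
Proof. exact: few_units_cross. Qed.

Let c2 x y : #|[set x; y]| <= 4. Proof. by rewrite cards2; case: (_ == _). Qed.
Let c3' x y z : #|[set x; y; z]| <= 3.
Proof.
apply: leq_trans (leq_card_setU _ _) _; rewrite cards1 cards2.
by case: (_ == _).
Qed.
Let c3 x y z : #|[set x; y; z]| <= 4. Proof. exact: leqW (c3' x y z). Qed.
Let c4 x y z t : #|[set x; y; z; t]| <= 4.
Proof.
apply: leq_trans (leq_card_setU _ _) _; rewrite cards1 addn1 ltnS; exact: c3'.
Qed.

Let sub2 x y : x \in ground s1 -> y \in ground s1 -> [set x; y] \subset ground s1.
Proof. by move=> xg yg; apply/subsetP => z; rewrite in_set2 => /orP[]/eqP->. Qed.
Let sub3 x y z : x \in ground s1 -> y \in ground s1 -> z \in ground s1 ->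
  [set x; y; z] \subset ground s1.
Proof. by move=> xg yg zg; rewrite subUset sub2//= sub1set. Qed.
Let sub4 x y z t : x \in ground s1 -> y \in ground s1 -> z \in ground s1 ->
  t \in ground s1 -> [set x; y; z; t] \subset ground s1.
Proof. by move=> xg yg zg tg; rewrite subUset sub3//= sub1set. Qed.

(** If four elements spanned [s2], nearly all leg elements of [s1] would be tips of [s2]; two of
    them from different legs are independent in [s1] but not in [s2]. Choosing them means avoiding
    up to nine elements, namely [X], its mates and one more, which is where twenty leg elements are
    needed. *)
Let small2 X : X \subset ground s1 -> #|X| <= 4 -> cyclical s2 -> spans s2 X = false.
Proof.
move=> Xg cX cs; apply/negP => /spansP sp.
pose Z := X :|: m2 @: X.
have cZ : #|Z| <= 8.
  apply: leq_trans (leq_card_setU _ _) _.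
  by have := leq_imset_card m2 X; lia.
have tipZ x : x \in ground s1 -> x \notin Z -> x \in tips s2.
  move=> xg; apply: contraR => xt; have := sp x; rewrite -gg => /(_ xg xt) [xX|mX].
    by rewrite inE xX.
  by rewrite inE -{2}[x]inv2 imset_f ?orbT.
have [|x [xm xZ mxZ]] := pick_leg W1 (Z := Z); first by lia.
have [|y [ym yZ myZ]] := pick_leg W1 (Z := x |: Z).
  by have := cardsU1 x Z; case: (_ \notin _); lia.
move: yZ myZ; rewrite !in_setU1 !negb_or => /andP[yx yZ] /andP[myx myZ].
have yx1 : y != m1 x by apply: contra myx => /eqP ->; rewrite inv1.
have xt := tipZ _ (gl xm) xZ; have yt := tipZ _ (gl ym) yZ.
have := pair1 xm ym yx1; rewrite -small_sindep ?small1//.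
rewrite SS ?sub2 ?gl//; have d2 : few_units s2 [set x; y] = false.
  apply: (two_units (x := x) (y := y)) => //.
  - by apply: tips_full => //; rewrite in_set2 eqxx.
  - by apply: tips_full => //; rewrite in_set2 eqxx orbT.
  - by rewrite (wf_tipm W2).
move: d2; rewrite /sindep /few_units; case: ifP => _ -> //.
Qed.

Let D X : X \subset ground s1 -> #|X| <= 4 -> few_units s1 X = few_units s2 X.
Proof.
move=> Xg cX; rewrite -small_sindep ?small1// SS//.
case: (boolP (cyclical s2)) => cs; first by rewrite small_sindep ?small2.
by rewrite /sindep /few_units (negPf cs) /= !andbT.
Qed.

(** In a lifted structure two whole legs are dependent while every pair with a leg element is
    independent; in an unlifted one a full unit has at most two elements. If only [s2] is lifted,
    the legs of [s1] are dependent pairs, hence consist of tips of [s2], and tips from different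
    legs would be dependent. *)
Let unique_lifted : lifted s1 = lifted s2.
Proof.
case: (boolP (lifted s1)) => l1; case: (boolP (lifted s2)) => l2 //; exfalso.
- have [|x [xm _ _]] := pick_leg W1 (Z := set0); first by rewrite cards0; lia.
  have [|y [ym yZ myZ]] := pick_leg W1 (Z := [set x; m1 x]).
    by have := c2 x (m1 x); lia.
  move: yZ myZ; rewrite !in_set2 !negb_or => /andP[yx ymx] /andP[myx mymx].
  have d1 : few_units s1 [set x; m1 x; y; m1 y] = false.
    apply: (two_units (x := x) (y := y)) => //; apply: leg_full => //;
      by rewrite !inE eqxx ?orbT.
  have sg : [set x; m1 x; y; m1 y] \subset ground s1 by rewrite sub4 ?glm ?gl.
  move: d1; rewrite D ?c4// /few_units (negPf l2) => /negbT/set0Pn[u uf].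
  have /fullP[uX mX h] := uf.
  have ug := subsetP sg _ uX; have mg := subsetP sg _ mX.
  have um : m1 u != u.
    by move: uX; rewrite !inE -!orbA => /or4P[]/eqP->; rewrite ?inv1 1?eq_sym// eq_sym.
  have := few_units_legs W1 (m2 u) l1 um; rewrite D ?sub2 ?c2// /few_units (negPf l2).
  move=> /eqP f0; have : u \in full s2 [set u; m2 u].
    by apply/fullP; split=> //; rewrite in_set2 eqxx ?orbT.
  by rewrite f0 inE.
- have tipx x : m1 x != x -> x \in tips s2.
    move=> xm; have d1 : few_units s1 [set x; m1 x] = false.
      rewrite /few_units (negPf l1); apply/negP => /eqP f0.
      have : x \in full s1 [set x; m1 x].
        by apply: leg_full; rewrite // in_set2 eqxx ?orbT.
      by rewrite f0 inE.
    move: d1; rewrite D ?sub2 ?glm ?gl ?c2// /few_units l2.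
    by case/(one_unit2_tips W2).
  have [|x [xm _ _]] := pick_leg W1 (Z := set0); first by rewrite cards0; lia.
  have [|y [ym yZ myZ]] := pick_leg W1 (Z := [set x; m1 x]).
    by have := c2 x (m1 x); lia.
  move: yZ myZ; rewrite !in_set2 !negb_or => /andP[yx ymx] /andP[myx mymx].
  have := pair1 xm ym ymx; rewrite D ?sub2 ?gl ?c2// (two_units (x := x) (y := y))//.
  + by apply: tips_full; rewrite ?tipx ?in_set2 ?eqxx.
  + by apply: tips_full; rewrite ?tipx ?in_set2 ?eqxx ?orbT.
  + by rewrite (wf_tipm W2) ?tipx.
Qed.

(** For [few_units] in the unlifted case, tips are the loops and legs the parallel pairs of
    non-loops, both visible on at most two elements. *)
Let unique0 : lifted s1 = false -> m1 =1 m2 /\ tips s1 = tips s2.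
Proof.
move=> l1; have l2 : lifted s2 = false by rewrite -unique_lifted.
have D0 X : X \subset ground s1 -> #|X| <= 4 -> (full s1 X == set0) = (full s2 X == set0).
  by move=> Xg cX; have := D Xg cX; rewrite /few_units l1 l2.
have full1 (s : spikelike E) : wf s -> forall x, (full s [set x] == set0) = (x \notin tips s).
  move=> W x; apply/eqP/idP => [f0|xt].
    apply/negP => xt; have : x \in full s [set x] by apply: tips_full; rewrite ?inE.
    by rewrite f0 inE.
  apply/setP => y; rewrite [RHS]inE; apply/negP => /fullP[].
  by rewrite !in_set1 => /eqP-> /eqP h [h'|//]; rewrite h' in xt.
have tt : tips s1 = tips s2.
  apply/setP => x; case: (boolP (x \in ground s1)) => xg.
    have : [set x] \subset ground s1 by rewrite sub1set.
    by move/D0; rewrite cards1 => /(_ isT); rewrite !full1//; do 2 case: (_ \in _).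
  have -> : (x \in tips s1) = false by apply/negP => /(subsetP (wf_tip W1)); exact/negP.
  by symmetry; apply/negP => /(subsetP (wf_tip W2)); rewrite -gg; exact/negP.
have one_dir (sa sb : spikelike E) : wf sa -> wf sb -> ground sa = ground s1 ->
    tips sa = tips sb ->
    (forall X, X \subset ground s1 -> #|X| <= 4 -> (full sa X == set0) = (full sb X == set0)) ->
    forall x, mate sa x != x -> mate sb x = mate sa x.
  move=> Wa Wb ga tab Dab x xm.
  have xg : x \in ground s1 by rewrite -ga; exact: leg_ground.
  have mg : mate sa x \in ground s1 by rewrite -ga mate_ground// ga.
  have := Dab _ (sub2 xg mg) (c2 _ _).
  have -> : (full sa [set x; mate sa x] == set0) = false.
    apply/negP => /eqP f0; have : x \in full sa [set x; mate sa x].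
      by apply: leg_full; rewrite // in_set2 eqxx ?orbT.
    by rewrite f0 inE.
  move/esym/negbT/set0Pn => [u /fullP[]]; rewrite !in_set2.
  have xt := leg_tips Wa xm.
  have mt : mate sa x \notin tips sa by rewrite mate_tips.
  move=> /orP[]/eqP-> h; rewrite -tab ?(negPf xt) ?(negPf mt) => -[//|h'].
    by case/orP: h => /eqP // h; case: h'.
  case/orP: h => /eqP h; last by case: h'.
  by rewrite -{1}h (wf_inv Wb).
split=> // x; have [e|xm] := eqVneq (m1 x) x; last first.
  by rewrite (one_dir s1 s2 W1 W2 erefl tt D0 x xm).
have [->//|xm] := eqVneq (m2 x) x.
rewrite (one_dir s2 s1 W2 W1 (esym gg) (esym tt) _ x xm)// => X Xg cX.
by rewrite D0.
Qed.

(** In the lifted case two tips, a tip with a leg, and two legs are the minimal sets that fail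
    [few_units]. Each step plays such a set of one structure against the other; the many legs of
    [s1] always provide one away from the few mates that could interfere. *)
Let unique1 : lifted s1 -> m1 =1 m2 /\ tips s1 = tips s2.
Proof.
move=> l1; have l2 : lifted s2 by rewrite -unique_lifted.
have tips2_one x y : m1 x != x -> m1 y != y -> x \in tips s2 -> y \in tips s2 -> x = y.
  move=> xm ym xt yt; apply/eqP/negPn/negP => xy.
  have := few_units_legs W1 y l1 xm; rewrite D ?sub2 ?gl ?c2// (two_units (x := x) (y := y))//.
  - by apply: tips_full; rewrite ?in_set2 ?eqxx.
  - by apply: tips_full; rewrite ?in_set2 ?eqxx ?orbT.
  - by rewrite eq_sym.
  - by rewrite (wf_tipm W2)// eq_sym.
(* Were [t] no tip of [s2], the dependent triple formed by [t] and the leg of [x] would force [x] to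
   be a tip of [s2], and this for two different legs, against [tips2_one]. *)
have tips12 t : t \in tips s1 -> t \in tips s2.
  move=> tt; apply/negPn/negP => t2.
  have tm : m1 t = t by exact: wf_tipm tt.
  have tg : t \in ground s1 by apply: (subsetP (wf_tip W1)).
  have key x : m1 x != x -> x \notin [set t; m2 t] -> m1 x \notin [set t; m2 t] ->
      x \in tips s2.
    rewrite !in_set2 !negb_or => xm /andP[xt xt2] /andP[mt mt2].
    have d1 : few_units s1 [set t; x; m1 x] = false.
      apply: (two_units (x := t) (y := x)) => //.
      - by apply: tips_full; rewrite // !inE eqxx.
      - by apply: leg_full; rewrite // !inE eqxx ?orbT.
      - by rewrite tm.
    move: d1; rewrite (D (sub3 tg (gl xm) (glm xm)) (c3 _ _ _)) /few_units l2.
    move/negbT/forall_inPn => [u uf /forall_inPn[v vf]]; rewrite negb_or => /andP[vu vm].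
    have not_t z : z \in full s2 [set t; x; m1 x] -> z != t.
      move=> /fullP[_ mX h]; apply/eqP => zt; subst z.
      move: mX; rewrite !inE -orbA => /or3P[/eqP e|/eqP e|/eqP e].
      - by case: h => // h; rewrite h in t2.
      - by rewrite -e eqxx in xt2.
      - by rewrite -e eqxx in mt2.
    have tipz z z' : z \in full s2 [set t; x; m1 x] -> z' \in full s2 [set t; x; m1 x] ->
        z' != z -> z' != m2 z -> z \in tips s2.
      move=> zf zf' ne nm; have zt := not_t _ zf; have zt' := not_t _ zf'.
      have /fullP[zX mX []//h] := zf; have /fullP[zX' _ _] := zf'.
      have mt0 : (m2 z == t) = false.
        apply/negP => /eqP e; have e' : z = m2 t by rewrite -e inv2.
        move: zX; rewrite !inE (negPf zt) /= e'.
        by rewrite ![m2 t == _]eq_sym (negPf xt2) (negPf mt2).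
      exfalso; move: zX zX' mX; rewrite !inE (negPf zt) (negPf zt') mt0 /=.
      move=> /orP[]/eqP ez /orP[]/eqP ez' /orP[]/eqP em;
        first [ by (move: ne; rewrite ez ez' eqxx) | by (move: nm; rewrite ez' em eqxx)
              | by (case: h; rewrite em ez) ].
    have ut := tipz u v uf vf vu vm.
    have vt : v \in tips s2.
      apply: (tipz v u) => //; first by rewrite eq_sym.
      by apply/eqP => h; move: vm; rewrite h inv2 eqxx.
    have := not_t _ uf; have := not_t _ vf.
    have /fullP[+ _ _] := uf; have /fullP[+ _ _] := vf.
    rewrite !inE -!orbA => /or3P[]/eqP ev /or3P[]/eqP eu; subst u v;
      rewrite ?eqxx// => _ _; rewrite ?eqxx// in vu.
  have [|x [xm xZ mxZ]] := pick_leg W1 (Z := [set t; m2 t]).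
    by have := c2 t (m2 t); lia.
  have [|y [ym yZ myZ]] := pick_leg W1 (Z := [set t; m2 t; x]).
    by have := c3 t (m2 t) x; lia.
  move: yZ myZ; rewrite !in_setU !in_set1 -!in_set2 !negb_or => /andP[yZ yx] /andP[myZ myx].
  have yx1 : y = x by apply/esym; apply: tips2_one => //; exact: key.
  by rewrite yx1 eqxx in yx.
(* The leg of [y] avoids the tips of [s2] and the [m2]-mates of the leg of [x]. A unit that [s2]
   sees in the leg of [x] is then a tip, since [ne] rules out a leg there. Two such tips, one such
   tip with the leg of [y], and two units in the leg of [y] are all impossible. *)
have mates12 x : m1 x != x -> m2 x = m1 x.
  move=> xm; apply/eqP/negPn/negP => ne.
  have xm' : m1 (m1 x) != m1 x by rewrite mate_leg.
  have [y [ym ny1 ny2 yZ myZ]] : exists y, [/\ m1 y != y, y \notin tips s2,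
      m1 y \notin tips s2, y \notin [set x; m1 x; m2 x; m2 (m1 x)] &
      m1 y \notin [set x; m1 x; m2 x; m2 (m1 x)]].
    have [|y [ym yZ myZ]] := pick_leg W1 (Z := [set x; m1 x; m2 x; m2 (m1 x)]).
      by have := c4 x (m1 x) (m2 x) (m2 (m1 x)); lia.
    case: (boolP ((y \in tips s2) || (m1 y \in tips s2))) => [yt|]; last first.
      by rewrite negb_or => /andP[y1 y2]; exists y.
    have [|z [zm zZ mzZ]] := pick_leg W1 (Z := y |: [set x; m1 x; m2 x; m2 (m1 x)]).
      have h5 : #|y |: [set x; m1 x; m2 x; m2 (m1 x)]| <= 5.
        by rewrite cardsU1; exact: leq_add (leq_b1 _) (c4 _ _ _ _).
      by clear -h5 many; lia.
    move: zZ mzZ; rewrite !in_setU1 !negb_or => /andP[zy zZ] /andP[mzy mzZ].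
    have zm' : m1 (m1 z) != m1 z by rewrite mate_leg.
    have ym' : m1 (m1 y) != m1 y by rewrite mate_leg.
    have bad u : m1 u != u -> u != y -> u != m1 y -> u \notin tips s2.
      move=> um uy umy; apply/negP => ut; case/orP: yt => yt.
        by move: uy; rewrite (tips2_one _ _ um ym ut yt) eqxx.
      by move: umy; rewrite (tips2_one _ _ um ym' ut yt) eqxx.
    exists z; split=> //; apply: bad => //.
      by apply: contra mzy => /eqP->; rewrite inv1.
    by rewrite (inj_eq (inv_inj inv1)).
  move: yZ myZ; rewrite !inE -!orbA !negb_or.
  move=> /and4P[y1 y2 y3 y4] /and4P[y1' y2' y3' y4'].
  have d1 : few_units s1 [set x; m1 x; y; m1 y] = false.
    apply: (two_units (x := x) (y := y)) => //; apply: leg_full => //;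
      by rewrite !inE eqxx ?orbT.
  move: d1; rewrite D ?sub4 ?glm ?gl ?c4// /few_units l2.
  move/negbT/forall_inPn => [u uf /forall_inPn[v vf]]; rewrite negb_or => /andP[vu vm].
  set X := [set x; m1 x; y; m1 y] in uf vf.
  have yy z : z \in full s2 X -> z = y \/ z = m1 y -> m2 y = m1 y.
    move=> /fullP[_ mX h] hz.
    have zt : z \notin tips s2 by case: hz => ->.
    have {}h : m2 z <> z by case: h => // h; rewrite h in zt.
    have : m2 z = y \/ m2 z = m1 y.
      move: mX; rewrite !inE -!orbA => /or4P[]/eqP e; auto.
        have ez : z = m2 x by rewrite -e inv2.
        by case: hz => hz; [move: y3|move: y3']; rewrite -hz ez eqxx.
      have ez : z = m2 (m1 x) by rewrite -e inv2.
      by case: hz => hz; [move: y4|move: y4']; rewrite -hz ez eqxx.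
    case: hz => hz; rewrite hz in h * => -[e|e] //.
    by rewrite -{1}e inv2.
  have xx z : z \in full s2 X -> z = x \/ z = m1 x -> z \in tips s2.
    move=> /fullP[_ mX []//h] hz; exfalso.
    move: mX; rewrite !inE -!orbA => /or4P[]/eqP e.
    - case: hz => hz; rewrite hz in e h => //.
      by move: ne; rewrite -{1}e inv2 eqxx.
    - by case: hz => hz; rewrite hz in e h => //; move: ne; rewrite e eqxx.
    - by case: hz => hz; rewrite hz in e; [move: y3|move: y4]; rewrite e eqxx.
    - by case: hz => hz; rewrite hz in e; [move: y3'|move: y4']; rewrite e eqxx.
  have cases z : z \in full s2 X -> (z = x \/ z = m1 x) \/ (z = y \/ z = m1 y).
    by move=> /fullP[+ _ _]; rewrite !inE -!orbA => /or4P[]/eqP->; auto.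
  have final w : w = x \/ w = m1 x -> w \in tips s2 -> m2 y = m1 y -> False.
    move=> hw wt my.
    have wm : m1 w != w by case: hw => ->.
    have wy : w != y by case: hw => ->; rewrite eq_sym.
    have wy' : w != m1 y by case: hw => ->; rewrite eq_sym.
    have d2 : few_units s2 [set w; y; m1 y] = false.
      apply: (two_units (x := w) (y := y)) => //.
      - by apply: tips_full; rewrite // !inE eqxx.
      - by apply: leg_full; rewrite ?my// !inE eqxx ?orbT.
      - by rewrite eq_sym.
      - by rewrite (wf_tipm W2)// eq_sym.
    move: d2; rewrite -D ?sub3 ?glm ?gl ?c3// /few_units l1 => /negP; apply.
    have ff z : z \in full s1 [set w; y; m1 y] -> z = y \/ z = m1 y.
      move=> /fullP[zX mX _]; move: zX; rewrite !inE -!orbA => /or3P[]/eqP ez; auto.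
      subst z; move: mX; rewrite !inE (negPf wm) /=.
      rewrite (inj_eq (inv_inj inv1)) (negPf wy) orbF => /eqP h.
      by move: wy'; rewrite -h inv1 eqxx.
    by apply/one_unitP => a b /ff[->|->] /ff[->|->]; rewrite ?inv1; auto.
  case: (cases _ uf) => hu; case: (cases _ vf) => hv.
  - have ut := xx _ uf hu; have vt := xx _ vf hv.
    have um : m1 u != u by case: hu => ->.
    have vm' : m1 v != v by case: hv => ->.
    by move: vu; rewrite (tips2_one _ _ um vm' ut vt) eqxx.
  - exact: final hu (xx _ uf hu) (yy _ vf hv).
  - exact: final hv (xx _ vf hv) (yy _ uf hu).
  - have my := yy _ uf hu; have my' : m2 (m1 y) = y by rewrite -my inv2.
    move: vu vm; case: hu => ->; case: hv => ->; rewrite ?my ?my' ?eqxx//.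
have mm : m1 =1 m2.
  move=> x; have [e|/mates12->//] := eqVneq (m1 x) x.
  rewrite e; apply/eqP; rewrite eq_sym; apply/negPn/negP => xm2; set y := m2 x.
  have ym1 : m1 y = y.
    apply/eqP/negPn/negP => ym; have := mates12 _ ym; rewrite /y inv2 => h.
    by move: xm2; rewrite -/y -(inv1 y) -h e eqxx.
  have xg : x \in ground s1 by rewrite gg; exact: leg_ground.
  have yg : y \in ground s1 by rewrite gg mate_ground// -gg.
  have xt1 : x \notin tips s1 by apply/negP => /tips12/(wf_tipm W2) h; rewrite h eqxx in xm2.
  have yt1 : y \notin tips s1.
    by apply/negP => /tips12; rewrite mate_tips// => /(wf_tipm W2) h; rewrite h eqxx in xm2.
  have [|z [zm zZ mzZ]] := pick_leg W1 (Z := [set x; y]); first by have := c2 x y; lia.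
  have d2 : few_units s2 [set x; y; z; m1 z] = false.
    move: zZ mzZ; rewrite !in_set2 !negb_or => /andP[zx zy] /andP[mzx mzy].
    apply: (two_units (x := x) (y := z)) => //.
    - by apply: leg_full; rewrite // !inE eqxx ?orbT.
    - by apply: leg_full; rewrite ?mates12// !inE eqxx ?orbT.
  move: d2; rewrite -(D (sub4 xg yg (gl zm) (glm zm)) (c4 _ _ _ _)) /few_units l1.
  move=> /negP; apply.
  have ff u : u \in full s1 [set x; y; z; m1 z] -> u = z \/ u = m1 z.
    move=> /fullP[uX _ h]; move: uX; rewrite !inE -!orbA => /or4P[]/eqP eu; auto.
      by subst u; case: h; rewrite ?(negPf xt1)// e.
    by subst u; case: h; rewrite ?(negPf yt1)// ym1.
  by apply/one_unitP => a b /ff[->|->] /ff[->|->]; rewrite ?inv1; auto.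
split=> //; apply/setP => t; apply/idP/idP; first exact: tips12.
move=> t2; apply/negPn/negP => t1.
have tm : m1 t = t by rewrite mm (wf_tipm W2).
have tg : t \in ground s1 by rewrite gg (subsetP (wf_tip W2)).
have [|z [zm zZ mzZ]] := pick_leg W1 (Z := [set t; t]); first by have := c2 t t; lia.
have d2 : few_units s2 [set t; z; m1 z] = false.
  move: zZ; rewrite in_set2 orbb => zt.
  apply: (two_units (x := t) (y := z)) => //.
  - by apply: tips_full; rewrite // !inE eqxx.
  - by apply: leg_full; rewrite -?mm// !inE eqxx ?orbT.
  - by rewrite (wf_tipm W2).
move: d2; rewrite -(D (sub3 tg (gl zm) (glm zm)) (c3 _ _ _)) /few_units l1.
move=> /negP; apply.
have ff u : u \in full s1 [set t; z; m1 z] -> u = z \/ u = m1 z.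
  move=> /fullP[uX _ h]; move: uX; rewrite !inE -!orbA => /or3P[]/eqP eu; auto.
  by subst u; case: h; rewrite ?(negPf t1)// tm.
by apply/one_unitP => a b /ff[->|->] /ff[->|->]; rewrite ?inv1; auto.
Qed.

Lemma unique_skeleton : same_skeleton s1 s2.
Proof.
have [mm tt] : m1 =1 m2 /\ tips s1 = tips s2.
  by case: (boolP (lifted s1)) => l1; [exact: unique1|apply: unique0; exact: negbTE].
have le2 : legs s2 = legs s1 by apply/setP => x; rewrite !inE mm.
have pos : 0 < #|legs s1| by exact: ltn_trans many.
split=> //; apply/idP/idP.
  exact: (cyclical_transfer W1 W2 gg mm tt unique_lifted pos SS).
apply: (cyclical_transfer W2 W1 (esym gg) (fun x => esym (mm x)) (esym tt)
  (esym unique_lifted)); first by rewrite le2.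
by move=> X; rewrite -gg => /SS.
Qed.

(** A word is dependent, and with the same skeleton the only reason that [s2] can have for this is
    that it is a word there too. *)
Lemma unique_words : lifted s1 -> cyclical s1 -> words s1 \subset words s2.
Proof.
move=> l1 c1; have [mm tt ll cc] := unique_skeleton.
apply/subsetP => X XW; have /and3P[Xg Xs /eqP Xf] := wf_words W1 XW.
have Xg' : X \subset ground s1 by apply: subset_trans Xg (subsetDl _ _).
have fullE : full s2 X = full s1 X by apply/setP => x; rewrite !inE mm tt.
have spE : spans s2 X.
  apply/spansP => x; rewrite -gg -tt -mm => xg xt; exact: (spansP _ _ Xs).
have := SS Xg'; rewrite /sindep -ll l1 -cc c1 Xs spE fullE Xf eqxx XW /= andbF.
by rewrite full0_one ?fullE// /= => /esym/negbT; rewrite negbK.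
Qed.

End Unique.

(** * Excluded minors of odd size *)

(** Independence is a predicate on subsets of one fixed type, so that structures of different minors
    can be compared without transport. *)
Record structured (E : finType) (k : nat) (I : {set E} -> bool) (Y : {set E})
    (s : spikelike E) : Prop := Structured {
  st_wf : wf s;
  st_ground : ground s = Y;
  st_words : #|words s| <= k;
  st_sindep : forall X : {set E}, X \subset Y -> I X = sindep s X }.

Lemma minor_structured (E : finType) (M : matroid E) (C D : {set E}) k :
  C \in indep M -> spike_minor_class k (minor M C D) ->
  exists s, structured k (fun X => X :|: C \in indep M) (~: (C :|: D)) s.
Proof.
move=> CI /spike_minor_class_represents[t [Wt gt tM] tk].
pose g (z : minor_ground C D) : E := val z.
have ginj : injective g by exact: val_inj.
have gg : g @: setT = ~: (C :|: D).
  apply/setP => x; apply/imsetP/idP => [[z _ ->]|xC]; first exact: (valP z).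
  by exists (Sub x xC); rewrite ?inE ?SubK.
exists (push g t); split=> //; first exact: push_wf.
  by apply: leq_trans (push_words _ _) tk.
move=> X sX; have -> : X = g @: (g @^-1: X).
  apply/setP => x; apply/idP/imsetP => [xX|[z]]; last by rewrite inE => ? ->.
  have : x \in g @: setT by rewrite gg (subsetP sX).
  by case/imsetP => z _ e; exists z => //; rewrite inE -e.
by rewrite push_sindep// -tM (minor_indepE _ (basis_in_indep CI)).
Qed.

(** * Deletion of one element *)

Definition dl (E : finType) (s : spikelike E) (f : E) := mnr s set0 [set f].

Section Deletion.
Variables (E : finType) (s : spikelike E).
Hypothesis W : wf s.
Let inv := wf_inv W.
Implicit Types (f x : E) (X : {set E}).

Lemma dl_wf f : wf (dl s f).
Proof. by apply: mnr_wf => //; rewrite -setI_eq0 set0I. Qed.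

Lemma dl_ground f : ground (dl s f) = ground s :\ f.
Proof. by rewrite /= set0U. Qed.

Lemma dl_mate f x :
  mate (dl s f) x = if (x == f) || (mate s x == f) then x else mate s x.
Proof. by rewrite /= set0U !in_set1. Qed.

Lemma dl_tips f : tips (dl s f) = tips s :\ f.
Proof.
apply/setP => x; rewrite /= set0U !inE orbF; case: (boolP (x \in tips s)) => xt.
  by rewrite !andbT (subsetP (wf_tip W)) ?andbT.
by rewrite !andbF.
Qed.

Let full0 : full s set0 = set0.
Proof. by apply/setP => x; rewrite !inE. Qed.

Lemma dl_lifted f : lifted (dl s f) = lifted s.
Proof. by rewrite /= full0 eqxx andbT. Qed.

Lemma dl_cyclical f : (mate s f != f) || (f \in tips s) ->
  cyclical (dl s f) = cyclical s.
Proof.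
move=> h /=; case: (cyclical s) => //=; apply/forall_inP => x.
rewrite !inE => /andP[xt _]; apply/negP => /andP[/eqP e /eqP e']; subst x.
by move: h; rewrite e' eqxx (negPf xt).
Qed.

Lemma dl_sindep f X : sindep s set0 -> X \subset ground s -> f \notin X ->
  sindep (dl s f) X = sindep s X.
Proof.
move=> s0 Xg fX; rewrite mnr_sindep ?setU0//; first by rewrite -setI_eq0 set0I.
by rewrite dl_ground subsetD1 Xg.
Qed.

Lemma dl_full f X : f \notin X -> full (dl s f) X = full s X.
Proof.
move=> fX; apply/setP => x; rewrite /full in_set [in RHS]in_set dl_mate dl_tips in_setD1.
case: (boolP (x \in X)) => //= xX.
have -> /= : (x == f) = false by apply/negP => /eqP e; rewrite e (negPf fX) in xX.
case: (eqVneq (mate s x) f) => [e|//].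
rewrite e (negPf fX) /= eqxx orbF xX /=; apply/negP => xt.
by move: e; rewrite (wf_tipm W xt) => e; rewrite e (negPf fX) in xX.
Qed.

Lemma dl_spans f X : mate s f != f -> spans (dl s f) X -> spans s X.
Proof.
move=> fm /spansP sp; apply/spansP => x xg xt.
case: (eqVneq x f) => [xf|xf].
  have fg := leg_ground W fm; have ft := leg_tips W fm.
  have := sp (mate s f); rewrite dl_ground dl_tips dl_mate !inE inv eqxx orbT fm.
  by rewrite mate_ground// mate_tips// fg ft xf /= => /(_ isT isT)[]; right.
have := sp x; rewrite dl_ground dl_tips dl_mate !inE xf xg xt /= => /(_ isT isT).
by case: ifP => _ []; auto.
Qed.

Lemma legs_dl f : #|legs s| <= #|legs (dl s f)| + 2.
Proof.
have sub : legs s \subset legs (dl s f) :|: [set f; mate s f].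
  apply/subsetP => x; rewrite in_setU in_set2 !in_set dl_mate.
  case: (eqVneq x f) => [->|xf] /=; first by rewrite orbT.
  case: (eqVneq (mate s x) f) => [<-|_ ->//]; by rewrite inv eqxx !orbT.
apply: leq_trans (subset_leq_card sub) _; apply: leq_trans (leq_card_setU _ _) _.
by rewrite leq_add2l cards2; case: (_ == _).
Qed.

Lemma dl_legs f : #|legs (dl s f)| <= #|legs s|.
Proof.
apply: subset_leq_card; apply/subsetP => x; rewrite !in_set dl_mate.
by case: ifP; rewrite ?eqxx.
Qed.

Lemma sindep_few X : sindep s X -> few_units s X.
Proof. by rewrite /sindep /few_units; case: ifP => _ /andP[]. Qed.

Lemma sindep_not_few X : few_units s X = false -> sindep s X = false.
Proof. by move=> h; apply/negP => /sindep_few; rewrite h. Qed.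

End Deletion.

Lemma skeleton_full (E : finType) (s t : spikelike E) X :
  same_skeleton s t -> full s X = full t X.
Proof. by case=> mm tt _ _; apply/setP => x; rewrite !inE mm tt. Qed.

(** The sets left out, spanning without full unit in a lifted and cyclical structure, are the only
    ones whose independence depends on the words. *)
Lemma skeleton_sindep (E : finType) (s t : spikelike E) (X : {set E}) :
  same_skeleton s t -> ground s = ground t ->
  ~~ [&& lifted s, cyclical s, spans s X & full s X == set0] ->
  sindep s X = sindep t X.
Proof.
move=> sk gg; have fe := skeleton_full X sk; have [mm tt ll cc] := sk.
have se : spans s X = spans t X.
  by apply/spansP/spansP => H x; have := H x; rewrite gg tt mm.
have oe : one_unit s X = one_unit t X.
  by apply/one_unitP/one_unitP => H x y; rewrite ?fe => xf yf;
    have := H x y; rewrite ?fe ?mm; auto.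
rewrite /sindep -ll -cc -se -fe -oe; case: (lifted s) => //=.
by case: (cyclical s) => //=; case: (spans s X) => //= /negPf ->.
Qed.

Section NotInClass.
Variables (E : finType) (M : matroid E) (k : nat).
Hypothesis notS : ~ spike_minor_class k M.

(** If one of the flags were cleared, words would not enter [sindep] and could be discarded, which
    would put [M] in the class. *)
Lemma not_in_class s : represents s M ->
  [/\ lifted s, cyclical s & k < #|words s|].
Proof.
move=> rep; case: (boolP (lifted s && cyclical s)) => [/andP[ls cs]|lc].
  split=> //; rewrite ltnNge; apply/negP => wk; apply: notS.
  exact: represents_spike_minor_class rep _ wk.
exfalso; apply: notS; have [Ws gs sM] := rep.
pose t := Spikelike (ground s) (mate s) (tips s) (lifted s) (cyclical s) set0.
apply: (@represents_spike_minor_class _ t); last by rewrite /= cards0.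
split=> //.
- split=> /=; try by case: Ws.
  + by move=> w; rewrite inE.
  + by move=> w x; rewrite inE.
- move=> X; rewrite sM; apply: skeleton_sindep => //.
  by apply: contra lc => /and4P[-> ->].
Qed.

End NotInClass.

(** * Gluing the structures of the one-element deletions *)

Section Extension.
Variables (E : finType) (M : matroid E) (k : nat) (S : E -> spikelike E).
Hypothesis HS : forall e, structured k (fun X => X \in indep M) (~: [set e]) (S e).
Implicit Types (e f g x y z : E) (X Y w : {set E}).
Local Notation m f := (mate (S f)).

Let W f : wf (S f). Proof. exact: (st_wf (HS f)). Qed.
Let inv f := wf_inv (W f).
Let gS f : ground (S f) = ~: [set f]. Proof. exact: (st_ground (HS f)). Qed.
Let SE f X : f \notin X -> (X \in indep M) = sindep (S f) X.
Proof. by move=> fX; apply: (st_sindep (HS f)); rewrite subsetC sub1set inE. Qed.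
Let S0 f : sindep (S f) set0. Proof. by rewrite -SE ?inE// indep0. Qed.
Let mff f : m f f = f. Proof. by apply: wf_out; rewrite // gS !inE eqxx. Qed.
Let leg_neq f x : m f x != x -> x != f.
Proof. by apply: contraNneq => ->; rewrite mff. Qed.

(** Both sides describe [M] with [f] and [g] deleted; the second deletion costs at most two leg
    elements, which leaves the 20 that uniqueness requires. *)
Let cmp f g : f != g -> 22 <= #|legs (S f)| ->
  same_skeleton (dl (S f) g) (dl (S g) f).
Proof.
move=> fg many.
have gE : ground (dl (S f) g) = ground (dl (S g) f).
  by rewrite !dl_ground !gS; apply/setP => x; rewrite !inE andbC.
apply: (unique_skeleton (dl_wf (W f) g) (dl_wf (W g) f) gE).
  move=> X; rewrite dl_ground gS => sX.
  have sub : X \subset ~: [set f] :&: ~: [set g].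
    by apply: subset_trans sX _; rewrite setDE.
  have [fX gX] : f \notin X /\ g \notin X.
    by split; apply/negP => /(subsetP sub); rewrite !inE eqxx ?andbF.
  by rewrite !dl_sindep// -?SE ?gS// subsetC sub1set inE.
by have := legs_dl (W f) g; lia.
Qed.

Variable e : E.
Hypothesis many : 24 <= #|legs (S e)|.
Variable f0 : E.
Hypothesis f0m : m e f0 != f0.
Let f1 := m e f0.

Let f1m : m e f1 != f1. Proof. by rewrite mate_leg. Qed.
Let f0e := leg_neq f0m.
Let f1e := leg_neq f1m.
Let m1 : m e f1 = f0. Proof. exact: inv. Qed.
Let cmpe g : g != e -> same_skeleton (dl (S e) g) (dl (S g) e).
Proof. by move=> ge; apply: cmp; [rewrite eq_sym|lia]. Qed.

Let many0 : 22 <= #|legs (S f0)|.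
Proof.
have [mm _ _ _] := cmpe f0e.
apply: leq_trans (dl_legs _ e).
have -> : legs (dl (S f0) e) = legs (dl (S e) f0).
  by apply/setP => x; rewrite !in_set mm.
by have := legs_dl (W e) f0; lia.
Qed.

Let other g := [/\ m e g != g, g != f0 & g != f1].

Let otherm g : other g -> other (m e g).
Proof.
case=> gm g0 g1; split; first by rewrite mate_leg.
- by apply: contraNneq g1 => h; rewrite -[g](inv e) h.
- by rewrite (inj_eq (inv_inj (inv e))).
Qed.

Let mg0 g : other g -> m g f0 = f1.
Proof.
case=> gm g0 g1; have [mm _ _ _] := cmpe (leg_neq gm).
have := mm f0; rewrite !dl_mate [f0 == g]eq_sym (negPf g0) /= (negPf f0e) /=.
rewrite -/f1 [f1 == g]eq_sym (negPf g1).
by case: ifP => // _ h; case/eqP: f0m.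
Qed.

Let mg1 g : other g -> m g f1 = f0.
Proof. by move=> og; rewrite -(mg0 og) (inv g). Qed.

Let m0g g : other g -> m f0 g = m e g.
Proof.
case=> gm g0 g1; have [mm _ _ _] := cmpe f0e.
have := mm g; rewrite !dl_mate (negPf g0) (negPf (leg_neq gm)) /=.
have -> : (m e g == f0) = false.
  by apply/negP => /eqP h; move: g1; rewrite /f1 -h (inv e) eqxx.
by case: ifP => // _ h; rewrite h eqxx in gm.
Qed.

Let pick_other (Z : {set E}) : #|Z| <= 8 ->
  exists g, [/\ other g, g \notin Z & m e g \notin Z].
Proof.
move=> cZ; have [|g [gm gZ mgZ]] := pick_leg (W e) (Z := Z :|: [set f0; f1]).
  have c2 : #|[set f0; f1]| <= 2 by rewrite cards2; case: (_ != _).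
  have : #|Z :|: [set f0; f1]| <= #|Z| + #|[set f0; f1]| by apply: leq_card_setU.
  by lia.
move: gZ mgZ; rewrite !inE !negb_or.
by move=> /and3P[gZ g0 g1] /and3P[mgZ _ _]; exists g; split.
Qed.

(** Comparison with [S e] leaves open that [f1] is paired with [e], and comparison with [S g] that
    it is paired with [g]; together they exclude both. It is no tip, since in [S g] it forms a leg
    with [f0]. *)
Let f1_fix : m f0 f1 = f1 /\ f1 \notin tips (S f0).
Proof.
have [|g [og _ _]] := pick_other (Z := set0); first by rewrite cards0.
have [gm g0 g1] := og; have ge := leg_neq gm.
have [mm0 tt0 _ _] := cmp (f := f0) (g := g) ltac:(by rewrite eq_sym) many0.
have [mme _ _ _] := cmpe f0e.
have h1 := mme f1; rewrite !dl_mate m1 eqxx orbT (negPf f1e) /= in h1.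
have h2 := mm0 f1; rewrite !dl_mate (mg1 og) eqxx orbT in h2.
rewrite [f1 == g]eq_sym (negPf g1) /= in h2.
split.
  move: h1; case: ifP => [/eqP h _|//]; move: h2; rewrite h [e == g]eq_sym (negPf ge).
  by move=> h2; rewrite h2.
apply/negP => ft; have : f1 \in tips (dl (S g) f0).
  by rewrite -tt0 dl_tips// in_setD1 ft [f1 == g]eq_sym g1.
rewrite dl_tips// in_setD1 => /andP[_ /(wf_tipm (W g))].
by rewrite (mg1 og) => h; case/eqP: f0m; exact: esym h.
Qed.

Definition rmate x := if x == f0 then f1 else if x == f1 then f0 else m f0 x.

Let rho0 := Spikelike setT rmate (tips (S f0)) (lifted (S f0)) (cyclical (S f0)) set0.

(** The words are not inherited from any [S g] but read off [M], as its dependent transversals. *)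
Let rwords := if lifted (S f0) && cyclical (S f0) then
  [set X | transversal_set rho0 X && (X \notin indep M)] else set0.

Definition rho := Spikelike setT rmate (tips (S f0)) (lifted (S f0)) (cyclical (S f0)) rwords.

Let f10 : f1 != f0. Proof. exact: f0m. Qed.

Let rmate_inv : involutive rmate.
Proof.
have [h1 _] := f1_fix.
move=> x; rewrite /rmate; case: (eqVneq x f0) => [->|x0].
  by rewrite (negPf f10) eqxx.
case: (eqVneq x f1) => [->|x1]; first by rewrite eqxx.
have -> : (m f0 x == f0) = false.
  by apply/negP => /eqP h; move: x0; rewrite -[x](inv f0) h mff eqxx.
have -> : (m f0 x == f1) = false.
  by apply/negP => /eqP h; move: x1; rewrite -[x](inv f0) h h1 eqxx.
exact: inv.
Qed.

Let rmate_other g : other g -> rmate g = m e g.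
Proof. by move=> og; have [_ g0 g1] := og; rewrite /rmate (negPf g0) (negPf g1) m0g. Qed.

Let rtip x : x \in tips (S f0) -> rmate x = x.
Proof.
move=> xt; have [_ h] := f1_fix.
have x0 : x != f0.
  by apply: contraTneq (subsetP (wf_tip (W f0)) _ xt) => ->; rewrite gS !inE eqxx.
have x1 : x != f1 by apply: contraNneq h => <-.
by rewrite /rmate (negPf x0) (negPf x1) (wf_tipm (W f0)).
Qed.

Let wf0 : wf rho0.
Proof.
split=> //=.
- by move=> x; rewrite inE.
- by move=> w; rewrite inE.
- by move=> w x; rewrite inE.
Qed.

Let sk g : other g -> same_skeleton (dl rho0 g) (S g) /\ ground (dl rho0 g) = ground (S g).
Proof.
move=> og; have [gm g0 g1] := og; have ge := leg_neq gm.
have [mm0 tt0 ll0 cc0] := cmp (f := f0) (g := g) ltac:(by rewrite eq_sym) many0.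
have fg0 : m g f0 != f0 by rewrite mg0.
have gg0 : m f0 g != g by rewrite m0g.
split; last by rewrite dl_ground gS; apply/setP => x; rewrite !inE andbT.
split.
- move=> x; rewrite dl_mate /=.
  case: (eqVneq x g) => [->|xg] /=; first by rewrite mff.
  rewrite /rmate; case: (eqVneq x f0) => [->|x0].
    by rewrite [f1 == g]eq_sym (negPf g1) mg0.
  case: (eqVneq x f1) => [->|x1].
    by rewrite [f0 == g]eq_sym (negPf g0) mg1.
  have := mm0 x; rewrite !dl_mate (negPf xg) (negPf x0) /=.
  have -> : (m g x == f0) = false.
    by apply/negP => /eqP h; move: x1; rewrite -[x](inv g) h mg0// eqxx.
  by [].
- rewrite dl_tips//=; have := tt0; rewrite !dl_tips// => ->.
  apply/setP => x; rewrite in_setD1; case: (eqVneq x f0) => [->|//] /=.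
  by symmetry; apply/negP => /(wf_tipm (W g)) h; rewrite h eqxx in fg0.
- by rewrite dl_lifted/=; have := ll0; rewrite !dl_lifted.
- rewrite dl_cyclical /=; last by rewrite rmate_other// gm.
  by have := cc0; rewrite !dl_cyclical ?fg0 ?gg0.
Qed.

Let full_other g X : other g -> g \notin X -> full (S g) X = full rho0 X.
Proof.
by move=> og gX; have [sk' _] := sk og; rewrite -(skeleton_full X sk') dl_full.
Qed.

(** The sets whose independence depends on words are settled by the choice of the words. Any other
    set that misses an element [g] of a leg other than that of [f0] is tested in [S g], which has
    the skeleton of [rho0] with [g] deleted. A set missing no such element contains two whole legs
    and is dependent on both sides. *)
Let rho_sindep X : (X \in indep M) = sindep rho X.
Proof.
case: (boolP [&& lifted (S f0), cyclical (S f0), spans rho0 X & full rho0 X == set0]).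
  case/and4P => ls cs sp /eqP f0'.
  have tX : transversal_set rho0 X.
    rewrite /transversal_set sp f0' eqxx !andbT; apply/subsetP => x xX.
    rewrite !inE andbT; apply/negP => xt.
    have : x \in full rho0 X by apply: tips_full.
    by rewrite f0' inE.
  rewrite /sindep /= ls cs /= -[spans rho X]/(spans rho0 X) sp.
  rewrite -[one_unit rho X]/(one_unit rho0 X) full0_one//.
  rewrite -[full rho X]/(full rho0 X) f0' eqxx /= /rwords ls cs /= inE tX /=.
  by rewrite negbK.
move=> ncond.
have -> : sindep rho X = sindep rho0 X.
  by symmetry; apply: skeleton_sindep.
case: (boolP [forall g, (m e g != g) && (g != f0) && (g != f1) ==> (g \in X)]).
  move=> /forallP H.
  have HX g : other g -> g \in X.
    by move=> [gm g0 g1]; have := H g; rewrite gm g0 g1.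
  have [|a [oa _ _]] := pick_other (Z := set0); first by rewrite cards0.
  have [|b [ob bZ mbZ]] := pick_other (Z := [set a; m e a]).
    by rewrite cards2; case: (_ != _).
  have [am _ _] := oa; have [bm _ _] := ob.
  move: bZ; rewrite in_set2 negb_or => /andP[ba bma].
  have r0 : sindep rho0 X = false.
    apply: sindep_not_few; apply: (two_units (x := a) (y := b)) => //.
    - by apply: leg_full => /=; rewrite ?rmate_other ?HX//; exact: otherm.
    - by apply: leg_full => /=; rewrite ?rmate_other ?HX//; exact: otherm.
    - by rewrite /= rmate_other.
  rewrite r0; apply/negP => XI.
  have : [set a; m e a; b; m e b] \in indep M.
    apply: indep_sub XI _; apply/subsetP => x; rewrite !inE -!orbA.
    by case/or4P => /eqP ->; apply: HX => //; exact: otherm.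
  have ne x : other x -> (e == x) = false.
    by case=> xm _ _; rewrite eq_sym; exact/negbTE/leg_neq.
  rewrite (SE (f := e)); last by rewrite !inE !ne//; exact: otherm.
  rewrite sindep_not_few//; apply: (two_units (x := a) (y := b)) => //.
  - by apply: leg_full; rewrite // !inE eqxx ?orbT.
  - by apply: leg_full; rewrite // !inE eqxx ?orbT.
case/forallPn => g; rewrite negb_imply => /andP[/andP[/andP[gm g0] g1] gX].
have og : other g by [].
rewrite (SE gX); have [sk' gE] := sk og.
have [rgm] : mate rho0 g != g by rewrite /= rmate_other.
have s0 : sindep rho0 set0.
  have f00 : full rho0 set0 = set0 by apply/setP => x; rewrite !inE.
  have ns : spans rho0 set0 = false.
    by apply: (spansN (x := g)); rewrite ?inE//; apply: (leg_tips wf0).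
  by rewrite small_sindep// /few_units full0_one// f00 eqxx if_same.
rewrite -(dl_sindep (f := g) wf0 s0 (subsetT _) gX).
symmetry; apply: skeleton_sindep => //.
apply: contra ncond; rewrite dl_lifted dl_cyclical ?rgm// dl_full//.
case/and4P => /= -> -> sp ->; rewrite andbT.
exact: dl_spans sp.
Qed.

(** Two words that differ only in the leg of [x] both miss some [g] of another leg. Both are then
    words of [S g], where [wf_dist] is known. *)
Lemma rho_wf : wf rho.
Proof.
have [h1 h2 h3 h4 h5 h6] := wf0.
split=> //.
- move=> w /=; rewrite /rwords; case: ifP => _; last by rewrite inE.
  by rewrite inE => /andP[].
- move=> w x /=; rewrite /rwords; case: ifP => [/andP[ls cs]|_]; last by rewrite inE.
  rewrite !inE => /andP[tw wI] xw xm; apply/negP => /andP[tw' wI'].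
  set w' := rmate x |: w :\ x in tw' wI'.
  have [|h [oh hZ mhZ]] := pick_other (Z := [set x; rmate x]).
    by rewrite cards2; case: (_ != _).
  have /and3P[_ _ /eqP fw] := tw; have /and3P[_ _ /eqP fw'] := tw'.
  have [g [og gZ mgZ gw]] : exists g, [/\ other g, g \notin [set x; rmate x],
      m e g \notin [set x; rmate x] & g \notin w].
    case: (boolP (h \in w)) => hw; last by exists h.
    exists (m e h); split=> //; [exact: otherm|by rewrite (inv e)|].
    apply/negP => mw; have : h \in full rho0 w.
      have [hm _ _] := oh; by apply: leg_full => /=; rewrite ?rmate_other.
    by rewrite fw inE.
  move: gZ mgZ; rewrite !in_set2 !negb_or => /andP[gx gmx] /andP[mgx mgmx].
  have gw' : g \notin w' by rewrite !inE negb_or gmx negb_and gw orbT.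
  have [[mm _ ll _] _] := sk og.
  have ls' : lifted (S g) by rewrite -ll dl_lifted.
  have inW v : v \notin indep M -> full rho0 v = set0 -> g \notin v -> v \in words (S g).
    move=> vI fv gv; move: vI; rewrite (SE gv) /sindep ls' full0_one ?full_other//=.
    by rewrite fv eqxx /= negb_imply negbK => /andP[].
  have := wf_dist (W g) (inW _ wI fw gw) xw.
  have -> : m g x = rmate x.
    rewrite -mm dl_mate /= [x == g]eq_sym (negPf gx) /=.
    by rewrite [rmate x == g]eq_sym (negPf gmx).
  by move=> /(_ xm); rewrite -/w' (inW _ wI' fw' gw').
Qed.

Lemma rho_represents : represents rho M.
Proof. by split=> //; exact: rho_wf. Qed.

Lemma rho_legs : 20 <= #|legs rho|.
Proof.
apply: leq_trans (leq_trans _ many0) _ => //; apply: subset_leq_card.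
apply/subsetP => x; rewrite !inE /= /rmate.
case: (eqVneq x f0) => [->|_]; first by rewrite mff eqxx.
by case: (eqVneq x f1) => [->|//]; rewrite (f1_fix.1) eqxx.
Qed.

End Extension.

Lemma pick_outside (T : finType) (A Z : {set T}) : #|A| < #|Z| ->
  exists2 z, z \in Z & z \notin A.
Proof.
move=> lt; apply/subsetPn; apply/negP => /subset_leq_card; lia.
Qed.

Lemma sub_notin (T : finType) (x : T) (X : {set T}) :
  x \notin X -> X \subset ~: [set x].
Proof. by move=> xX; rewrite subsetC sub1set inE. Qed.

(** * Behaviour of tips and singles, and addition of one of them *)

Section Tips.
Variables (E : finType) (s : spikelike E).
Hypothesis W : wf s.
Implicit Types (t x y z : E) (X : {set E}).

Lemma full_tip X t : t \in X -> t \in tips s -> full s X = t |: full s (X :\ t).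
Proof.
move=> tX tt; have tm := wf_tipm W tt; have inv := wf_inv W.
apply/setP => x; rewrite in_setU1; case: (eqVneq x t) => [->|xt] /=.
  exact: tips_full.
apply/fullP/fullP; rewrite !inE xt /=; case=> xX mX h; split=> //.
- by rewrite mX andbT; apply: contra xt => /eqP h'; rewrite -[x]inv h' tm.
- by case/andP: mX.
Qed.

Lemma spans_tip X t : t \in tips s -> spans s (X :\ t) = spans s X.
Proof.
move=> tt; apply/spansP/spansP => H x xg xt; have := H x xg xt; rewrite !inE.
  by case=> /andP[_ h]; auto.
have -> : x != t by apply: contraNneq xt => ->.
have -> // : mate s x != t.
by apply: contraNneq xt => h; rewrite -(mate_tips _ W) h.
Qed.

(** The tip uses up the one unit allowed, so the rest is tested by the rule of unlifted structures,
    that is, in the contraction of the tip. *)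
Lemma sindep_tip X t : lifted s -> t \in X -> t \in tips s ->
  sindep s X = (full s (X :\ t) == set0) && ~~ (cyclical s && spans s (X :\ t)).
Proof.
move=> ls tX tt; rewrite /sindep ls spans_tip//.
have fn : (full s X == set0) = false.
  by apply/negP => /eqP f0; have := tips_full W tX tt; rewrite f0 inE.
rewrite fn /= implybF; congr (_ && _).
apply/one_unitP/eqP => [H|f0 x y].
  apply/setP => y; rewrite [RHS]inE; apply/negP => yf.
  have /fullP[+ _ _] := yf; rewrite !inE => /andP[yt _].
  have [||h|h] := H t y; rewrite ?(full_tip tX tt) ?setU11// ?in_setU1 ?yf ?orbT//.
    by rewrite h eqxx in yt.
  by rewrite h (wf_tipm W tt) eqxx in yt.
by rewrite (full_tip tX tt) f0 setU0 !in_set1 => /eqP-> /eqP->; left.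
Qed.

Lemma full_single X x : mate s x = x -> x \notin tips s -> full s (X :\ x) = full s X.
Proof.
move=> xm xt; have inv := wf_inv W; apply/setP => y.
apply/fullP/fullP; rewrite !inE; case=> yX mX h; split=> //.
- by case/andP: yX.
- by case/andP: mX.
- rewrite yX andbT; apply/eqP => e; subst y.
  by case: h => h; [rewrite h in xt|case: h].
- rewrite mX andbT; apply/eqP => e; have ey : y = x by rewrite -[y]inv e.
  by subst y; case: h => h; [rewrite h in xt|case: h].
Qed.

End Tips.

Section Add.
Variables (E : finType) (s : spikelike E) (x : E).
Hypotheses (W : wf s) (gs : ground s = ~: [set x]).
Let inv := wf_inv W.
Implicit Types (y z : E) (X : {set E}).

Definition addtip : spikelike E :=
  Spikelike setT (mate s) (x |: tips s) (lifted s) (cyclical s) (words s).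
Definition addsingle : spikelike E :=
  Spikelike setT (mate s) (tips s) (lifted s) (cyclical s) [set x |: w | w in words s].

Let xm : mate s x = x. Proof. by apply: wf_out; rewrite // gs !inE eqxx. Qed.
Let xt : x \notin tips s.
Proof. by apply/negP => /(subsetP (wf_tip W)); rewrite gs !inE eqxx. Qed.

Let mx y : (mate s y == x) = (y == x).
Proof. by rewrite -{1}xm (inj_eq (inv_inj inv)). Qed.

Lemma addtip_full X : x \notin X -> full addtip X = full s X.
Proof.
move=> xX; apply/setP => y; rewrite /full !inE /=; case: (boolP (y \in X)) => //= yX.
by have -> : (y == x) = false by apply/negP => /eqP e; rewrite e (negPf xX) in yX.
Qed.

Lemma addtip_spans X : spans addtip X = spans s X.
Proof.
apply/spansP/spansP => H y; have := H y; rewrite /= gs !inE.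
  by move=> h yx yt; apply: h; rewrite // negb_or yx.
by move=> h _; rewrite negb_or => /andP[yx yt]; exact: h.
Qed.

Lemma addtip_one X : x \notin X -> one_unit addtip X = one_unit s X.
Proof.
by move=> xX; apply/one_unitP/one_unitP => H u v; have := H u v; rewrite addtip_full.
Qed.

Lemma addtip_sindep X : x \notin X -> sindep addtip X = sindep s X.
Proof.
by move=> xX; rewrite /sindep /= addtip_full// addtip_spans addtip_one.
Qed.

Lemma addtip_wf : wf addtip.
Proof.
split=> //=.
- by move=> y; rewrite inE.
- by move=> y; rewrite in_setU1 => /orP[/eqP->//|/(wf_tipm W)].
- move=> w wW; have /and3P[wg ws /eqP wf0] := wf_words W wW.
  have xw : x \notin w by apply/negP => /(subsetP wg); rewrite gs !inE eqxx andbF.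
  rewrite /transversal_set addtip_full// addtip_spans ws wf0 eqxx !andbT.
  apply/subsetP => y yw; have := subsetP wg _ yw.
  by rewrite !inE gs !inE negb_or => /andP[-> ->].
- exact: wf_dist.
Qed.

Lemma addsingle_full X : full addsingle X = full s X.
Proof. by apply/setP => y; rewrite !inE. Qed.

Lemma addsingle_one X : one_unit addsingle X = one_unit s X.
Proof. by apply/one_unitP/one_unitP => H u v; have := H u v; rewrite addsingle_full. Qed.

Lemma addsingle_spans X : spans addsingle X = (x \in X) && spans s (X :\ x).
Proof.
apply/spansP/andP => [H|[xX /spansP H] y _ yt].
  split; first by case: (H x); rewrite ?inE//= xm.
  apply/spansP => y; rewrite gs !inE => yx yt.
  by rewrite mx yx /=; apply: H; rewrite ?inE.
case: (eqVneq y x) => [->|yx]; first by left.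
by have := H y; rewrite gs !inE mx yx /=; apply.
Qed.

Let words_x w : w \in words s -> x \notin w.
Proof.
move=> /(wf_words W)/and3P[wg _ _].
by apply/negP => /(subsetP wg); rewrite gs !inE eqxx andbF.
Qed.

Lemma addsingle_words X : x \in X -> (X \in words addsingle) = (X :\ x \in words s).
Proof.
move=> xX; apply/imsetP/idP => [[w wW ->]|h]; first by rewrite setU1K// words_x.
by exists (X :\ x); rewrite // setD1K.
Qed.

Lemma addsingle_in X : x \in X -> sindep addsingle X = sindep s (X :\ x).
Proof.
move=> xX; rewrite /sindep /= addsingle_full addsingle_one addsingle_spans xX /=.
rewrite -[X \in [set _ | _ in _]]/(X \in words addsingle) addsingle_words//.
rewrite (full_single W)//; case: ifP => // _; congr (_ && _).
by apply/one_unitP/one_unitP => H u v; have := H u v; rewrite (full_single W).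
Qed.

Lemma addsingle_out X : x \notin X -> sindep addsingle X = few_units s X.
Proof.
move=> xX; rewrite small_sindep; last by rewrite addsingle_spans (negPf xX).
by rewrite /few_units /= addsingle_full addsingle_one.
Qed.

Lemma addsingle_wf : wf addsingle.
Proof.
split=> //=.
- by move=> y; rewrite inE.
- exact: wf_tipm.
- move=> w /imsetP[v vW ->]; have /and3P[vg vs /eqP vf] := wf_words W vW.
  have xv := words_x vW.
  rewrite /transversal_set addsingle_spans setU11 setU1K// vs /= addsingle_full.
  rewrite -(full_single W _ xm xt) setU1K// vf eqxx andbT.
  apply/subsetP => y; rewrite !inE andbT => /orP[/eqP->//|/(subsetP vg)].
  by rewrite !inE => /andP[].
- move=> w y /imsetP[v vW ->]; have xv := words_x vW.
  rewrite in_setU1 => /orP[/eqP->|yv ym]; first by rewrite xm eqxx.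
  have yx : y != x by apply: contraNneq ym => ->; rewrite xm.
  apply/negP => /imsetP[u uW e]; have := wf_dist W vW yv ym.
  have xu := words_x uW.
  suff -> : mate s y |: v :\ y = u by rewrite uW.
  rewrite -(setU1K xu) -e; apply/setP => z; rewrite !inE.
  case: (eqVneq z x) => [->|//] /=.
  by rewrite [x == mate s y]eq_sym mx (negPf yx) (negPf xv) andbF.
Qed.

Lemma addsingle_card : #|words addsingle| <= #|words s|.
Proof. exact: leq_imset_card. Qed.

End Add.

(** * Loops and parallel classes of an excluded minor *)

Section ExcludedMinor.
Variables (E : finType) (M : matroid E) (k : nat).
Hypothesis exM : excluded_minor (spike_minor_class k) M.
Implicit Types (e f x y z : E) (X Y Z : {set E}).

Let notS : ~ spike_minor_class k M. Proof. by case: exM. Qed.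

Lemma exm_del e : exists s, structured k (fun X => X \in indep M) (~: [set e]) s.
Proof.
have := exM.2 set0 [set e]; rewrite set0U -setI_eq0 set0I eqxx.
have -> : [set e] != set0 by apply/set0Pn; exists e; rewrite inE.
move=> /(_ isT isT) /(minor_structured (indep0 M))[s [h1 h2 h3 h4]].
exists s; split=> //; first by rewrite h2 set0U.
by move=> X sX; rewrite -h4 ?setU0 ?set0U.
Qed.

Lemma exm_con e : [set e] \in indep M ->
  exists s, structured k (fun X => e |: X \in indep M) (~: [set e]) s.
Proof.
move=> eI; have := exM.2 [set e] set0; rewrite setU0 -setI_eq0 setI0 eqxx.
have -> : [set e] != set0 by apply/set0Pn; exists e; rewrite inE.
move=> /(_ isT isT) /(minor_structured eI)[s [h1 h2 h3 h4]].
exists s; split=> //; first by rewrite h2 setU0.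
by move=> X sX; rewrite -h4 ?setU0// setUC.
Qed.

Lemma exm_not_small s : represents s M -> #|words s| <= k -> False.
Proof.
by move=> rep wk; have [_ _] := not_in_class notS rep; rewrite ltnNge wk.
Qed.

(** Let [x] be one of three loops. If the structure of the deletion of [x] is unlifted, its tips are
    loops and [x] is added as one. If it is lifted, each further loop spans and is a tip or a word;
    two of them force all elements to be tips, so that [M] has rank 0. *)
Lemma few_loops Z : (forall z, z \in Z -> [set z] \notin indep M) -> #|Z| <= 2.
Proof.
move=> Zl; rewrite leqNgt; apply/negP => Z3.
have [x xZ _] : exists2 x, x \in Z & x \notin (set0 : {set E}).
  by apply: pick_outside; rewrite cards0; lia.
have [s [W gs wk sM]] := exm_del x.
have xl X : x \in X -> X \notin indep M.
  by move=> xX; apply: contra (Zl _ xZ) => XI; apply: indep_sub XI _; rewrite sub1set.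
case: (boolP (lifted s)) => ls; last first.
  apply: (@exm_not_small (addtip s x)) => //; split=> //; first exact: addtip_wf.
  move=> X; case: (boolP (x \in X)) => xX; last by rewrite addtip_sindep// -sM ?sub_notin.
  rewrite (negPf (xl _ xX)); symmetry; apply/negP.
  rewrite /sindep /= (negPf ls) => /andP[/eqP f0 _].
  have : x \in full (addtip s x) X.
    by apply: tips_full; rewrite ?setU11//; exact: addtip_wf.
  by rewrite f0 inE.
have [y yZ] : exists2 y, y \in Z & y \notin [set x] by apply: pick_outside; rewrite cards1; lia.
rewrite in_set1 => yx.
have [z zZ] : exists2 z, z \in Z & z \notin [set x; y].
  by apply: pick_outside; rewrite cards2; case: (_ != _); lia.
rewrite in_set2 negb_or => /andP[zx zy].
have dep u : u \in Z -> u != x -> [/\ cyclical s, spans s [set u] &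
    u \in tips s \/ [set u] \in words s].
  move=> uZ ux; have := Zl _ uZ; rewrite sM ?sub_notin ?in_set1 1?eq_sym//.
  have ff v : v \in full s [set u] -> v = u /\ u \in tips s.
    move=> /fullP[]; rewrite !in_set1 => /eqP -> /eqP h [//|//].
  have one : one_unit s [set u] by apply/one_unitP => a b /ff[-> _] /ff[-> _]; left.
  rewrite /sindep ls one /= negb_imply => /andP[/andP[cs sp]].
  rewrite negb_and negbK => /orP[/set0Pn[v /ff[_ h]]|h]; split=> //; by [left|right].
have [cs sy hy] := dep _ yZ yx; have [_ sz hz] := dep _ zZ zx.
have yg : y \in ground s by rewrite gs !inE.
have zg : z \in ground s by rewrite gs !inE.
have mem u v : u \in ground s -> u \notin tips s -> spans s [set v] -> u = v \/ mate s u = v.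
  move=> ug ut /spansP /(_ u ug ut); rewrite !in_set1.
  by case=> /eqP; auto.
have all_tips : forall u, u \in ground s -> u \in tips s.
  have yt : y \in tips s.
    apply/negPn/negP => yt; case: (mem _ _ yg yt sz) => h.
      by rewrite h eqxx in zy.
    have ym : mate s y != y by rewrite h.
    have zt : z \notin tips s by rewrite -h mate_tips.
    have yW : [set y] \in words s by case: hy => // h'; rewrite h' in yt.
    have zW : [set z] \in words s by case: hz => // h'; rewrite h' in zt.
    have := wf_dist W yW (set11 y) ym; rewrite h.
    suff -> : z |: [set y] :\ y = [set z] by rewrite zW.
    by apply/setP => u; rewrite !inE; case: (u == y); rewrite ?andbF ?orbF.
  move=> u ug; apply/negPn/negP => ut; case: (mem _ _ ug ut sy) => h.
    by rewrite h yt in ut.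
  by move: yt; rewrite -h mate_tips// (negPf ut).
have allloop u : [set u] \notin indep M.
  case: (eqVneq u x) => [->|ux]; first exact: Zl.
  rewrite sM ?sub_notin ?in_set1 1?eq_sym//.
  have ug : u \in ground s by rewrite gs !inE.
  have uf : u \in full s [set u] by apply: tips_full; rewrite ?set11// all_tips.
  rewrite /sindep ls cs.
  have -> : spans s [set u] by apply/spansP => v vg; rewrite all_tips.
  have -> : (full s [set u] == set0) = false by apply/negP => /eqP f0; rewrite f0 inE in uf.
  by rewrite andbF.
pose t := Spikelike setT id [set: E] false false set0.
have Wt : wf t.
  split=> //.
  - by move=> w; rewrite inE.
  - by move=> w u; rewrite inE.
apply: (@exm_not_small t); last by rewrite /= cards0.
split=> // X; rewrite /sindep /= andbT.
apply/idP/eqP => [XI|f0].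
  apply/setP => u; rewrite [RHS]inE; apply/negP => /fullP[uX _ _].
  by move/negP: (allloop u); apply; apply: indep_sub XI _; rewrite sub1set.
suff -> : X = set0 by exact: indep0.
apply/setP => u; rewrite [RHS]inE; apply/negP => uX.
have : u \in full t X by apply: tips_full; rewrite ?inE.
by rewrite f0 inE.
Qed.

Lemma parallel_swap x y X : [set x; y] \notin indep M -> [set y] \in indep M ->
  x \in X -> y \notin X -> X \in indep M -> y |: X :\ x \in indep M.
Proof.
move=> xy yI xX yX XI.
have [|Z [h1 h2 h3 h4]] := indep_extend yI XI.
  by rewrite cards1; apply/card_gt0P; exists x.
rewrite sub1set in h1.
have xZ : x \notin Z.
  apply: contra xy => xZ; apply: indep_sub h3 _.
  by apply/subsetP => u; rewrite in_set2 => /orP[]/eqP->.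
have ZX : Z \subset y |: X :\ x.
  apply/subsetP => u uZ; have := subsetP h2 _ uZ; rewrite !inE => /orP[->//|->].
  by rewrite andbT orbC; apply/orP; left; apply: contraNneq xZ => <-.
suff <- : Z = y |: X :\ x by [].
apply/eqP; rewrite eqEcard ZX h4 cardsU1 !inE (negPf yX) andbF /=.
by have := cardsD1 x X; rewrite xX => ->.
Qed.

(** If no tip of the deletion of [x] were in [Z], one could choose [u], [v], [w] in [Z], no two of
    them mates, avoiding at most five elements each time; the dependent pair [u], [v] would have to
    span and yet misses [w]. So there is a tip [y] parallel to [x], and [x] is added as a tip beside
    it. *)
Lemma few_parallel Z : (forall z, z \in Z -> [set z] \in indep M) ->
  (forall y z, y \in Z -> z \in Z -> y != z -> [set y; z] \notin indep M) ->
  #|Z| <= 6.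
Proof.
move=> Zn Zp; rewrite leqNgt; apply/negP => Z7.
have [x xZ _] : exists2 x, x \in Z & x \notin (set0 : {set E}).
  by apply: pick_outside; rewrite cards0; lia.
have [s [W gs wk sM]] := exm_del x.
have inv := wf_inv W.
have single u : u \in Z -> u != x -> sindep s [set u].
  by move=> uZ ux; rewrite -sM ?Zn// sub_notin// in_set1 eq_sym.
have pair u v : u \in Z -> v \in Z -> u != x -> v != x -> u != v -> ~~ sindep s [set u; v].
  move=> uZ vZ ux vx uv; rewrite -sM ?Zp// sub_notin// in_set2 negb_or.
  by rewrite ![x == _]eq_sym ux vx.
have [y [yZ yx yt]] : exists y, [/\ y \in Z, y != x & y \in tips s].
  case: (boolP [exists y, [&& y \in Z, y != x & y \in tips s]]).
    by case/existsP => y /and3P[]; exists y.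
  move/existsPn => nt; exfalso.
  have nt' u : u \in Z -> u != x -> u \notin tips s.
    by move=> uZ ux; have := nt u; rewrite uZ ux.
  have [u uZ] : exists2 u, u \in Z & u \notin [set x] by apply: pick_outside; rewrite cards1; lia.
  rewrite in_set1 => ux.
  have [v vZ] : exists2 v, v \in Z & v \notin [set x; u; mate s u].
    apply: pick_outside; apply: leq_ltn_trans (leq_card_setU _ _) _.
    by rewrite cards1 cards2; case: (_ != _); lia.
  rewrite !inE !negb_or => /andP[/andP[vx vu] vmu].
  have [w wZ] : exists2 w, w \in Z & w \notin [set x; u; mate s u] :|: [set v; mate s v].
    apply: pick_outside; apply: leq_ltn_trans (leq_card_setU _ _) _.
    have h : #|[set x; u; mate s u]| <= 3.
      apply: leq_trans (leq_card_setU _ _) _.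
      by rewrite cards1 cards2; case: (_ != _).
    by rewrite cards2; case: (_ != _); lia.
  rewrite !inE !negb_or -!andbA => /and5P[wx wu wmu wv wmv].
  have ut := nt' _ uZ ux; have vt := nt' _ vZ vx; have wt := nt' _ wZ wx.
  have : spans s [set u; v].
    apply/negPn/negP => nsp; have := pair _ _ uZ vZ ux vx ltac:(by rewrite eq_sym).
    rewrite small_sindep; last exact: negbTE.
    rewrite /few_units; case: ifP => _.
      by move=> /negbTE /(one_unit2_tips W)[h _]; rewrite h in ut.
    case/set0Pn => a /fullP[]; rewrite !in_set2.
    move=> /orP[]/eqP-> /orP[]/eqP h [h'|h']; rewrite ?h' // in ut vt.
    - by rewrite h eqxx in vmu.
    - by rewrite -h inv eqxx in vmu.
  move=> /spansP /(_ w); rewrite gs !inE => /(_ wx wt).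
  rewrite (negPf wu) (negPf wv) /= => -[//|/orP[]/eqP h].
  - by rewrite -h inv eqxx in wmu.
  - by rewrite -h inv eqxx in wmv.
(* In an unlifted structure the tip [y] would be a loop. *)
have ls : lifted s.
  apply/negPn/negP => ls; have := single _ yZ yx.
  rewrite /sindep (negPf ls) => /andP[/eqP f0 _].
  by have := tips_full W (set11 y) yt; rewrite f0 inE.
have Wa := addtip_wf W gs.
apply: (@exm_not_small (addtip s x)) => //; split=> // X.
case: (boolP (x \in X)) => xX; last by rewrite addtip_sindep// -sM ?sub_notin.
case: (boolP (y \in X)) => yX.
  have -> : sindep (addtip s x) X = false.
    apply: sindep_not_few; apply: (two_units (x := x) (y := y)) => //=.
    - by apply: tips_full => //; exact: setU11.
    - by apply: tips_full => //; rewrite /= in_setU1 yt orbT.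
    - have -> // : mate s x = x by apply: wf_out; rewrite // gs !inE eqxx.
  apply/negP => XI; have /negP := Zp _ _ xZ yZ ltac:(by rewrite eq_sym); apply.
  by apply: indep_sub XI _; apply/subsetP => u; rewrite in_set2 => /orP[]/eqP->.
have xyd : [set x; y] \notin indep M by apply: Zp => //; rewrite eq_sym.
have -> : (X \in indep M) = (y |: X :\ x \in indep M).
  apply/idP/idP; first by apply: parallel_swap => //; exact: Zn.
  move=> h; have : x |: (y |: X :\ x) :\ y \in indep M.
    apply: parallel_swap h => //; [by rewrite setUC|exact: Zn|exact: setU11|].
    by rewrite !inE eqxx /= orbF eq_sym.
  suff -> : x |: (y |: X :\ x) :\ y = X by [].
  by rewrite setU1K ?setD1K// !inE (negPf yX) andbF.
have xn : x \notin y |: X :\ x by rewrite !inE eqxx /= orbF eq_sym.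
rewrite sM ?sub_notin// (sindep_tip W ls (setU11 _ _) yt).
rewrite (@sindep_tip _ (addtip s x) Wa X x)//=; last exact: setU11.
rewrite setU1K; last by rewrite !inE (negPf yX) andbF.
by rewrite addtip_full ?addtip_spans// !inE eqxx.
Qed.

(** Tips are all loops or pairwise parallel: in the lifted case two tips are always dependent, and
    the criterion for a tip to be a loop does not involve the tip. *)
Lemma few_tips e s : structured k (fun X => X \in indep M) (~: [set e]) s ->
  #|tips s| <= 6.
Proof.
case=> W gs wk sM.
have tg t : t \in tips s -> [set t] \subset ~: [set e].
  by move=> tt; rewrite -gs sub1set (subsetP (wf_tip W)).
case: (boolP (lifted s)) => ls; last first.
  apply: leq_trans (few_loops _) _ => // t tt; rewrite sM ?tg// sindep_not_few//.
  rewrite /few_units (negPf ls); apply/negP => /eqP f0.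
  by have := tips_full W (set11 t) tt; rewrite f0 inE.
case: (boolP [exists t in tips s, [set t] \notin indep M]).
  case/exists_inP => t tt; rewrite sM ?tg// (sindep_tip W ls (set11 t) tt).
  rewrite setDv (_ : full s set0 = set0) ?eqxx /= ?negbK; last first.
    by apply/setP => x; rewrite !inE.
  move=> /andP[cs sp]; apply: leq_trans (few_loops _) _ => // u ut.
  rewrite sM ?tg// (sindep_tip W ls (set11 u) ut) setDv cs sp.
  by rewrite andbF.
move/exists_inPn => H; apply: few_parallel => [t tt|t u tt ut tu].
  by have := H t tt; rewrite negbK.
rewrite sM; last by rewrite subUset !tg.
rewrite sindep_not_few//; apply: (two_units (x := t) (y := u)).
- by apply: tips_full; rewrite // in_set2 eqxx.
- by apply: tips_full; rewrite // in_set2 eqxx orbT.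
- by rewrite eq_sym.
- by rewrite (wf_tipm W)// eq_sym.
Qed.

End ExcludedMinor.

(** * Series classes, and the bound on excluded minors of odd size *)

Definition singles (E : finType) (s : spikelike E) : {set E} :=
  [set x in ground s :\: tips s | mate s x == x].

Lemma singlesP (E : finType) (s : spikelike E) x :
  reflect [/\ x \in ground s, x \notin tips s & mate s x = x] (x \in singles s).
Proof.
rewrite !inE; apply: (iffP andP) => [[/andP[-> ->] /eqP]//|[-> -> ->]].
by rewrite eqxx.
Qed.

Lemma few_units_single (E : finType) (s : spikelike E) (X : {set E}) x : wf s ->
  x \in singles s -> few_units s (X :\ x) = few_units s X.
Proof.
move=> W /singlesP[_ xt xm]; rewrite /few_units (full_single W)//.
case: ifP => // _.
by apply/one_unitP/one_unitP => H u v; have := H u v; rewrite (full_single W).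
Qed.

Lemma sindep_missing_single (E : finType) (s : spikelike E) (X : {set E}) x :
  x \in singles s -> x \notin X -> sindep s X = few_units s X.
Proof.
move=> /singlesP[xg xt xm] xX; apply: small_sindep.
by apply: (spansN (x := x)); rewrite // xm.
Qed.

Lemma odd_involution_fix (E : finType) (f : E -> E) : involutive f -> odd #|E| ->
  exists x, f x = x.
Proof.
move=> fK oE; case: (pickP (fun x => f x == x)) => [x /eqP|nf]; first by exists x.
pose T := [set x | enum_rank x < enum_rank (f x)].
have fT : f @: T = ~: T.
  apply/setP => x; rewrite -{1}[x]fK (mem_imset _ _ (inv_inj fK)) !inE fK -leqNgt.
  rewrite ltn_neqAle; have := negbT (nf x); case: (eqVneq (enum_rank (f x)) (enum_rank x)).
    by move/enum_rank_inj ->; rewrite eqxx.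
  by move=> h _; have -> : (enum_rank (f x) != enum_rank x :> nat) by [].
have := cardsC T; rewrite -fT card_imset; last exact: inv_inj.
by move=> e; move: oE; rewrite -e addnn odd_double.
Qed.

Section ExcludedMinor.
Variables (E : finType) (M : matroid E) (k : nat).
Hypothesis exM : excluded_minor (spike_minor_class k) M.
Implicit Types (e f x y z : E) (X Y Z : {set E}).

(** The hypothesis says that no circuit contains one of two elements of [Z] without the other. Eight
    elements are [x], at most two tips of the contraction of [x], and five more; if those all lay in
    legs, three of the legs would yield a circuit through [a] that avoids [b]. So some [y] is a
    single, and [x] is added as a single in series with it. *)
Lemma few_series Z :
  (forall y z, y \in Z -> z \in Z -> y != z -> forall X, y \notin X -> z \notin X ->
    X \in indep M -> y |: X \in indep M) -> #|Z| <= 7.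
Proof.
move=> Zs; rewrite leqNgt; apply/negP => Z8.
have [x xZ _] : exists2 x, x \in Z & x \notin (set0 : {set E}).
  by apply: pick_outside; rewrite cards0; lia.
have [x' xZ'] : exists2 x', x' \in Z & x' \notin [set x].
  by apply: pick_outside; rewrite cards1; lia.
rewrite in_set1 => x'x.
have xI : [set x] \in indep M.
  by rewrite -[[set x]]setU0; apply: (Zs x x'); rewrite ?inE ?indep0// eq_sym.
have [s [W gs wk sM]] := exm_con exM xI.
have inv := wf_inv W.
have ser u v X : u \in Z -> v \in Z -> u != x -> v != x -> u != v ->
    x \notin X -> u \notin X -> v \notin X -> sindep s X -> sindep s (u |: X).
  move=> uZ vZ ux vx uv xX uX vX; rewrite -!sM ?sub_notin//; last first.
    by rewrite in_setU1 negb_or xX eq_sym ux.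
  rewrite setUCA => h; apply: (Zs u v) => //; by rewrite in_setU1 negb_or ?ux ?vx.
have s0 : sindep s set0 by rewrite -sM ?sub0set// setU0.
have [y [yZ yx ys]] : exists y, [/\ y \in Z, y != x & y \in singles s].
  case: (boolP [exists y, [&& y \in Z, y != x & y \in singles s]]).
    by case/existsP => y /and3P[]; exists y.
  move/existsPn => ns; exfalso.
  have g u : u != x -> u \in ground s by move=> ux; rewrite gs !inE.
  have ns' u : u \in Z -> u != x -> u \notin tips s -> mate s u != u.
    move=> uZ ux ut; have := ns u; rewrite uZ ux /=; apply: contra => /eqP um.
    by apply/singlesP; rewrite g.
  have t2 : #|Z :&: tips s :\ x| <= 2.
    rewrite leqNgt; apply/negP => t3; set T := Z :&: tips s :\ x in t3.
    have [a aT _] : exists2 a, a \in T & a \notin (set0 : {set E}).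
      by apply: pick_outside; rewrite cards0; lia.
    have [b bT] : exists2 b, b \in T & b \notin [set a].
      by apply: pick_outside; rewrite cards1; lia.
    rewrite in_set1 => ba.
    have [c cT] : exists2 c, c \in T & c \notin [set a; b].
      by apply: pick_outside; rewrite cards2; case: (_ != _); lia.
    rewrite in_set2 negb_or => /andP[ca cb].
    move: aT bT cT; rewrite !inE => /and3P[aZ ax at_] /and3P[bZ bx bt] /and3P[cZ cx ct].
    have c1 : sindep s (c |: set0) by apply: (ser c a); rewrite ?inE.
    rewrite setU0 in c1.
    have : sindep s (a |: [set c]).
      by apply: (ser a b); rewrite // ?in_set1 // eq_sym.
    rewrite sindep_not_few//; apply: (two_units (x := a) (y := c)) => //.
    - by apply: tips_full; rewrite ?setU11.
    - by apply: tips_full; rewrite // in_setU1 set11 orbT.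
    - by rewrite (wf_tipm W).
  pose Zl := Z :\: (x |: Z :&: tips s :\ x).
  have card_Zl : 5 <= #|Zl|.
    have h1 : #|x |: Z :&: tips s :\ x| <= 3.
      by rewrite cardsU1; case: (_ \notin _); lia.
    have h2 : #|Z :&: (x |: Z :&: tips s :\ x)| <= #|x |: Z :&: tips s :\ x|.
      by apply: subset_leq_card; exact: subsetIr.
    by have := cardsID (x |: Z :&: tips s :\ x) Z; rewrite -/Zl; lia.
  have inZl u : u \in Zl -> [/\ u \in Z, u != x, u \notin tips s & mate s u != u].
    rewrite !inE; case: (eqVneq u x) => //= ux /andP[h uZ].
    have ut : u \notin tips s by move: h; rewrite uZ.
    by split=> //; exact: ns'.
  have [a aZl _] : exists2 a, a \in Zl & a \notin (set0 : {set E}).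
    by apply: pick_outside; rewrite cards0; lia.
  have [b bZl] : exists2 b, b \in Zl & b \notin [set a; mate s a].
    by apply: pick_outside; rewrite cards2; case: (_ != _); lia.
  rewrite in_set2 negb_or => /andP[ba bma].
  have [c cZl] : exists2 c, c \in Zl & c \notin [set a; mate s a] :|: [set b; mate s b].
    apply: pick_outside; apply: leq_ltn_trans (leq_card_setU _ _) _.
    by rewrite !cards2; apply: leq_trans card_Zl; do 2 case: (_ != _).
  rewrite !inE !negb_or => /andP[/andP[ca cma] /andP[cb cmb]].
  have [aZ ax at_ am] := inZl _ aZl; have [bZ bx bt bm] := inZl _ bZl.
  have [cZ cx ct cm] := inZl _ cZl.
  have mx u : u != x -> mate s u != x.
    by move=> ux; have := g _ ux; rewrite -(mate_ground _ W) gs !inE.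
  have mI u v : v != u -> mate s v != mate s u by rewrite (inj_eq (inv_inj inv)).
  have ab : a != b by rewrite eq_sym.
  case: (boolP (lifted s)) => ls.
    (* This set is independent and misses [a] and [b], but adding [a] completes a second leg. *)
    pose X := [set mate s a; c; mate s c].
    have nx u : u != mate s a -> u != c -> u != mate s c -> u \notin X.
      by move=> h1 h2 h3; rewrite !inE !negb_or h1 h2.
    have bc : b != c by rewrite eq_sym.
    have bmc : b != mate s c by apply: contra cmb => /eqP ->; rewrite inv.
    have bX : b \notin X by exact: nx.
    have mbX : mate s b \notin X by apply: nx; [exact: mI|rewrite eq_sym|exact: mI].
    have spX : spans s X = false by apply: (spansN (x := b)); rewrite ?g.
    have sX : sindep s X.
      rewrite small_sindep// /few_units ls.
      have ff u : u \in full s X -> u = c \/ u = mate s c.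
        move=> /fullP[uX mX _]; move: uX; rewrite !inE -!orbA => /or3P[]/eqP e; auto.
        move: mX; rewrite e inv (negPf (nx a _ _ _))//.
        - by rewrite eq_sym.
        - by rewrite eq_sym.
        - by apply: contra cma => /eqP ->; rewrite inv.
      by apply/one_unitP => u v /ff[->|->] /ff[->|->]; rewrite ?inv; auto.
    have aX : a \notin X.
      apply: nx; [by rewrite eq_sym|by rewrite eq_sym|].
      by apply: contra cma => /eqP ->; rewrite inv.
    have xX : x \notin X by apply: nx; rewrite eq_sym ?mx.
    have := ser a b X aZ bZ ax bx ab xX aX bX sX.
    rewrite sindep_not_few//; apply: (two_units (x := a) (y := c)) => //.
    - by apply: leg_full; rewrite // !inE eqxx ?orbT.
    - by apply: leg_full; rewrite // !inE eqxx ?orbT.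
  have sX : sindep s [set mate s a].
    rewrite small_sindep.
      rewrite /few_units (negPf ls); apply/eqP/setP => u; rewrite [RHS]inE; apply/negP.
      move=> /fullP[]; rewrite !in_set1 => /eqP-> /eqP; rewrite inv => h.
      by rewrite -h eqxx in am.
    by apply: (spansN (x := b)); rewrite ?g// in_set1// mI.
  have := ser a b _ aZ bZ ax bx ab _ _ _ sX; rewrite !in_set1.
  rewrite [x == _]eq_sym mx// [a == _]eq_sym am bma => /(_ isT isT isT).
  rewrite sindep_not_few// /few_units (negPf ls); apply/negP => /eqP f0.
  have : a \in full s (a |: [set mate s a]) by apply: leg_full; rewrite // !inE eqxx ?orbT.
  by rewrite f0 inE.
apply: (@exm_not_small _ _ _ exM (addsingle s x)); last exact: leq_trans (addsingle_card _ _) wk.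
split=> //; first exact: addsingle_wf.
have xy : x != y by rewrite eq_sym.
move=> X; case: (boolP (x \in X)) => xX.
  by rewrite addsingle_in// -sM ?setD1K// sub_notin// !inE eqxx.
rewrite addsingle_out//.
case: (boolP (y \in X)) => yX.
  have -> : (X \in indep M) = (x |: X :\ y \in indep M).
    have yn : y \notin X :\ y by rewrite !inE eqxx.
    have xn : x \notin X :\ y by rewrite !inE (negPf xX) andbF.
    apply/idP/idP => h.
      by apply: (Zs x y) => //; apply: indep_sub h _; exact: subD1set.
    rewrite -(setD1K yX); apply: (Zs y x) => //.
    by apply: indep_sub h _; exact: subsetUr.
  rewrite sM ?sub_notin ?inE ?(negPf xX) ?andbF//.
  by rewrite (sindep_missing_single ys) ?few_units_single// !inE eqxx.
have -> : (X \in indep M) = (x |: X \in indep M).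
  apply/idP/idP => h; first exact: (Zs x y).
  by apply: indep_sub h _; exact: subsetUr.
by rewrite sM ?sub_notin// (sindep_missing_single ys).
Qed.

(** Singles satisfy the series condition in the contraction of [e]; it lifts to [M] directly as long
    as [e |: X] is independent, and otherwise by an exchange. *)
Lemma few_singles e s : [set e] \in indep M ->
  structured k (fun X => e |: X \in indep M) (~: [set e]) s -> #|singles s| <= 7.
Proof.
move=> eI [W gs wk sM]; apply: few_series => y z ys zs yz X yX zX XI.
have /singlesP[yg _ _] := ys; have ye : y != e by move: yg; rewrite gs !inE.
have key Y : e \notin Y -> y \notin Y -> z \notin Y -> e |: Y \in indep M ->
    e |: (y |: Y) \in indep M.
  move=> eY yY zY; rewrite sM ?sub_notin// sM; last first.
    by rewrite sub_notin// in_setU1 negb_or eq_sym ye.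
  rewrite (sindep_missing_single zs zY) (@sindep_missing_single _ _ (y |: Y) z)//.
    by rewrite -(few_units_single (y |: Y) W ys) setU1K.
  by rewrite in_setU1 negb_or eq_sym yz.
case: (boolP (e |: X \in indep M)) => eX.
  case: (boolP (e \in X)) => h.
    have hD : e \notin X :\ e by rewrite !inE eqxx.
    have [yD zD] : y \notin X :\ e /\ z \notin X :\ e.
      by rewrite !inE (negPf yX) (negPf zX) !andbF.
    by rewrite -(setD1K h) setUCA; apply: key; rewrite ?setD1K.
  by apply: indep_sub (key X h yX zX eX) _; exact: subsetUr.
have eX' : e \notin X by apply: contra eX => h; rewrite (setUidPr _)// sub1set.
have X0 : 0 < #|X|.
  rewrite card_gt0; apply/eqP => X0; move: eX; rewrite X0 setU0 eI.
  by [].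
(* Here [e] is in the closure of [X]: exchange an element of [X] for [e], add [y], and augment [X]
   from the result. What is gained is neither [e] nor in [X], so it is [y]. *)
have [|Z [h1 h2 h3 h4]] := indep_extend eI XI; first by rewrite cards1.
rewrite sub1set in h1.
have ZX : Z :\ e \subset X.
  by apply/subsetP => u; rewrite !inE => /andP[ue uZ]; have := subsetP h2 _ uZ;
    rewrite !inE (negPf ue).
have cZ := cardsD1 e Z; rewrite h1 in cZ.
have := key (Z :\ e); rewrite setD1K// !in_setD1 eqxx /= => /(_ isT).
have -> : (y \in Z) = false.
  by apply/negP => /(subsetP h2); rewrite !inE (negPf ye) (negPf yX).
have -> : (z \in Z) = false.
  have ze : z != e by have /singlesP[] := zs; rewrite gs !inE.
  by apply/negP => /(subsetP h2); rewrite !inE (negPf ze) (negPf zX).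
rewrite !andbF => /(_ isT isT h3) YI.
have cY : #|X| < #|e |: (y |: Z :\ e)|.
  have yZ : y \notin Z :\ e by apply: contra yX; exact: (subsetP ZX).
  have eZ : e \notin y |: Z :\ e by rewrite !inE negb_or eq_sym ye eqxx.
  by rewrite !cardsU1 yZ eZ -h4 cZ; exact: leqnn.
have [_ _ /(_ _ _ XI YI cY)[u]] := indepP M.
rewrite inE => /andP[uX]; rewrite in_setU1 => /orP[/eqP->|]; first by rewrite (negPf eX).
rewrite in_setU1 => /orP[/eqP->//|/(subsetP ZX)]; by rewrite (negPf uX).
Qed.

(** With few tips and few leg elements, the deletion of [e] consists mostly of singles, so [M] has
    an independent set that misses only about thirty elements. In the contraction of [e], which has
    at most seven singles, an independent set has little more than half of the elements. *)
Lemma few_legs_small (S : E -> spikelike E) :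
  (forall e, structured k (fun X => X \in indep M) (~: [set e]) (S e)) ->
  (forall e, #|legs (S e)| < 24) -> #|E| < 100.
Proof.
move=> HS few; rewrite ltnNge; apply/negP => big.
have [e eI] : exists e, [set e] \in indep M.
  case: (pickP (fun e => [set e] \in indep M)) => [e|no]; first by exists e.
  have := few_loops exM (Z := setT); rewrite cardsT => h.
  have : #|E| <= 2 by apply: h => z _; rewrite no.
  by lia.
have stS := HS e; have [Ws gs wks sM] := stS.
have [t stt] := exm_con exM eI; have [Wt gt wkt tM] := stt.
have ft := few_tips exM stS; have fl := few e; have fs := few_singles eI stt.
(* The 30 elements are [e], at most 6 tips and at most 23 leg elements. *)
have cs : #|E| <= #|singles (S e)| + 30.
  have sub : [set: E] \subset e |: (tips (S e) :|: (legs (S e) :|: singles (S e))).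
    apply/subsetP => x _; rewrite in_setU1 !in_setU !in_set.
    case: (eqVneq x e) => //= xe; rewrite gs !inE xe andbT.
    by case: (_ \in _) => //=; case: (_ == _).
  have := subset_leq_card sub; rewrite cardsT => h.
  apply: leq_trans h _; rewrite cardsU1.
  have h1 : #|tips (S e) :|: (legs (S e) :|: singles (S e))| <=
    #|tips (S e)| + #|legs (S e) :|: singles (S e)| by exact: leq_card_setU.
  have h2 : #|legs (S e) :|: singles (S e)| <= #|legs (S e)| + #|singles (S e)|.
    by exact: leq_card_setU.
  by case: (_ \notin _); lia.
have [z zs _] : exists2 z, z \in singles (S e) & z \notin (set0 : {set E}).
  by apply: pick_outside; rewrite cards0; lia.
pose X := singles (S e) :\ z.
have cX : #|E| <= #|X| + 31 by have := cardsD1 z (singles (S e)); rewrite zs -/X; lia.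
have eX : e \notin X.
  by apply/negP; rewrite inE => /andP[_ /singlesP[]]; rewrite gs !inE eqxx.
have XI : X \in indep M.
  rewrite sM ?sub_notin// (sindep_missing_single zs); last by rewrite !inE eqxx.
  have f0 : full (S e) X = set0.
    apply/setP => x; rewrite [RHS]inE; apply/negP => /fullP[].
    rewrite inE => /andP[_ /singlesP[_ xt xm]] _ []; first by rewrite (negPf xt).
    by rewrite xm.
  by rewrite /few_units full0_one// f0 eqxx if_same.
have [|Z [h1 h2 h3 h4]] := indep_extend eI XI; first by rewrite cards1; lia.
rewrite sub1set in h1; pose J := Z :\ e.
have eJ : e \notin J by rewrite !inE eqxx.
have cJ : #|E| <= #|J| + 32 by have := cardsD1 e Z; rewrite h1 h4 -/J; lia.
have JI : few_units t J.
  by apply: sindep_few; rewrite -tM ?sub_notin// setD1K.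
have fJ : #|full t J| <= 2.
  move: JI; rewrite /few_units; case: ifP => _; last by move/eqP ->; rewrite cards0.
  move=> /one_unitP H; case: (eqVneq (full t J) set0) => [->|/set0Pn[x xf]].
    by rewrite cards0.
  have sub : full t J \subset [set x; mate t x].
    by apply/subsetP => y /(H x y xf)[]->; rewrite in_set2 eqxx ?orbT.
  by apply: leq_trans (subset_leq_card sub) _; rewrite cards2; case: (_ != _).
pose B := [set x in J | mate t x \notin J].
have sub : J \subset singles t :|: (full t J :|: B).
  apply/subsetP => x xJ; rewrite !in_setU.
  case: (boolP (mate t x \in J)) => mJ; last by rewrite [x \in B]inE xJ mJ !orbT.
  case: (boolP (x \in full t J)) => xf; first by rewrite ?orbT.
  have xg : x \in ground t.
    by rewrite gt !inE; apply: contraNneq eJ => <-.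
  apply/orP; left; apply/singlesP; split=> //.
    by apply: contra xf => xt; exact: tips_full.
  by apply/eqP; apply: contraNT xf => xm; exact: leg_full.
(* At most 7 singles and 2 elements of a full unit; all other elements of [J] have their mates
   outside [J]. *)
have cB : #|J| <= 9 + #|B|.
  apply: leq_trans (subset_leq_card sub) _.
  have a1 : #|singles t :|: (full t J :|: B)| <= #|singles t| + #|full t J :|: B|.
    by exact: leq_card_setU.
  have a2 : #|full t J :|: B| <= #|full t J| + #|B| by exact: leq_card_setU.
  by clear -a1 a2 fs fJ; lia.
have cBJ : #|B| + #|J| <= #|E|.
  have <- : #|mate t @: B| = #|B| by apply: card_imset; exact: inv_inj (wf_inv Wt).
  have d0 : (mate t @: B) :&: J = set0.
    apply/setP => x; rewrite [RHS]inE; apply/negP; rewrite inE => /andP[/imsetP[y]].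
    by rewrite inE => /andP[_ /negPf yJ] ->; rewrite yJ.
  by have := cardsUI (mate t @: B) J; rewrite d0 cards0 addn0 => <-; exact: max_card.
by clear -big cJ cB cBJ; lia.
Qed.

(** Oddness gives a fixed point of the mate involution, which is a tip or a single. Words avoid tips
    and contain singles, so they all survive the deletion of the tip or the contraction of the
    single, and [unique_words] carries more than [k] of them into a structure with at most [k]. *)
Lemma odd_excluded_minor_small : odd #|E| -> #|E| < 100.
Proof.
move=> oE; have [S HS] := choice (exm_del exM).
rewrite ltnNge; apply/negP => big.
case: (boolP [exists e, 24 <= #|legs (S e)|]) => [/existsP[e many]|/existsPn few]; last first.
  have few' e : #|legs (S e)| < 24 by rewrite ltnNge.
  by have := few_legs_small HS few'; rewrite ltnNge big.
have [f0 f0m] : exists f0, mate (S e) f0 != f0.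
  have /card_gt0P[f0] : 0 < #|legs (S e)| by exact: leq_trans many.
  by rewrite inE; exists f0.
have rep := rho_represents HS many f0m.
have rlegs := rho_legs HS many f0m.
set r := rho M S e f0 in rep rlegs; clearbody r.
have [lr cr wr] := not_in_class exM.1 rep.
have [W gr rM] := rep.
have [x xm] := odd_involution_fix (wf_inv W) oE.
have s0 : sindep r set0 by rewrite -rM indep0.
case: (boolP (x \in tips r)) => xt.
  have [Wx gx wkx xM] := HS x.
  have Wd := dl_wf W x.
  have gE : ground (dl r x) = ground (S x).
    by rewrite dl_ground gr gx; apply/setP => y; rewrite !inE andbT.
  have SSx (X : {set E}) : X \subset ground (dl r x) -> sindep (dl r x) X = sindep (S x) X.
    rewrite gE gx => sX; have xX : x \notin X by apply/negP => /(subsetP sX); rewrite !inE eqxx.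
    by rewrite dl_sindep ?gr ?subsetT// -rM xM.
  have ml : 20 <= #|legs (dl r x)|.
    have -> // : legs (dl r x) = legs r.
    apply/setP => y; rewrite !in_set dl_mate.
    case: (eqVneq y x) => [->|yx] /=; first by rewrite xm eqxx.
    by case: (eqVneq (mate r y) x) => [e'|//]; rewrite -[y](wf_inv W) e' xm eqxx in yx.
  have := unique_words Wd Wx gE SSx ml; rewrite dl_lifted dl_cyclical ?xt ?orbT//.
  move=> /(_ lr cr) /subset_leq_card; apply/negP; rewrite -ltnNge.
  apply: leq_ltn_trans wkx _; apply: leq_trans wr _.
  apply: subset_leq_card; apply/subsetP => w wW.
  rewrite /dl /mnr /=; have -> /= : lifted r && (full r set0 == set0).
    by rewrite lr; apply/eqP/setP => y; rewrite !inE.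
  have -> : cyclical r && [forall y in ground r :\: tips r, ~~ ((y \in [set x]) && (mate r y \in [set x]))].
    rewrite cr; apply/forall_inP => y; rewrite !inE => /andP[yt _].
    by apply/negP => /andP[/eqP e' _]; rewrite e' xt in yt.
  apply/imsetP; exists w; last by rewrite setD0.
  rewrite inE wW sub0set /= -setI_eq0; apply/eqP/setP => y; rewrite !inE.
  apply/negP => /andP[yw /eqP e']; subst y.
  by have /and3P[wg _ _] := wf_words W wW; have := subsetP wg _ yw; rewrite !inE xt.
have xs : x \in singles r by apply/singlesP; rewrite gr inE.
have CD : [disjoint [set x] & set0] by rewrite -setI_eq0 setI0.
have fx : full r [set x] = set0.
  apply/setP => y; rewrite [RHS]inE; apply/negP => /fullP[]; rewrite !in_set1.
  by move=> /eqP -> _ []; [rewrite (negPf xt)|rewrite xm].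
have xI : sindep r [set x].
  have [|y [ym yx myx]] := pick_leg W (Z := [set x]); first by rewrite cards1; lia.
  rewrite small_sindep; first by rewrite /few_units full0_one// fx eqxx if_same.
  by apply: (spansN (x := y)); rewrite ?gr ?inE// ?leg_tips//; rewrite !inE in yx myx.
have [t [Wt gt wkt tM]] := exm_con exM (etrans (rM [set x]) xI).
have Wc := mnr_wf W CD.
have gE : ground (mnr r [set x] set0) = ground t.
  by rewrite /= gr gt setU0; apply/setP => y; rewrite !inE andbT.
have SSx (X : {set E}) : X \subset ground (mnr r [set x] set0) ->
    sindep (mnr r [set x] set0) X = sindep t X.
  by move=> sX; rewrite mnr_sindep// -rM setUC tM// -gt -gE.
have ml : 20 <= #|legs (mnr r [set x] set0)|.
  have -> // : legs (mnr r [set x] set0) = legs r.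
  apply/setP => y; rewrite !in_set /= setU0 !in_set1.
  case: (eqVneq y x) => [->|yx] /=; first by rewrite xm eqxx.
  by case: (eqVneq (mate r y) x) => [e'|//]; rewrite -[y](wf_inv W) e' xm eqxx in yx.
have l' : lifted r && (full r [set x] == set0) by rewrite lr fx eqxx.
have c' : cyclical r && [forall y in ground r :\: tips r, ~~ ((y \in set0) && (mate r y \in set0))].
  by rewrite cr; apply/forall_inP => y _; rewrite !inE.
have := unique_words Wc Wt gE SSx ml l' c'.
move=> /subset_leq_card; apply/negP; rewrite -ltnNge.
apply: leq_ltn_trans wkt _; apply: leq_trans wr _.
rewrite /mnr /= l' c' /=.
have xw w : w \in words r -> x \in w.
  move=> /(wf_words W)/and3P[_ /spansP sp _]; have := sp x; rewrite gr inE xm.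
  by move=> /(_ isT xt)[].
have <- : #|[set w :\: [set x] | w in words r]| = #|words r|.
  apply: card_in_imset => w w' /xw xw1 /xw xw2 e'.
  by rewrite -(setD1K xw1) -(setD1K xw2) e'.
apply: subset_leq_card; apply/subsetP => v /imsetP[w wW ->].
apply/imsetP; exists w => //; rewrite inE wW sub1set xw//= -setI_eq0 setI0.
by [].
Qed.

End ExcludedMinor.

(** * Counting spike minors *)

Lemma matroid_iso_refl (E : finType) (M : matroid E) : matroid_iso M M.
Proof. by exists id; [exists id|move=> A; rewrite imset_id]. Qed.

Lemma matroid_iso_sym (E F : finType) (M : matroid E) (N : matroid F) :
  matroid_iso M N -> matroid_iso N M.
Proof.
case=> f [g fK gK] fM; exists g; first by exists f.
move=> A; rewrite -fM -imset_comp.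
by rewrite (eq_imset _ (gK : f \o g =1 id)) imset_id.
Qed.

Lemma matroid_iso_trans (E F G : finType) (M : matroid E) (N : matroid F) (P : matroid G) :
  matroid_iso M N -> matroid_iso N P -> matroid_iso M P.
Proof.
case=> f bf fM [g bg gM]; exists (g \o f); first exact: bij_comp.
by move=> A; rewrite imset_comp gM fM.
Qed.

Section IsoClasses.
Variables (P : matroid_class) (n : nat).

Let D := [set M : matroid 'I_n | `[< P M >]].
Let R (M N : matroid 'I_n) : bool := `[< matroid_iso M N >].
Let F M := [set N in D | R M N].

Let F_eq M N : matroid_iso M N -> F M = F N.
Proof.
move=> MN; apply/setP => L; rewrite ![_ \in F _]inE; congr (_ && _).
apply/asboolP/asboolP => h.
  by apply: matroid_iso_trans h; exact: matroid_iso_sym.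
exact: matroid_iso_trans h.
Qed.

Lemma num_iso_classes_le (T : finType) (c : matroid 'I_n -> T) :
  (forall M N, P M -> P N -> c M = c N -> matroid_iso M N) ->
  num_iso_classes P n <= #|T|.
Proof.
move=> H; pose h t := if [pick M in D | c M == t] is Some M then F M else set0.
rewrite /num_iso_classes -cardsT; apply: leq_trans (leq_imset_card h _).
apply: subset_leq_card; apply/subsetP => b /imsetP[M MD ->].
apply/imsetP; exists (c M); rewrite ?inE// /h; case: pickP => [N|/(_ M)].
  rewrite inE in MD; move/asboolP: MD => PM.
  move=> /andP[]; rewrite inE => /asboolP PN /eqP e.
  by apply: F_eq; apply: H.
by rewrite MD eqxx.
Qed.

Lemma num_iso_classes_ge (H : finType) (m : H -> matroid 'I_n) (K : nat) :
  (forall h, P (m h)) ->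
  (forall h, #|[set h' | `[< matroid_iso (m h) (m h') >]]| <= K) ->
  #|H| <= num_iso_classes P n * K.
Proof.
move=> Pm fib; have mD h : m h \in D by rewrite inE; apply/asboolP.
rewrite -sum1_card (partition_big (fun h => F (m h)) (mem (F @: D))) /=; last first.
  by move=> h _; exact: imset_f.
rewrite /num_iso_classes -sum_nat_const; apply: leq_sum => b _.
case: (pickP (fun h => F (m h) == b)) => [h0 /eqP e0|no]; last by rewrite big_pred0.
apply: leq_trans (fib h0); rewrite sum1dep_card; apply: subset_leq_card.
apply/subsetP => h; rewrite !inE -e0 => /eqP/setP/(_ (m h)).
rewrite ![_ \in F _]inE mD /= => e.
suff : R (m h0) (m h) by [].
by rewrite -e; apply/asboolP; exact: matroid_iso_refl.
Qed.

End IsoClasses.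

Section TransversalMem.
Variables (E : finType) (s : spikelike E) (w : {set E}).
Hypotheses (W : wf s) (gs : ground s = setT) (tw : transversal_set s w).

Lemma transversal_leg x : mate s x != x -> (mate s x \in w) = (x \notin w).
Proof.
move=> xm; have /and3P[_ /spansP sp /eqP f0] := tw; have xt := leg_tips W xm.
have := sp x; rewrite gs inE => /(_ isT xt).
case: (boolP (x \in w)) => xw; last by case.
by move=> _; apply/negP => mw; have := leg_full xw mw xm; rewrite f0 inE.
Qed.

Lemma transversal_fix x : mate s x = x -> (x \in w) = (x \notin tips s).
Proof.
move=> xm; have /and3P[wt /spansP sp _] := tw; apply/idP/idP.
  by move/(subsetP wt); rewrite inE => /andP[].
by move/(sp x); rewrite gs inE xm => /(_ isT)[].
Qed.

End TransversalMem.

(** * Profiles of the members of the class *)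

Section Profile.
Variables (n k : nat).
Local Notation E := 'I_n.

(* A member of the class is recorded by a structure together with k+1 (possibly
   repeated) transversals; they enumerate the words unless there is none. *)
Record presents (s : spikelike E) (u : 'I_k.+1 -> {set E}) (b : bool)
    (M : matroid E) : Prop := Presents {
  pr_rep : represents s M;
  pr_tr : forall j, transversal_set s (u j);
  pr_words : words s = if b then [set u j | j : 'I_k.+1] else set0 }.

Lemma presents_exists M : spike_minor_class k.+1 M -> exists s u b, presents s u b M.
Proof.
case/spike_minor_class_represents => s rep wk; have [W gs _] := rep.
have [w0|/set0Pn[w0 w0W]] := eqVneq (words s) set0.
  have [T tT] := transversal_exists W.
  by exists s, (fun=> T), false; split.
(* Past the end of the list, the default [w0] repeats a word. *)
exists s, (fun j : 'I_k.+1 => nth w0 (enum (words s)) j), true.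
have mem j : nth w0 (enum (words s)) j \in words s.
  case: (ltnP j (size (enum (words s)))) => h; last by rewrite nth_default.
  by rewrite -mem_enum mem_nth.
split=> //; first by move=> j; apply: (wf_words W).
apply/setP => w; apply/idP/imsetP => [wW|[j _ ->]]; last exact: mem.
have iw : index w (enum (words s)) < size (enum (words s)) by rewrite index_mem mem_enum.
have ik : index w (enum (words s)) < k.+1.
  by apply: leq_trans iw _; rewrite -cardE.
by exists (Ordinal ik); rewrite //= nth_index// mem_enum.
Qed.

Local Notation K := ({ffun 'I_k -> bool} + 'I_3)%type.
Let Ktip : K := inr (inord 0).
Let Ksingle : K := inr (inord 1).
Let Kother : K := inr (inord 2).

(** A leg is recorded through its element in the first transversal, by the membership pattern in the
    other [k]. The mate of this element gets [Kother], since its pattern is the complement. *)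
Definition kind (s : spikelike E) (u : 'I_k.+1 -> {set E}) (x : E) : K :=
  if x \in tips s then Ktip
  else if mate s x == x then Ksingle
  else if x \in u ord0 then inl [ffun j => x \in u (lift ord0 j)] else Kother.

Let Kneq : [/\ Ktip != Ksingle, Ktip != Kother & Ksingle != Kother].
Proof.
by split; apply/eqP => -[] /(congr1 val); rewrite /= !inordK.
Qed.

Definition profile (s : spikelike E) (u : 'I_k.+1 -> {set E}) : {ffun K -> 'I_n.+1} :=
  [ffun t => inord #|[set x | kind s u x == t]|].

Lemma kind_bij (T : eqType) (c c' : E -> T) :
  (forall t, #|[set x | c x == t]| = #|[set x | c' x == t]|) ->
  exists p : {perm E}, forall x, c x = c' (p x).
Proof.
move=> H; have cnt (d : E -> T) t :
    count_mem t [tuple d i | i < n] = #|[set x | d x == t]|.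
  rewrite -sum1_count /= big_map big_enum_cond /= sum1dep_card.
  by apply: eq_card => x; rewrite !inE.
have : perm_eq [tuple c i | i < n] [tuple c' i | i < n].
  by apply/allP => t _ /=; apply/eqP; rewrite !cnt.
case/tuple_permP => p e; exists p => x.
have := congr1 (fun l => nth (c x) l x) e.
by rewrite -!tnth_nth !tnth_mktuple.
Qed.

(** A permutation preserving kinds need not respect legs. It is kept on the fixed elements and on
    the first transversal, and carried over from there to the mates. *)
Lemma presents_iso s u b M s' u' M' :
  presents s u b M -> presents s' u' b M' -> profile s u = profile s' u' ->
  lifted s = lifted s' -> cyclical s = cyclical s' -> matroid_iso M M'.
Proof.
case=> -[W gs sM] tr wd [[W' gs' sM'] tr' wd'] pe le ce.
have inv := wf_inv W; have inv' := wf_inv W'.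
have [kts kto kso] := Kneq.
have [p pE] : exists p : {perm E}, forall x, kind s u x = kind s' u' (p x).
  apply: kind_bij => t; have := congr1 (fun g : {ffun K -> 'I_n.+1} => val (g t)) pe.
  rewrite !ffunE /= !inordK ?ltnS//.
    by apply: leq_trans (max_card _) _; rewrite card_ord.
  by apply: leq_trans (max_card _) _; rewrite card_ord.
have kT (t : spikelike E) v x : (kind t v x == Ktip) = (x \in tips t).
  rewrite /kind; case: ifP => _; first by rewrite eqxx.
  case: ifP => _; first by rewrite eq_sym (negPf kts).
  by case: ifP => _ //; rewrite eq_sym (negPf kto).
have kS (t : spikelike E) v x : wf t ->
    (mate t x == x) = (kind t v x == Ktip) || (kind t v x == Ksingle).
  move=> Wt; rewrite kT /kind; case: ifP => xt; first by rewrite (wf_tipm Wt) ?eqxx.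
  case: ifP => _; first by rewrite eqxx.
  by case: ifP => _ //; rewrite eq_sym (negPf kso).
have kO (t : spikelike E) v x : wf t -> mate t x != x ->
    (kind t v x == Kother) = (x \notin v ord0).
  move=> Wt xm; rewrite /kind (negPf (leg_tips Wt xm)) (negPf xm).
  by case: ifP => //; rewrite eqxx.
have kV (t : spikelike E) (v : 'I_k.+1 -> {set E}) x : wf t -> mate t x != x -> x \in v ord0 ->
    kind t v x = inl [ffun j => x \in v (lift ord0 j)].
  by move=> Wt xm xv; rewrite /kind (negPf (leg_tips Wt xm)) (negPf xm) xv.
have pT x : (p x \in tips s') = (x \in tips s) by rewrite -(kT _ u') -pE kT.
have pM x : (mate s' (p x) == p x) = (mate s x == x).
  by rewrite (kS s' u')// (kS s u)// pE.
have p0 x : mate s x != x -> (p x \in u' ord0) = (x \in u ord0).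
  move=> xm; apply: negb_inj; rewrite -(kO s')// ?pM// -pE kO//.
have pj x j : mate s x != x -> x \in u ord0 -> (p x \in u' j) = (x \in u j).
  move=> xm xu; case: (unliftP ord0 j) => [j' ->|->]; last exact: p0.
  have := pE x; rewrite (kV s)// (kV s')// ?pM// ?p0// => -[] /ffunP/(_ j').
  by rewrite !ffunE.
pose f x := if (mate s x == x) || (x \in u ord0) then p x else mate s' (p (mate s x)).
have trl j x : mate s x != x -> (mate s x \in u j) = (x \notin u j).
  exact: transversal_leg.
have trl' j x : mate s' x != x -> (mate s' x \in u' j) = (x \notin u' j).
  exact: transversal_leg.
have mleg x : mate s x != x -> mate s (mate s x) != mate s x by rewrite mate_leg.
have fleg x : (mate s' (f x) != f x) = (mate s x != x).
  rewrite /f; case: ifP => h; first by rewrite pM.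
  by rewrite mate_leg// pM mate_leg.
have fmate x : mate s' (f x) = f (mate s x).
  have [xm|xm] := eqVneq (mate s x) x.
    have -> : f (mate s x) = f x by rewrite xm.
    by apply/eqP; rewrite -[_ == _]negbK fleg xm eqxx.
  rewrite /f (negPf xm) (negPf (mleg _ xm)) /= trl//.
  by case: (x \in u ord0); rewrite /= ?inv ?inv'.
have ftip x : (f x \in tips s') = (x \in tips s).
  rewrite /f; case: ifP => h; first exact: pT.
  by rewrite mate_tips// pT mate_tips.
have fu x j : (f x \in u' j) = (x \in u j).
  have [xm|xm] := eqVneq (mate s x) x.
    have fm : mate s' (f x) = f x by rewrite fmate xm.
    by rewrite (transversal_fix gs' (tr' j) fm) (transversal_fix gs (tr j) xm) ftip.
  rewrite /f (negPf xm) /=; case: (boolP (x \in u ord0)) => xu; first exact: pj.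
  have mm := mleg _ xm; rewrite trl' ?pM// pj// ?trl// negbK.
  by [].
have finj : injective f.
  move=> x y e; have em : (mate s x == x) = (mate s y == y).
    by apply: negb_inj; rewrite -!fleg e.
  have e0 : (x \in u ord0) = (y \in u ord0) by rewrite -!fu e.
  move: e; rewrite /f -em -e0; case: ifP => _; first exact: perm_inj.
  by move/(inv_inj inv')/perm_inj/(inv_inj inv).
have fb : bijective f by exact: injF_bij.
have sm : smorph s s' f.
  split=> //.
  - by move=> x y _ _; exact: finj.
  - by move=> y _; case: fb => g fK gK; exists (g y); rewrite ?gs ?inE.
  - by move=> x _; rewrite gs' inE.
  - by move=> x _; rewrite gs inE.
exists f => // A; rewrite sM sM'; apply: (sm_sindep sm) => //; first by rewrite gs subsetT.
move=> _ _ _; rewrite wd wd'; case: b {wd wd'} => //; last by rewrite !inE.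
have fim j : f @: u j = u' j.
  case: fb => g fK gK; apply/setP => y; rewrite -[y]gK fu.
  by rewrite (mem_imset _ _ finj).
apply/imsetP/imsetP => -[j _ e]; exists j => //.
  by apply: (imset_inj finj); rewrite e fim.
by rewrite e fim.
Qed.

End Profile.

(** The exponent counts kinds: [2 ^ k] patterns relative to the first transversal and three special
    kinds. The factor 8 accounts for the booleans [lifted], [cyclical] and [b]. *)
Lemma num_spike_minors_le n k :
  num_iso_classes (spike_minor_class k.+1) n <= n.+1 ^ (2 ^ k + 3) * 8.
Proof.
pose T := ({ffun ({ffun 'I_k -> bool} + 'I_3) -> 'I_n.+1} * (bool * bool * bool))%type.
have cT : #|{: T}| = n.+1 ^ (2 ^ k + 3) * 8.
  by rewrite !card_prod card_ffun card_sum card_ffun !card_ord !card_bool.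
rewrite -cT.
have [c Hc] := choice (fun M : matroid 'I_n => (ltac:(
    case: (pselect (spike_minor_class k.+1 M)) => [/presents_exists[s [u [b h]]]|h];
    [exists (profile s u, (lifted s, cyclical s, b)) => _; by exists s, u, b
    |exists ([ffun=> ord0], (true, true, true)) => /h []]) :
  exists t : T, spike_minor_class k.+1 M -> exists s u b,
    presents s u b M /\ t = (profile s u, (lifted s, cyclical s, b)))).
apply: (num_iso_classes_le (c := c)) => M N /Hc[s [u [b [h ->]]]] /Hc[s' [u' [b' [h' ->]]]].
by case=> e1 e2 e3 e4; subst b'; apply: presents_iso h h' _ _ _.
Qed.

(** * Counting excluded minors *)

Lemma all_legs_legs (E : finType) (s : spikelike E) : all_legs s -> legs s = setT.
Proof. by move=> L; apply/setP => x; rewrite !inE (al_mate L). Qed.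

(** Applied to an element and to its mate, the covering hypothesis says that no element lies in none
    or in all of the words, so each deletion or contraction loses a word. Uniqueness of the words
    keeps the matroid itself out of the class. *)
Lemma excluded_spike k (E : finType) (s : spikelike E) (L : all_legs s) :
  20 <= #|E| -> #|words s| = k.+1 ->
  (forall x, exists2 w, w \in words s & x \in w) ->
  excluded_minor (spike_minor_class k) (spike_matroid L).
Proof.
move=> E20 wk cov; have rep := spike_matroid_represents L.
have [W gs sM] := rep; split.
  case/spike_minor_class_represents => t [Wt gt tM] tk.
  have := unique_words W Wt (etrans gs (esym gt)) _ _ (al_lifted L) (al_cyclical L).
  move=> /(_ _ _)/subset_leq_card; rewrite wk => h.
  suff : k.+1 <= #|words t| by rewrite ltnNge tk.
  apply: h; last by rewrite all_legs_legs// cardsT.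
  by move=> X _; rewrite -sM tM.
move=> C D CD CD0.
have [C' [D' [CDE CD' [t [rt ct]]]]] := represents_minor rep CD (matroid_iso_refl _).
apply: (represents_spike_minor_class rt); apply: leq_trans ct _.
rewrite -ltnS -wk; apply: proper_card; apply/properP; split.
  by apply/subsetP => w; rewrite inE => /andP[].
have /set0Pn[x] : C' :|: D' != set0 by rewrite CDE.
rewrite inE => /orP[xC|xD].
  have [w wW mw] := cov (mate s x); exists w => //; rewrite inE wW /=.
  apply/negP => /andP[/subsetP/(_ x xC) xw _].
  have := transversal_leg W gs (wf_words W wW) (al_mate L x).
  by rewrite mw xw.
have [w wW xw] := cov x; exists w => //; rewrite inE wW /=.
by apply/negP => /andP[_ /disjointFr/(_ xw)]; rewrite xD.
Qed.

Section Family.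
Variables (k u : nat).
Hypothesis k1 : 0 < k.

Local Notation V := {ffun 'I_k -> bool}.
Let v0 : V := [ffun=> false].
Let v1 : V := [ffun=> true].
Local Notation V' := {v : V | (v != v0) && (v != v1)}.
Local Notation H := {ffun V' -> 'I_u.+1}.
Local Notation J := (V * 'I_u.+2)%type.
Local Notation B := (J * bool)%type.
Local Notation I := (option 'I_k).

Implicit Types (h : H) (v : V) (i : J) (x : B) (j : I).

(* The column v occurs [(h v).+2] times among the legs (v, _), and the other legs
   get the all-ones column, so that the number of legs does not depend on h. *)
Let mult h v : nat := if insub v is Some v' then h v' else 0.

Let col h (i : J) : V := if (i.1 != v0) && (i.2 < (mult h i.1).+2) then i.1 else v1.

Let bit v j : bool := if j is Some a then v a else false.

(** Columns are relative to the word [None], which takes the [false] element of each leg. As no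
    column is [v0], every [true] element lies in some other word. *)
Let word h j : {set B} := [set x | x.2 == bit (col h x.1) j].

Let v10 : v1 != v0.
Proof. by apply/eqP => /ffunP/(_ (Ordinal k1)); rewrite !ffunE. Qed.

Let col_neq0 h i : col h i != v0.
Proof. by rewrite /col; case: ifP => // /andP[]. Qed.

Let col_low h v (a : 'I_u.+2) : v != v0 -> a < 2 -> col h (v, a) = v.
Proof.
by move=> vn a2; rewrite /col /= vn /= (leq_trans a2).
Qed.

Let separate j j' : j != j' -> exists2 v, v != v0 & bit v j != bit v j'.
Proof.
case: j j' => [a|] [b|] // ne.
- exists [ffun c => c == a].
    by apply/eqP => /ffunP/(_ a); rewrite !ffunE eqxx.
  rewrite /= !ffunE eqxx; apply: contra ne => /eqP/esym/eqP ->.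
  by [].
- by exists v1; rewrite // /= ffunE.
- by exists v1; rewrite // /= ffunE.
Qed.

(** Each nonzero column occurs on at least two legs, which is why multiplicities start at two: two
    words then differ outside any given leg, as [wf_dist] requires. *)
Let separate2 h j j' i0 : j != j' -> exists2 i, i != i0 & bit (col h i) j != bit (col h i) j'.
Proof.
move=> /separate[v vn vb].
(* Of the copies 0 and 1 of the column, one that differs from the copy in [i0]. *)
pose a : 'I_u.+2 := if i0.2 == 0 :> nat then inord 1 else ord0.
have a2 : a < 2 by rewrite /a; case: ifP => // _; rewrite inordK.
exists (v, a); last by rewrite col_low.
apply/eqP => e; have : i0.2 = a :> nat by rewrite -e.
rewrite /a; case: eqP => [->|h'] ; first by rewrite inordK.
by move=> h''; apply: h'; rewrite h''.
Qed.

Let flip (x : B) : B := (x.1, ~~ x.2).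
Let flipK : involutive flip. Proof. by case=> i b; rewrite /flip /= negbK. Qed.
Let flip_neq x : flip x != x.
Proof. by case: x => i b; rewrite /flip xpair_eqE /= eqxx; case: b. Qed.

Let word_flip h j x : (flip x \in word h j) = (x \notin word h j).
Proof. by rewrite !inE /=; case: x.2; case: (bit _ _). Qed.

Let word_inj h : injective (word h).
Proof.
move=> j j' e; apply/eqP/negPn/negP => ne.
have i0 : J := (v0, ord0); have [i _ ib] := separate2 h i0 ne.
move/setP: e => /(_ (i, bit (col h i) j)); rewrite !inE /= eqxx => /esym.
by rewrite (negPf ib).
Qed.

Let sigma h : spikelike B :=
  Spikelike setT flip set0 true true [set word h j | j : I].

Let sigma_legs h : all_legs (sigma h).
Proof.
split; [ | |by []|by []|exact: flip_neq|by []|by []].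
- split=> //=.
  + by move=> x; rewrite inE.
  + by move=> x; rewrite inE.
  + move=> w /imsetP[j _ ->]; apply/and3P; split.
    * by apply/subsetP => x _; rewrite !inE.
    * apply/spansP => x _ _; rewrite /= word_flip.
      by case: (x \in word h j); auto.
    * apply/eqP/setP => x; rewrite [RHS]inE; apply/negP => /fullP[xw].
      by rewrite /= word_flip xw.
  + move=> w x /imsetP[j _ ->] xw _; apply/negP => /imsetP[j' _ e].
    have xw' : x \notin word h j'.
      by rewrite -e !inE eqxx /= orbF eq_sym flip_neq.
    have jj : j != j' by apply: contraNneq xw' => <-.
    have [i ix ib] := separate2 h x.1 jj.
    move/setP: e => /(_ (i, bit (col h i) j)).
    have n1 : ((i, bit (col h i) j) == flip x) = false.
      by apply/negP => /eqP [e' _]; rewrite e' eqxx in ix.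
    have n2 : (i, bit (col h i) j) != x.
      by apply/eqP => e'; rewrite -e' eqxx in ix.
    by rewrite in_setU1 in_setD1 n1 n2 !inE /= eqxx (negPf ib).
- by apply/card_gt0P; exists ((v0, ord0), true).
Qed.

Let ev : 'I_#|{: B}| -> B := enum_val.
Let ev_inj : injective ev. Proof. exact: enum_val_inj. Qed.

Let tau h := pull ev (sigma h).

Let ev_ground h y : (y \in ground (sigma h)) = (y \in codom ev).
Proof. by rewrite inE; symmetry; apply/codomP; exists (enum_rank y); rewrite /ev enum_rankK. Qed.

Let tau_legs h : all_legs (tau h).
Proof.
have L := sigma_legs h; have W := al_wf L; split=> //.
- exact: (pull_wf ev_inj W (ev_ground h)).
- by rewrite card_ord; exact: al_inhabited L.
- by apply/setP => x; rewrite !inE.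
- move=> x; apply/eqP => e; have := pull_mate ev_inj W (ev_ground h) x.
  by rewrite e => h'; have := al_mate L (ev x); rewrite h' eqxx.
Qed.

Let wrd h j : {set 'I_#|{: B}|} := ev @^-1: word h j.

Let ev_wrd h j : ev @: wrd h j = word h j.
Proof.
apply/setP => x; apply/imsetP/idP => [[y]|xw]; first by rewrite inE => ? ->.
by exists (enum_rank x); [rewrite in_set /ev enum_rankK|rewrite /ev enum_rankK].
Qed.

Let tau_words h : words (tau h) = [set wrd h j | j : I].
Proof.
apply/setP => X; rewrite inE; apply/imsetP/imsetP => -[j _ e]; exists j => //.
  by apply: (imset_inj ev_inj); rewrite e ev_wrd.
by rewrite e ev_wrd.
Qed.

Let wrd_inj h : injective (wrd h).
Proof. by move=> j j' e; apply: (@word_inj h); rewrite -!ev_wrd e. Qed.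

Let fam h := spike_matroid (tau_legs h).

Let card_B : #|{: B}| = 2 ^ k * u.+2 * 2.
Proof. by rewrite !card_prod card_ffun !card_bool !card_ord. Qed.

Hypothesis big : 20 <= 2 ^ k * u.+2 * 2.

Let fam_excluded h : excluded_minor (spike_minor_class k) (fam h).
Proof.
apply: excluded_spike.
- by rewrite card_ord card_B.
- rewrite tau_words card_imset; last exact: wrd_inj.
  by rewrite card_option card_ord.
- move=> x; suff [j hj] : exists j, x \in wrd h j.
    by exists (wrd h j); rewrite // tau_words imset_f.
  case: (boolP (ev x).2) => b; last by exists None; rewrite !inE /= (negPf b).
  case: (pickP (col h (ev x).1)) => [a ca|no].
    by exists (Some a); rewrite !inE /= b ca.
  have /eqP[] := col_neq0 h (ev x).1.
  by apply/ffunP => a; rewrite [RHS]ffunE no.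
Qed.

(** An isomorphism invariant up to renaming of the words; at the pattern [ext v] it recovers the
    multiplicity of the column [v]. *)
Let cnt h (q : {ffun I -> bool}) : nat :=
  #|[set y | [forall j, (y \in wrd h j) == q j]]|.

Let ext v : {ffun I -> bool} := [ffun j => bit v j].

Let card_lt m : m <= u.+2 -> #|[set a : 'I_u.+2 | a < m]| = m.
Proof.
move=> mu; rewrite -[RHS]card_ord -cardsT.
have wi : injective (@widen_ord _ _ mu) by move=> a b /(congr1 val) /= /val_inj.
rewrite -(card_imset _ wi); congr #|pred_of_set _|; apply/setP => a; rewrite inE.
apply/idP/imsetP => [am|[b _ ->]]; last exact: (ltn_ord b).
by exists (Ordinal am); rewrite ?inE//; apply: val_inj.
Qed.

Let cnt_mult h (v' : V') : cnt h (ext (val v')) = (h v').+2.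
Proof.
set v := val v'; have /andP[vn0 vn1] : (v != v0) && (v != v1) := valP v'.
have mv : mult h v = h v' by rewrite /mult /v valK.
rewrite -(card_lt (m := (h v').+2)); last by have := ltn_ord (h v').
pose emb (a : 'I_u.+2) : 'I_#|{: B}| := enum_rank (((v, a), true) : B).
have ei : injective emb by move=> a b /enum_rank_inj [].
rewrite -(card_imset _ ei); congr #|pred_of_set _|; apply/setP => y.
apply/idP/imsetP => [|[a]].
  rewrite inE => /forallP yq.
  have b1 : (ev y).2.
    by have := yq None; rewrite !inE ffunE /= eqbF_neg; case: (ev y).2.
  have cv : col h (ev y).1 = v.
    apply/ffunP => a; have := yq (Some a); rewrite !inE ffunE /= b1.
    by case: (col _ _ _); case: (v a).
  move: cv; rewrite /col; case: ifP => [/andP[_ lt] e1|_ e1]; last first.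
    by rewrite e1 eqxx in vn1.
  exists (ev y).1.2; first by rewrite inE -mv -e1.
  rewrite /emb -[LHS]enum_valK; congr enum_rank.
  by move: b1 e1; rewrite /ev; case: (enum_val y) => -[v2 a] b /= -> <-.
rewrite inE -mv => lt ->; rewrite inE; apply/forallP => j.
rewrite !inE /ev /emb enum_rankK /= ffunE /col /= vn0 lt /=.
by case: (bit v j).
Qed.

(** By uniqueness an isomorphism maps words to words, hence permutes their indices. *)
Let iso_cnt h h' : matroid_iso (fam h) (fam h') ->
  exists p : {ffun I -> I}, forall q, cnt h' q = cnt h [ffun j => q (p j)].
Proof.
case=> f fb fM; have finj := bij_inj fb.
have [_ gh hM] := spike_matroid_represents (tau_legs h).
have [_ gh' hM'] := spike_matroid_represents (tau_legs h').
have W := al_wf (tau_legs h); have W' := al_wf (tau_legs h').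
have gf y : (y \in ground (tau h')) = (y \in codom f).
  rewrite inE; symmetry; apply/codomP; case: fb => g _ gK; by exists (g y).
have Wp := pull_wf finj W' gf.
have SS (X : {set 'I_#|{: B}|}) : X \subset ground (tau h) ->
    sindep (tau h) X = sindep (pull f (tau h')) X.
  by move=> _; rewrite (pull_sindep finj W' gf) -hM' fM hM.
have sub : words (tau h) \subset words (pull f (tau h')).
  apply: (unique_words W Wp _ SS) => //.
  by rewrite all_legs_legs; [rewrite cardsT card_ord card_B|exact: tau_legs].
have ex j : exists j', f @: wrd h j = wrd h' j'.
  have : wrd h j \in words (tau h) by rewrite tau_words imset_f.
  by move/(subsetP sub); rewrite inE tau_words => /imsetP[j' _ ->]; exists j'.
have [p0 pE] := choice ex.
have p0i : injective p0.
  move=> j j' e; apply: (@wrd_inj h); apply: (imset_inj finj).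
  by rewrite !pE e.
have [p0' pK p0'K] := injF_bij p0i.
exists [ffun j => p0 j] => q; rewrite /cnt -[RHS](card_imset _ finj).
congr #|pred_of_set _|; case: fb => g fK gK; apply/setP => y.
rewrite -[y]gK (mem_imset _ _ finj) !inE.
have mem j : (f (g y) \in wrd h' (p0 j)) = (g y \in wrd h j).
  by rewrite -pE (mem_imset _ _ finj).
apply/forallP/forallP => H j.
  by have := H (p0 j); rewrite mem !ffunE.
by have := H (p0' j); rewrite !ffunE -mem p0'K.
Qed.

Let cnt_inj h h' : (forall q, cnt h q = cnt h' q) -> h = h'.
Proof.
move=> H; apply/ffunP => v'; apply: val_inj.
by have := H (ext (val v')); rewrite !cnt_mult => -[].
Qed.

(** Given [h], the renaming [p] determines all counts of [h'] and so [h'] itself. There are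
    [k.+1 ^ k.+1] maps on the indices; the extra one is the value [None] of [pick]. *)
Let fiber h : #|[set h' | `[< matroid_iso (fam h) (fam h') >]]| <= (k.+1 ^ k.+1).+1.
Proof.
pose g h' := [pick p : {ffun I -> I} |
  [forall q : {ffun I -> bool}, cnt h' q == cnt h [ffun j => q (p j)]]].
have gP h' : matroid_iso (fam h) (fam h') -> exists2 p, g h' = Some p &
    forall q, cnt h' q = cnt h [ffun j => q (p j)].
  case/iso_cnt => p pq; rewrite /g; case: pickP => [p' /forallP H|/(_ p)].
    by exists p' => // q; apply/eqP.
  by move/negbT/negP; case; apply/forallP => q; rewrite pq.
rewrite -(card_in_imset (f := g)); last first.
  move=> a b; rewrite !inE => /asboolP/gP[p ga pa] /asboolP/gP[p' gb pb].
  rewrite ga gb => -[e]; subst p'; apply: cnt_inj => q; by rewrite pa pb.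
apply: leq_trans (max_card _) _.
by rewrite card_option card_ffun card_option card_ord.
Qed.

Lemma num_excluded_ge : u.+1 ^ (2 ^ k - 2) <=
  num_iso_classes (excluded_minor (spike_minor_class k)) (2 ^ k * u.+2 * 2)
    * (k.+1 ^ k.+1).+1.
Proof.
have cV : #|{: V'}| = 2 ^ k - 2.
  rewrite card_sig.
  have -> : #|[pred v : V | (v != v0) && (v != v1)]| = #|~: [set v0; v1]|.
    by apply: eq_card => v; rewrite !inE negb_or.
  have := cardsC [set v0; v1]; rewrite cards2 eq_sym v10 card_ffun card_bool card_ord.
  by move=> <-; rewrite addKn.
rewrite -card_B -cV -[X in X ^ _]card_ord -card_ffun.
exact: (num_iso_classes_ge fam_excluded fiber).
Qed.

End Family.

(** * Fractality *)

Lemma num_iso_classes0 (P : matroid_class) n :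
  (forall M : matroid 'I_n, ~ P _ M) -> num_iso_classes P n = 0.
Proof.
move=> H; apply/eqP; rewrite /num_iso_classes cards_eq0 /equivalence_partition.
have -> : [set M : matroid 'I_n | `[< P _ M >]] = set0.
  by apply/setP => M; rewrite !inE; apply/asboolP; exact: H.
by rewrite imset0.
Qed.

(** The excluded minors grow with exponent at least [2 ^ k.+1 - 2] and the class with at most
    [2 ^ k + 3]. The difference of at least one leaves the factor [u.+1]. *)
Lemma spike_minors_dominated k : 4 <= k -> exists C, forall u,
  let n := 2 ^ k.+1 * u.+2 * 2 in
  let m := num_iso_classes (spike_minor_class k.+1) n in
  let x := num_iso_classes (excluded_minor (spike_minor_class k.+1)) n in
  0 < x /\ m * u.+1 <= C * x.
Proof.
(* With this [c], [n.+1 <= c * u.+1], so that both bounds become powers of [u.+1]. *)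
move=> k4; pose c := 2 ^ k.+1 * 6; pose p := 2 ^ k + 3.
pose K := (k.+2 ^ k.+2).+1.
have h16 : 16 <= 2 ^ k by rewrite -[16]/(2 ^ 4) leq_exp2l.
exists (c ^ p * 8 * K) => u n m x.
have big : 20 <= 2 ^ k.+1 * u.+2 * 2 by rewrite expnS; nia.
have ge := num_excluded_ge (isT : 0 < k.+1) big; rewrite -/n -/x -/K in ge.
have le := num_spike_minors_le n k; rewrite -/m -/p in le.
split.
  rewrite lt0n; apply/eqP => x0; move: ge; rewrite x0 mul0n leqn0 expn_eq0.
  by [].
have nc : n.+1 <= c * u.+1.
  rewrite /n /c; have : 0 < 2 ^ k.+1 by rewrite expn_gt0.
  by nia.
have le2 : m <= (c * u.+1) ^ p * 8.
  by apply: leq_trans le _; rewrite leq_mul2r /= leq_exp2r // /p addn3.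
have pe : u.+1 ^ p.+1 <= u.+1 ^ (2 ^ k.+1 - 2).
  by rewrite leq_pexp2l // /p expnS; lia.
apply: (@leq_trans (c ^ p * 8 * u.+1 ^ p.+1)).
  apply: (leq_trans (leq_mul le2 (leqnn _))).
  by rewrite expnMn expnSr; apply: eq_leq; lia.
apply: (@leq_trans (c ^ p * 8 * (x * K))); last by apply: eq_leq; lia.
by rewrite leq_mul2l (leq_trans pe ge) orbT.
Qed.

Lemma spike_minor_class_weakly_fractal (R : realType) k : 4 <= k ->
  weakly_fractal R (spike_minor_class k.+1).
Proof.
move=> k4; have [C HC] := spike_minors_dominated k4.
have pos : 0 < 2 ^ k.+1 by rewrite expn_gt0.
exists (fun u => 2 ^ k.+1 * u.+2 * 2); split.
- move=> a b /=; rewrite leEnat leq_pmul2r// leq_pmul2l//.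
- by rewrite !muln_gt0 pos.
(* The deficit of [Gamma] from 1 is [m / (m + x)], which is at most [C * harmonic u]. *)
have lower : ((fun u => 1 - C%:R * harmonic u : R)%R @ \oo --> (1 : R)%R)%classic.
  have c1 : ((fun _ : nat => 1 : R)%R @ \oo --> (1 : R)%R)%classic by exact: cvg_cst.
  have cC : ((fun _ : nat => C%:R : R)%R @ \oo --> (C%:R : R)%R)%classic by exact: cvg_cst.
  have := cvgB c1 (cvgM cC (@cvg_harmonic R)); rewrite mulr0 subr0; exact.
apply: (@squeeze_cvgr _ _ _ _ (fun u => 1 - C%:R * harmonic u : R)%R (fun=> 1 : R)%R);
  [|exact: lower|exact: cvg_cst].
apply: nearW => u; have [x0 mx] := HC u; rewrite /Gamma.
set m := num_iso_classes (spike_minor_class _) _ in mx *.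
set x := num_iso_classes (excluded_minor _) _ in x0 mx *.
have mx0 : (0 < (m + x)%:R :> R)%R by rewrite ltr0n addn_gt0 x0 orbT.
rewrite ler_pdivlMr// ler_pdivrMr// mul1r ler_nat leq_addl andbT.
have key : (m%:R <= C%:R * harmonic u * (m + x)%:R :> R)%R.
  rewrite /harmonic /= mulrAC ler_pdivlMr ?ltr0n// -!natrM ler_nat.
  by apply: leq_trans mx _; rewrite leq_mul2l leq_addl orbT.
rewrite mulrBl mul1r lerBlDr {1}natrD [X in (X <= _)%R]addrC lerD2l.
exact: key.
Qed.

Lemma spike_minor_class_not_strongly_fractal (R : realType) k :
  ~ strongly_fractal R (spike_minor_class k).
Proof.
move=> /cvgrPdist_lt /(_ 1%R ltr01) [N _ HN].
(* An odd size beyond [N] and at least 101: there is no excluded minor, and [Gamma] is 0. *)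
pose n := (N + 50).*2.+1.
have Nn : (N <= n)%N by rewrite /n; lia.
have := HN n Nn; rewrite /Gamma num_iso_classes0; last first.
  move=> M exM; have := odd_excluded_minor_small exM; rewrite card_ord /n /= odd_double.
  by move=> /(_ isT); lia.
by rewrite mul0r subr0 normr1 ltxx.
Qed.

Theorem theorem1p5 (R : realType) (k : nat) (hk : 5 <= k) :
  weakly_fractal R (spike_minor_class k) /\
  ~ strongly_fractal R (spike_minor_class k).
Proof.
split; last exact: spike_minor_class_not_strongly_fractal.
by case: k hk => [//|k] k4; exact: spike_minor_class_weakly_fractal.
Qed.
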